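(* Let $\{(f^{n+\frac12})\}_{n=0}^{N_t-1}$ be the cell averages $f^{n+\frac12}=\frac1{\Delta t}\int_{t^n}^{t^{n+1}}f(s)\,ds$ of $f\in L^2(0,T;L^2(\Omega)^3)$. Given $(E_h^n,B_h^n)\in\mathcal N_h^0\times\mathcal{RT}_h$, the Crank--Nicolson step: find $(E_h^{n+1},B_h^{n+1})\in\mathcal N_h^0\times\mathcal{RT}_h$ such that for all $(\psi_h,\phi_h)\in\mathcal N_h^0\times\mathcal{RT}_h$ $$(\varepsilon\,\delta_tE_h^{n+1},\psi_h)+(\sigma E_h^{n+\frac12},\psi_h)-(\mu^{-1}B_h^{n+\frac12},\operatorname{curl}\psi_h)=(f^{n+\frac12},\psi_h),\qquad (\delta_tB_h^{n+1},\phi_h)+(\operatorname{curl}E_h^{n+\frac12},\phi_h)=0,$$ admits a unique solution, and the solution depends continuously on the data $(E_h^n,B_h^n,f^{n+\frac12})$. Moreover, for the discrete energy $\mathcal E^n:=\tfrac12\big(\|\varepsilon^{1/2}E_h^n\|_{L^2(\Omega)}^2+\|\mu^{-1/2}B_h^n\|_{L^2(\Omega)}^2\big)$ the exact balance $$\frac{\mathcal E^{n+1}-\mathcal E^n}{\Delta t}+\|\sqrt\sigma\,E_h^{n+\frac12}\|_{L^2(\Omega)}^2=(f^{n+\frac12},E_h^{n+\frac12})$$ holds for every $n$. In particular, if $f\equiv0$ then the scheme is energy-dissipative, i.e. $\mathcal E^{n+1}\le\mathcal E^n$ (and strictly conservative, $\mathcal E^{n+1}=\mathcal E^n$, when $\sigma\equiv0$).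 Finally, there exists a constant $C_T>0$ depending only on $T$, the ellipticity bounds of $\varepsilon,\mu$, and $\|\varepsilon\|_{L^\infty}$, $\|\mu^{-1}\|_{L^\infty}$ (but not on $h,\Delta t$), such that for all $m=1,\dots,N_t$, $$\mathcal E^m+\Delta t\sum_{n=0}^{m-1}\|\sqrt\sigma\,E_h^{n+\frac12}\|_{L^2(\Omega)}^2\le C_T\Big(\mathcal E^0+\sum_{n=0}^{m-1}\Delta t\,\|\varepsilon^{-1/2}f^{n+\frac12}\|_{L^2(\Omega)}^2\Big).$$
   Context: $\Omega\subset\mathbb R^3$ is a bounded Lipschitz domain with outward unit normal $\nu$, and $T>0$. $(\cdot,\cdot)$ is the $L^2(\Omega)$ inner product (scalar or vector). The tensors $\varepsilon,\mu,\sigma\in L^\infty(\Omega;\mathbb R^{3\times3})$ are symmetric; there are $\varepsilon_0,\mu_0>0$ with $\xi^\top\varepsilon(x)\xi\ge\varepsilon_0|\xi|^2$ and $\xi^\top\mu(x)\xi\ge\mu_0|\xi|^2$ for a.e. $x\in\Omega$ and all $\xi\in\mathbb R^3$; $\sigma$ is positive semidefinite. Discrete spaces: $\{\mathcal T_h\}_h$ is a family of shape-regular meshes of $\Omega$ and $k\ge0$ a fixed polynomial degree. $\mathcal N_h=\{v_h\in H(\operatorname{curl};\Omega): v_h|_K\in\mathcal N_k(K)\ \forall K\in\mathcal T_h\}$, where $\mathcal N_k(K)$ is the local Nédélec space of the first kind of degree $k$ (convention: $\mathbb P_k(K)^3\subset\mathcal N_k(K)$); $\mathcal N_h^0=\mathcal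 N_h\cap H_0(\operatorname{curl};\Omega)$ with $H_0(\operatorname{curl};\Omega)=\{v\in H(\operatorname{curl};\Omega): v\times\nu=0\text{ on }\partial\Omega\}$. $\mathcal{RT}_h=\{w_h\in H(\operatorname{div};\Omega): w_h|_K\in\mathcal{RT}_k(K)\ \forall K\}$, where $\mathcal{RT}_k(K)$ is the local Raviart--Thomas space of degree $k$. These satisfy $\operatorname{curl}\mathcal N_h^0\subset\mathcal{RT}_h$. Time grid: $N_t\in\mathbb N$, $\Delta t=T/N_t$, $t^n=n\Delta t$. For sequences, $\delta_tg^{n+1}=(g^{n+1}-g^n)/\Delta t$ and $g^{n+\frac12}=\tfrac12(g^{n+1}+g^n)$ (for $E_h$, $B_h$), $n=0,\dots,N_t-1$. *)

(* Defs.v *)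
From HB Require Import structures.
From mathcomp Require Import all_boot all_order all_algebra.
From mathcomp Require Import all_classical all_reals all_analysis.
From mathcomp Require Import ess_sup_inf.

Set Implicit Arguments.
Unset Strict Implicit.
Unset Printing Implicit Defensive.

Import Order.TTheory GRing.Theory Num.Theory.
Import numFieldNormedType.Exports.

Local Open Scope classical_set_scope.
Local Open Scope ring_scope.

(* The space R^3 is the iterated product, so that its
   Borel sigma-algebra is the domain of the product Lebesgue measure, while its
   topology and norm are those of R * R * R (measurableTypeR R unfolds to R).
   Vector values live in 'cV[R]_3.  Fields are total functions on R^3; only
   their values almost everywhere on Omega matter. *)
Notation space3 R :=
  (measurableTypeR R * measurableTypeR R * measurableTypeR R)%type.
Notation vfield R := (space3 R -> 'cV[R]_3).
Notation leb3 R :=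
  (@lebesgue_measure R \x @lebesgue_measure R \x @lebesgue_measure R)%E.

Section Euclidean.
Variable R : realType.
Implicit Types (x : space3 R) (u v : 'cV[R]_3) (A : 'M[R]_3).

Definition vec x : 'cV[R]_3 := \col_i ([:: x.1.1; x.1.2; x.2] : seq R)`_i.

Definition std_basis (i : 'I_3) : space3 R :=
  ((i == 0 :> nat)%:R : R, (i == 1 :> nat)%:R : R, (i == 2 :> nat)%:R : R).

Definition dot u v : R := \sum_i u i 0 * v i 0.

Definition enorm u : R := Num.sqrt (dot u u).

Definition psdmx A := forall xi : 'cV[R]_3, 0 <= dot xi (A *m xi).

(* The symmetric positive semidefinite square root; it exists and is unique
   when A is symmetric positive semidefinite. *)
Definition sqrtmx A : 'M[R]_3 :=
  xget 0 [set S | [/\ S^T = S, psdmx S & S *m S = A]].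

End Euclidean.

Section Domain.
Variable R : realType.
Implicit Types (O : set (space3 R)).

(* Near each boundary point, up to a linear isometry Q, O is the region lying
   strictly above the graph of a Lipschitz function of two variables. *)
Definition lipschitz_boundary O :=
  forall x0, closure O x0 -> ~ O x0 ->
  exists r : R, exists Q : 'M[R]_3, exists g : R -> R -> R, exists L : R,
    [/\ 0 < r, Q^T *m Q = 1%:M,
        forall a b c d, `|g a b - g c d| <= L * (`|a - c| + `|b - d|)
      & forall x, enorm (vec (x - x0)) < r ->
          let y := Q *m vec (x - x0) in
          O x <-> g (y 0 0) (y 1 0) < y 2 0].

Definition bounded_lipschitz_domain O :=
  [/\ open O, connected O, O !=set0, bounded_set O & lipschitz_boundary O].

End Domain.

Section L2.
Variable R : realType.
Implicit Types (O : set (space3 R)) (u v : vfield R).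

Definition scalarL2 O (g : space3 R -> R) :=
  measurable_fun O g /\
  (leb3 R).-integrable O (EFin \o (fun x => g x ^+ 2)).

Definition vectorL2 O : set (vfield R) :=
  [set u | forall i, scalarL2 O (fun x => u x i 0)].

Definition ip O u v : R := \int[leb3 R]_(x in O) dot (u x) (v x).

Definition L2norm O u : R := Num.sqrt (ip O u u).

Definition ae_eq_on O u v := {ae leb3 R, forall x, O x -> u x = v x}.

End L2.

Section Tensors.
Variable R : realType.
Implicit Types (O : set (space3 R)) (M : space3 R -> 'M[R]_3).

Definition tapp M (u : vfield R) : vfield R := fun x => M x *m u x.

Definition tinv M := fun x => invmx (M x).

Definition tsqrt M := fun x => sqrtmx (M x).

(* `|M x| is the library norm on matrices (largest absolute value of an entry);
   the function is extended by 0 outside O. *)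
Definition tensor_esssup O M : \bar R :=
  ess_sup (leb3 R) ((fun x => (`|M x|)%:E) \_ O).

Definition tensorLinf O M :=
  (forall i j, measurable_fun O (fun x => M x i j)) /\
  (tensor_esssup O M < +oo)%E.

Definition Linf_norm O M : R := fine (tensor_esssup O M).

Definition tensor_sym O M := {ae leb3 R, forall x, O x -> (M x)^T = M x}.

Definition tensor_elliptic O (c : R) M :=
  {ae leb3 R, forall x, O x ->
    forall xi : 'cV[R]_3, c * enorm xi ^+ 2 <= dot xi (M x *m xi)}.

Definition tensor_psd O M := {ae leb3 R, forall x, O x -> psdmx (M x)}.

End Tensors.

Section DifferentialOperators.
Variable R : realType.
Implicit Types (O : set (space3 R)) (u v phi : vfield R).

Definition partial (i : 'I_3) (f : space3 R -> R) : space3 R -> R :=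
  fun x => 'D_(std_basis R i) f x.

Definition smooth (f : space3 R -> R) := forall s : seq 'I_3,
  continuous (foldr partial f s) /\
  (forall i x, derivable (foldr partial f s) x (std_basis R i)).

Definition vsmooth phi := forall i, smooth (fun x => phi x i 0).

Definition compactly_supported_in (V : nmodType) O (f : space3 R -> V) :=
  exists K : set (space3 R),
    [/\ compact K, K `<=` O & forall x, ~ K x -> f x = 0].

Definition grad (f : space3 R -> R) : vfield R :=
  fun x => \col_i partial i f x.

(* Indices are added in 'I_3, that is, modulo 3. *)
Definition curl phi : vfield R := fun x => \col_i
  (partial (i + 1) (fun y => phi y (i + 2) 0) x -
   partial (i + 2) (fun y => phi y (i + 1) 0) x).

Definition weak_curl O u g := forall phi,
  vsmooth phi -> compactly_supported_in O phi ->
  ip O u (curl phi) = ip O g phi.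

Definition weak_div O u (g : space3 R -> R) := forall f : space3 R -> R,
  smooth f -> compactly_supported_in O f ->
  ip O u (grad f) = - \int[leb3 R]_(x in O) (g x * f x).

Definition Hcurl O : set (vfield R) :=
  [set u | vectorL2 O u /\ exists2 g, vectorL2 O g & weak_curl O u g].

Definition wcurl O u : vfield R :=
  xget (fun=> 0) [set g | vectorL2 O g /\ weak_curl O u g].

(* The trace u x nu on the boundary, defined for u in H(curl) as a functional by
   Green's formula:
     <u x nu, phi> = int_O u . curl phi - int_O curl u . phi. *)
Definition tangential_trace O u phi : R :=
  ip O u (curl phi) - ip O (wcurl O u) phi.

Definition H0curl O : set (vfield R) :=
  [set u | Hcurl O u /\ forall phi, vsmooth phi -> tangential_trace O u phi = 0].

Definition Hdiv O : set (vfield R) :=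
  [set u | vectorL2 O u /\ exists2 g, scalarL2 O g & weak_div O u g].

End DifferentialOperators.

Section Polynomials.
Variable R : realType.

(* Functions of the form sum_a c_a x^a, over multi-indices a : 'I_3 -> {0,..,k}
   whose total degree satisfies D. *)
Definition polyfun (k : nat) (D : pred nat) : set (space3 R -> R) :=
  [set p | exists c : {ffun 'I_3 -> 'I_k.+1} -> R, forall x, p x =
    \sum_(a : {ffun 'I_3 -> 'I_k.+1} | D (\sum_i a i)%N)
      c a * \prod_i vec x i 0 ^+ a i].

Definition poly_le k := polyfun k (fun d => (d <= k)%N).

Definition poly_homog k := polyfun k (fun d => d == k).

Definition vpoly_le k : set (vfield R) :=
  [set p | forall i, poly_le k (fun x => p x i 0)].

Definition vpoly_homog k : set (vfield R) :=
  [set p | forall i, poly_homog k (fun x => p x i 0)].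

(* P_k^3 + {s homogeneous of degree k+1 with s(x) . x = 0} *)
Definition nedelec k : set (vfield R) :=
  [set q | exists p s, [/\ vpoly_le k p, vpoly_homog k.+1 s,
     forall x, dot (s x) (vec x) = 0 & q = p + s]].

(* P_k^3 + x * {homogeneous of degree k} *)
Definition raviart_thomas k : set (vfield R) :=
  [set q | exists p s, [/\ vpoly_le k p, poly_homog k s &
     q = fun x => p x + s x *: vec x]].

End Polynomials.

Section Meshes.
Variable R : realType.
Implicit Types (O K : set (space3 R)) (T : set (set (space3 R))).

Definition tetrahedron (v : 'I_4 -> space3 R) : set (space3 R) :=
  [set x | exists l : 'I_4 -> R,
    [/\ forall i, 0 <= l i, \sum_i l i = 1 & vec x = \sum_i l i *: vec (v i)]].

Definition is_mesh O T :=
  [/\ finite_set T,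
      forall K, T K -> [/\ exists v, K = tetrahedron v,
        interior K !=set0 & interior K `<=` O],
      closure O = \bigcup_(K in T) K
    & forall K K', T K -> T K' -> K <> K' ->
        interior K `&` interior K' = set0].

Definition diameter K : R :=
  sup [set d | exists x y, [/\ K x, K y & d = enorm (vec (x - y))]].

Definition inball_diameter K : R :=
  sup [set d | exists c, exists r, [/\ 0 <= r, d = 2 * r &
    forall x, enorm (vec (x - c)) <= r -> K x]].

Definition shape_regular (I : Type) (T : I -> set (set (space3 R))) :=
  exists kappa : R, forall h K, T h K ->
    diameter K <= kappa * inball_diameter K.

Definition nedelec_space O T k : set (vfield R) :=
  [set v | Hcurl O v /\ forall K, T K -> exists2 q, nedelec k q &
    {ae leb3 R, forall x, K x -> v x = q x}].

Definition nedelec_space0 O T k : set (vfield R) :=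
  nedelec_space O T k `&` H0curl O.

Definition raviart_thomas_space O T k : set (vfield R) :=
  [set w | Hdiv O w /\ forall K, T K -> exists2 q, raviart_thomas k q &
    {ae leb3 R, forall x, K x -> w x = q x}].

End Meshes.

Section Bochner.
Variable R : realType.
Implicit Types (O : set (space3 R)) (f : R -> vfield R).

(* A simple function is given by finitely many pairs (A, v) and stands for
   sum 1_A(t) v. *)
Notation simple_fun := (seq (set (measurableTypeR R) * vfield R)).

Definition is_simple O (a b : R) (s : simple_fun) :=
  forall n, (n < size s)%N -> let p := nth (set0, fun=> 0) s n in
  [/\ measurable p.1, p.1 `<=` `]a, b[ & vectorL2 O p.2].

Definition simple_eval (s : simple_fun) (t : R) : vfield R :=
  \sum_(p <- s) (\1_(p.1) t : R) *: p.2.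

Definition simple_integral (s : simple_fun) : vfield R :=
  \sum_(p <- s) fine (@lebesgue_measure R p.1) *: p.2.

Definition strongly_measurable O (a b : R) f :=
  exists s : nat -> simple_fun, (forall j, is_simple O a b (s j)) /\
    {ae @lebesgue_measure R, forall t, t \in `]a, b[ ->
      (fun j => L2norm O (f t - simple_eval (s j) t)) @ \oo --> (0 : R)}.

Definition L2_in_time O (T : R) f :=
  [/\ forall t, t \in `]0, T[ -> vectorL2 O (f t),
      strongly_measurable O 0 T f
    & (\int[@lebesgue_measure R]_(t in `]0%R, T[)
         (L2norm O (f t) ^+ 2)%:E < +oo)%E].

Definition is_bochner_integral O (a b : R) f (g : vfield R) :=
  vectorL2 O g /\
  exists s : nat -> simple_fun, [/\ forall j, is_simple O a b (s j),
    ((fun j => \int[@lebesgue_measure R]_(t in `]a, b[)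
        (L2norm O (f t - simple_eval (s j) t))%:E) @ \oo --> 0)%E
    & (fun j => L2norm O (simple_integral (s j) - g)) @ \oo --> (0 : R)].

(* g = (b - a)^-1 int_a^b f *)
Definition is_average O (a b : R) f (g : vfield R) :=
  is_bochner_integral O a b f ((b - a) *: g).

Definition zero_in_time O (T : R) f :=
  {ae @lebesgue_measure R, forall t, t \in `]0, T[ ->
    ae_eq_on O (f t) (fun=> 0)}.

End Bochner.

Section CrankNicolson.
Variable R : realType.
Implicit Types (O : set (space3 R)) (E B g : vfield R).
Implicit Types (eps mu sigma : space3 R -> 'M[R]_3).

Definition dquot (dt : R) (g0 g1 : vfield R) : vfield R := dt^-1 *: (g1 - g0).

Definition midpoint (g0 g1 : vfield R) : vfield R := 2^-1 *: (g1 + g0).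

Definition cn_step O (V W : set (vfield R)) eps mu sigma (dt : R) E0 B0 g E1 B1
    :=
  (forall psi, V psi ->
     ip O (tapp eps (dquot dt E0 E1)) psi
     + ip O (tapp sigma (midpoint E0 E1)) psi
     - ip O (tapp (tinv mu) (midpoint B0 B1)) (wcurl O psi)
     = ip O g psi) /\
  (forall phi, W phi ->
     ip O (dquot dt B0 B1) phi + ip O (wcurl O (midpoint E0 E1)) phi = 0).

Definition energy O eps mu E B : R :=
  2^-1 * (L2norm O (tapp (tsqrt eps) E) ^+ 2
          + L2norm O (tapp (tinv (tsqrt mu)) B) ^+ 2).

End CrankNicolson.

(* Main.v *)
(* A field of the discrete curl-conforming space is polynomial on each tetrahedron,
   whose boundary is negligible, so its weak curl is almost everywhere the piecewise
   classical curl and lies in the Raviart-Thomas space.  Hence the magnetic equation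
   holds pointwise almost everywhere, curl E^{n+1/2} = - delta_t B^{n+1}, and testing
   the electric equation with E^{n+1/2} yields the energy balance.

   Eliminating B^{n+1} leaves a coercive symmetric problem for the midpoint field
   E^{n+1/2} in a space that is finitely generated up to null sets, which gives
   existence.  For the bounds, let y_n be twice the energy plus twice the accumulated
   dissipation.  Cauchy-Schwarz in the eps-weighted product bounds the source term by
   |eps^{-1/2} f| (sqrt y_{n+1} + sqrt y_n), so that
   sqrt y_{n+1} <= sqrt y_n + 2 dt |eps^{-1/2} f|.  No discrete Gronwall lemma is
   needed: this summed over n gives the stability estimate with C_T = 2 + 4 T, and
   applied to a difference of two solutions it gives continuous dependence and
   uniqueness.

   The weak curl is determined up to null sets by tensor products of bumps
   exp(-1/(n(x-a))) exp(-1/(n(b-x))), which increase with n to indicators of boxes. *)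

Require Import Defs.
From HB Require Import structures.
From mathcomp Require Import all_boot all_order all_algebra.
From mathcomp Require Import all_classical all_reals all_analysis.
From mathcomp Require Import measurable_realfun ess_sup_inf spectral sesquilinear.
From mathcomp Require complex.
From mathcomp Require Import ring lra.
Import Order.TTheory GRing.Theory Num.Theory.
Import numFieldNormedType.Exports.
Local Open Scope classical_set_scope.
Local Open Scope ring_scope.

Set Implicit Arguments.
Unset Strict Implicit.
Unset Printing Implicit Defensive.

(** * Square-integrable fields *)

(** [wcurl] is picked by [xget] among the weak curls, so even its linearity holds only off a null
    set, and the scheme is treated through integrals, which do not see null sets. As a set of total
    functions a discrete space is infinite-dimensional: fields may be changed on null sets. Finite
    generation is therefore extracted from the piecewise polynomial coefficients, treated as a
    relation between fields and coefficient vectors, so that their uniqueness never has to be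
    discussed; for the same reason the linear system is solved without an independent basis.

    Norms in time such as that of [f t - simple_eval s t] are not assumed measurable by
    [is_bochner_integral], hence the comparison of integrals without measurability.

    Square roots replace Gronwall because the source enters the balance linearly in [sqrt y], so the
    increments merely add up. The constant then comes from squaring a sum of two terms and from
    Cauchy-Schwarz over the time steps, where the number of steps times [dt] is at most [T]. *)

Section AlmostEverywhere.
Context d (T : measurableType d) (R : realType).
Variable mu : {measure set T -> \bar R}.
Implicit Types (D : set T) (f g : T -> \bar R).

Import HBNNSimple.

(* The functions need not be measurable: multiplying a simple function by the
   indicator of a conull set does not change its integral. *)
Lemma ae_ge0_le_integral_nonmeas D f g :
  (forall x, D x -> (0 <= f x)%E) -> (forall x, D x -> (0 <= g x)%E) ->
  {ae mu, forall x, D x -> (f x <= g x)%E} ->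
  (\int[mu]_(x in D) f x <= \int[mu]_(x in D) g x)%E.
Proof.
move=> f0 g0 [N [mN N0 subN]].
rewrite !ge0_integralE//; apply: ge_ereal_sup => _ /= [h hf <-].
have mNC : measurable (~` N) by exact: measurableC.
have mNT : measurable [set: T] by [].
have eqh : sintegral mu h = sintegral mu (proj_nnsfun h mNC).
  rewrite -[in RHS](mrestrict h mNC) -(integral_nnsfun mu mNC h).
  transitivity (sintegral mu (h \_ setT)); first by rewrite patch_setT.
  rewrite -(integral_nnsfun mu mNT h) (ge0_negligible_integral mN mNT)//.
  - by rewrite setTD.
  - by apply/measurable_EFinP; exact: measurable_funTS.
  - by move=> x _; rewrite lee_fin.
rewrite eqh; apply: ereal_sup_ubound => /=.
exists (proj_nnsfun h mNC) => // x; rewrite -(mrestrict h mNC) /patch.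
case: ifPn => [|_]; last by case: ifPn => // /[!inE] /g0.
rewrite inE => NCx; apply: (le_trans (hf x)); rewrite /patch.
case: ifPn => // /[!inE] Dx.
have /contrapT : ~ ~ (D x -> (f x <= g x)%E) by move=> /subN.
exact.
Qed.

(** Positive and negative parts are compared separately, each in both directions. This serves
    integrands of unknown measurability, such as norms in time. *)
Lemma ae_eq_integral_nonmeas D f g :
  {ae mu, forall x, D x -> f x = g x} ->
  (\int[mu]_(x in D) f x = \int[mu]_(x in D) g x)%E.
Proof.
move=> fg; rewrite integralE [in RHS]integralE.
by congr (_ - _)%E; apply/eqP; rewrite eq_le; apply/andP; split;
  apply: ae_ge0_le_integral_nonmeas => //; apply: filterS fg => x fg Dx;
  rewrite ?(funeposE,funenegE) fg.
Qed.

Lemma ae_eq_Rintegral (D : set T) (f g : T -> R) :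
  {ae mu, forall x, D x -> f x = g x} ->
  \int[mu]_(x in D) f x = \int[mu]_(x in D) g x.
Proof.
move=> fg; congr fine; apply: ae_eq_integral_nonmeas.
by apply: filterS fg => x fg Dx; rewrite fg.
Qed.

Lemma Rintegral_sum (D : set T) (I : Type) (s : seq I) (P : pred I)
    (f : I -> T -> R) : measurable D ->
  (forall i, mu.-integrable D (EFin \o f i)) ->
  \int[mu]_(x in D) (\sum_(i <- s | P i) f i x) =
  \sum_(i <- s | P i) \int[mu]_(x in D) f i x.
Proof.
move=> mD fi; elim: s => [|a s ih].
  under eq_Rintegral do rewrite big_nil.
  by rewrite big_nil /Rintegral integral0.
under eq_Rintegral do rewrite big_cons.
rewrite big_cons; case: (P a) => //.
rewrite RintegralD ?ih//.
rewrite (_ : _ \o _ = fun x => \sum_(i <- s | P i) (EFin \o f i) x)%E; last first.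
  by apply/funext => x /=; rewrite sumEFin.
exact: integrable_sum.
Qed.

Lemma integrable_ae_eq_le (D : set T) (f g : T -> R) : measurable D ->
  measurable_fun D f -> mu.-integrable D (EFin \o g) ->
  {ae mu, forall x, D x -> `|f x| <= g x} ->
  mu.-integrable D (EFin \o f).
Proof.
move=> mD mf ig fg; apply/integrableP; split; first exact/measurable_EFinP.
apply: (@le_lt_trans _ _ (\int[mu]_(x in D) `|(EFin \o g) x|)%E); last first.
  by case/integrableP : ig.
apply: ae_ge0_le_integral_nonmeas => //.
apply: filterS fg => x fg Dx /=; rewrite lee_fin (le_trans (fg Dx))//.
exact: ler_norm.
Qed.

End AlmostEverywhere.

(** * The Euclidean inner product *)

Section Dot.
Variable R : realType.
Implicit Types (u v w : 'cV[R]_3) (A B : 'M[R]_3).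

Lemma dotE u v : dot u v = (u^T *m v) 0 0.
Proof. by rewrite mxE; apply: eq_bigr => i _; rewrite mxE. Qed.

Lemma dotC u v : dot u v = dot v u.
Proof. by apply: eq_bigr => i _; rewrite mulrC. Qed.

Lemma dot_linl a u v w : dot (a *: u + v) w = a * dot u w + dot v w.
Proof.
rewrite /dot mulr_sumr -big_split/=; apply: eq_bigr => i _.
by rewrite !mxE mulrDl mulrA.
Qed.

Lemma dotDl u v w : dot (u + v) w = dot u w + dot v w.
Proof. by rewrite -[u]scale1r dot_linl scale1r mul1r. Qed.

Lemma dotDr u v w : dot w (u + v) = dot w u + dot w v.
Proof. by rewrite dotC dotDl !(dotC w). Qed.

Lemma dotZl a u w : dot (a *: u) w = a * dot u w.
Proof. by rewrite /dot mulr_sumr; apply: eq_bigr => i _; rewrite !mxE mulrA. Qed.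

Lemma dotZr a u w : dot w (a *: u) = a * dot w u.
Proof. by rewrite dotC dotZl dotC. Qed.

Lemma dot0l w : dot 0 w = 0.
Proof. by rewrite -[0](scale0r w) dotZl mul0r. Qed.

Lemma dot0r w : dot w 0 = 0. Proof. by rewrite dotC dot0l. Qed.

Lemma dot_ge0 u : 0 <= dot u u.
Proof. by apply: sumr_ge0 => i _; rewrite -expr2 sqr_ge0. Qed.

Lemma dot_eq0 u : dot u u = 0 -> u = 0.
Proof.
move=> /eqP; rewrite psumr_eq0; last by move=> i _; rewrite -expr2 sqr_ge0.
move=> /allP u0; apply/matrixP => i j; rewrite ord1 mxE.
by have := u0 i (mem_index_enum _); rewrite mulf_eq0 orbb => /eqP.
Qed.

Lemma enorm_sq u : enorm u ^+ 2 = dot u u.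
Proof. by rewrite sqr_sqrtr// dot_ge0. Qed.

Lemma dot_mull A u v : dot (A *m u) v = dot u (A^T *m v).
Proof. by rewrite !dotE trmx_mul mulmxA. Qed.

(** The square of [dot v v *: u - dot u v *: v] expands to [dot v v] times the defect of the
    inequality. *)
Lemma dot_CauchySchwarz u v : dot u v ^+ 2 <= dot u u * dot v v.
Proof.
have [->|v0] := eqVneq v 0; first by rewrite !dot0r expr2 !mulr0.
have vv : 0 < dot v v.
  by rewrite lt_def dot_ge0 andbT; apply: contra_neq v0 => /dot_eq0.
have := dot_ge0 (dot v v *: u - dot u v *: v).
rewrite -scaleNr dotDl !dotDr !dotZl !dotZr (dotC v u) => h.
have {h} : 0 <= dot v v * (dot u u * dot v v - dot u v ^+ 2) by nra.
by rewrite pmulr_rge0// subr_ge0.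
Qed.

End Dot.

Section ScalarL2.
Variable R : realType.
Implicit Types (O : set (space3 R)) (f g : space3 R -> R).
Local Notation mu := (leb3 R).

Lemma scalarL2_mul_integrable O f g : measurable O ->
  scalarL2 O f -> scalarL2 O g -> mu.-integrable O (EFin \o (fun x => f x * g x)).
Proof.
move=> mO [mf f2] [mg g2].
apply: (@integrable_ae_eq_le _ _ _ _ _ _ (fun x => f x ^+ 2 + g x ^+ 2)) => //.
- exact: measurable_funM.
- exact: (integrableD mO f2 g2).
- apply: aeW => x _; rewrite ler_norml; apply/andP; split; nra.
Qed.

Lemma scalarL2_lin O a f g : measurable O ->
  scalarL2 O f -> scalarL2 O g -> scalarL2 O (fun x => a * f x + g x).
Proof.
move=> mO [mf f2] [mg g2].
have mm : measurable_fun O (fun x => a * f x + g x).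
  by apply: measurable_funD => //; exact: measurable_funM.
split => //.
apply: (@integrable_ae_eq_le _ _ _ _ _ _
    (fun x => (2 * a ^+ 2) * f x ^+ 2 + 2 * g x ^+ 2)) => //.
- exact: measurable_funX.
- exact: (integrableD mO (integrableZl mO (2 * a ^+ 2) f2)
                          (integrableZl mO 2 g2)).
- apply: aeW => x _; rewrite ger0_norm ?sqr_ge0//.
  have : 0 <= (a * f x - g x) ^+ 2 by rewrite sqr_ge0.
  nra.
Qed.

Lemma scalarL2_bounded_mul O (C : R) (m f : space3 R -> R) : measurable O -> measurable_fun O m ->
  {ae mu, forall x, O x -> `|m x| <= C} ->
  scalarL2 O f -> scalarL2 O (fun x => m x * f x).
Proof.
move=> mO mm mC [mf f2]; split; first exact: measurable_funM.
apply: (@integrable_ae_eq_le _ _ _ _ _ _ (fun x => C ^+ 2 * f x ^+ 2)) => //.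
- by apply: measurable_funX; exact: measurable_funM.
- exact: (integrableZl mO (C ^+ 2) f2).
- apply: filterS mC => x mC /mC {}mC; rewrite ger0_norm ?sqr_ge0//.
  rewrite exprMn ler_wpM2r ?sqr_ge0// -(real_normK (num_real (m x))).
  by rewrite lerXn2r ?nnegrE// (le_trans _ mC).
Qed.

Lemma scalarL2_0 O : measurable O -> scalarL2 O (fun=> 0).
Proof.
move=> mO; split; first exact: measurable_cst.
rewrite (_ : _ \o _ = cst 0%E); first exact: integrable0.
by apply/funext => x /=; rewrite expr0n.
Qed.

End ScalarL2.

Section VectorL2.
Variable R : realType.
Implicit Types (O : set (space3 R)) (u v w : vfield R).
Local Notation mu := (leb3 R).

Lemma vectorL2_lin O a u v : measurable O ->
  vectorL2 O u -> vectorL2 O v -> vectorL2 O (a *: u + v).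
Proof.
move=> mO uL vL i; have := scalarL2_lin a mO (uL i) (vL i).
by congr scalarL2; apply/funext => x; rewrite !mxE.
Qed.

Lemma vectorL2_0 O : measurable O -> vectorL2 O 0.
Proof.
move=> mO i; have := scalarL2_0 mO.
by congr scalarL2; apply/funext => x; rewrite !mxE.
Qed.

Lemma vectorL2_Z O a u : measurable O -> vectorL2 O u -> vectorL2 O (a *: u).
Proof.
by move=> mO uL; rewrite -[_ *: _]addr0; apply: vectorL2_lin => //; exact: vectorL2_0.
Qed.

Lemma vectorL2_D O u v : measurable O ->
  vectorL2 O u -> vectorL2 O v -> vectorL2 O (u + v).
Proof. by move=> mO uL vL; rewrite -[u]scale1r; exact: vectorL2_lin. Qed.

Lemma vectorL2_B O u v : measurable O ->
  vectorL2 O u -> vectorL2 O v -> vectorL2 O (u - v).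
Proof.
by move=> mO uL vL; rewrite addrC -scaleN1r; exact: vectorL2_lin.
Qed.

Lemma vectorL2_sum O (I : Type) (s : seq I) (F : I -> vfield R) : measurable O ->
  (forall i, vectorL2 O (F i)) -> vectorL2 O (\sum_(i <- s) F i).
Proof.
move=> mO FL; elim: s => [|a s ih]; first by rewrite big_nil; exact: vectorL2_0.
by rewrite big_cons; apply: vectorL2_D.
Qed.

Lemma dot_integrable O u v : measurable O -> vectorL2 O u -> vectorL2 O v ->
  mu.-integrable O (EFin \o (fun x => dot (u x) (v x))).
Proof.
move=> mO uL vL.
pose h (i : 'I_3) (x : space3 R) := (u x i 0 * v x i 0)%:E.
rewrite (_ : _ \o _ = fun x => (\sum_i h i x)%E); last first.
  by apply/funext => x /=; rewrite sumEFin.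
apply: integrable_sum => // i _.
exact: scalarL2_mul_integrable (uL i) (vL i).
Qed.

Lemma ipC O u v : ip O u v = ip O v u.
Proof. by apply: eq_Rintegral => x _; rewrite dotC. Qed.

Lemma ip_linl O a u v w : measurable O ->
  vectorL2 O u -> vectorL2 O v -> vectorL2 O w ->
  ip O (a *: u + v) w = a * ip O u w + ip O v w.
Proof.
move=> mO uL vL wL; rewrite /ip.
rewrite (@eq_Rintegral _ _ _ _ _
  (fun x => a * dot (u x) (w x) + dot (v x) (w x))); last first.
  by move=> x _; rewrite -dot_linl.
rewrite RintegralD//; last 2 first.
- exact: (integrableZl mO a (dot_integrable mO uL wL)).
- exact: dot_integrable.
by rewrite RintegralZl//; exact: dot_integrable.
Qed.

Lemma ip_linr O a u v w : measurable O ->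
  vectorL2 O u -> vectorL2 O v -> vectorL2 O w ->
  ip O w (a *: u + v) = a * ip O w u + ip O w v.
Proof. by move=> *; rewrite ipC ip_linl// !(ipC _ w). Qed.

Lemma ip0l O w : ip O 0 w = 0.
Proof.
rewrite /ip /Rintegral integral0_eq// => x _.
by rewrite (_ : (0 : vfield R) x = 0)// dot0l.
Qed.

Lemma ip0r O w : ip O w 0 = 0. Proof. by rewrite ipC ip0l. Qed.

Lemma ipZl O a u w : measurable O -> vectorL2 O u -> vectorL2 O w ->
  ip O (a *: u) w = a * ip O u w.
Proof.
move=> mO uL wL; rewrite -[_ *: _]addr0 ip_linl//; last exact: vectorL2_0.
by rewrite ip0l addr0.
Qed.

Lemma ipZr O a u w : measurable O -> vectorL2 O u -> vectorL2 O w ->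
  ip O w (a *: u) = a * ip O w u.
Proof. by move=> *; rewrite ipC ipZl// (ipC _ w). Qed.

Lemma ipDl O u v w : measurable O ->
  vectorL2 O u -> vectorL2 O v -> vectorL2 O w ->
  ip O (u + v) w = ip O u w + ip O v w.
Proof. by move=> *; rewrite -[u]scale1r ip_linl// scale1r mul1r. Qed.

Lemma ipDr O u v w : measurable O ->
  vectorL2 O u -> vectorL2 O v -> vectorL2 O w ->
  ip O w (u + v) = ip O w u + ip O w v.
Proof. by move=> *; rewrite ipC ipDl// !(ipC _ w). Qed.

Lemma ipBl O u v w : measurable O ->
  vectorL2 O u -> vectorL2 O v -> vectorL2 O w ->
  ip O (u - v) w = ip O u w - ip O v w.
Proof.
by move=> *; rewrite addrC -scaleN1r ip_linl// mulN1r addrC.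
Qed.

Lemma ipBr O u v w : measurable O ->
  vectorL2 O u -> vectorL2 O v -> vectorL2 O w ->
  ip O w (u - v) = ip O w u - ip O w v.
Proof. by move=> *; rewrite ipC ipBl// !(ipC _ w). Qed.

Lemma ip_suml O (I : Type) (s : seq I) (F : I -> vfield R) w : measurable O ->
  (forall i, vectorL2 O (F i)) -> vectorL2 O w ->
  ip O (\sum_(i <- s) F i) w = \sum_(i <- s) ip O (F i) w.
Proof.
move=> mO FL wL; elim: s => [|a s ih]; first by rewrite !big_nil ip0l.
by rewrite !big_cons ipDl ?ih//; exact: vectorL2_sum.
Qed.

Lemma ip_ge0 O u : 0 <= ip O u u.
Proof. by apply: Rintegral_ge0 => x _; exact: dot_ge0. Qed.

Lemma ip_aeE O u v u' v' : ae_eq_on O u u' -> ae_eq_on O v v' ->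
  ip O u v = ip O u' v'.
Proof.
move=> uu vv; apply: ae_eq_Rintegral.
by apply: filterS2 uu vv => x uu vv Ox; rewrite uu// vv.
Qed.

Lemma ae_eq_on_refl O u : ae_eq_on O u u. Proof. exact: aeW. Qed.

Lemma ip_ael O u u' v : ae_eq_on O u u' -> ip O u v = ip O u' v.
Proof. by move=> h; apply: ip_aeE => //; exact: ae_eq_on_refl. Qed.

Lemma ip_aer O u v v' : ae_eq_on O v v' -> ip O u v = ip O u v'.
Proof. by move=> h; apply: ip_aeE => //; exact: ae_eq_on_refl. Qed.

Lemma ip_eq0 O u : measurable O -> vectorL2 O u -> ip O u u = 0 ->
  ae_eq_on O u 0.
Proof.
move=> mO uL; have iu := dot_integrable mO uL uL.
rewrite /ip /Rintegral => /eqP; rewrite fine_eq0; last first.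
  exact: (integrable_fin_num mO iu).
move=> /eqP uu0.
have /integrableP[mdu _] := iu.
have /(ae_eq_integral_abs _ mO mdu) : (\int[mu]_(x in O) `|(dot (u x) (u x))%:E|)%E = 0%E.
  rewrite -[RHS]uu0; apply: eq_integral => x _.
  by rewrite gee0_abs// lee_fin dot_ge0.
by apply: filterS => x h Ox; apply: dot_eq0; have := h Ox => /= -[].
Qed.

Lemma L2norm_sq O u : L2norm O u ^+ 2 = ip O u u.
Proof. by rewrite sqr_sqrtr// ip_ge0. Qed.

Lemma L2norm_ge0 O u : 0 <= L2norm O u.
Proof. exact: sqrtr_ge0. Qed.

Lemma ip_CauchySchwarz O u v : measurable O -> vectorL2 O u -> vectorL2 O v ->
  `|ip O u v| <= L2norm O u * L2norm O v.
Proof.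
move=> mO uL vL; rewrite -[leLHS]ger0_norm// -ler_sqr ?nnegrE ?mulr_ge0 ?L2norm_ge0//.
rewrite normr_id exprMn !L2norm_sq real_normK ?num_real//.
(* A field of zero norm vanishes only almost everywhere, so [v] is replaced by [0] under the
   integral. *)
have [v0|v0] := eqVneq (ip O v v) 0.
  rewrite (@ip_aer O u v 0); last exact: ip_eq0.
  by rewrite ip0r expr0n/= v0 mulr0.
have vv : 0 < ip O v v by rewrite lt_def ip_ge0 andbT.
have := ip_ge0 O (ip O v v *: u - ip O u v *: v).
have suL := vectorL2_Z (ip O v v) mO uL.
have svL := vectorL2_Z (ip O u v) mO vL.
have dL := vectorL2_B mO suL svL.
rewrite ipBl// !ipBr// !ipZl// !ipZr// (ipC _ v u) => h.
have {h} : 0 <= ip O v v * (ip O u u * ip O v v - ip O u v ^+ 2) by nra.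
by rewrite pmulr_rge0// subr_ge0.
Qed.

Lemma L2norm_triangle O u v : measurable O -> vectorL2 O u -> vectorL2 O v ->
  L2norm O (u + v) <= L2norm O u + L2norm O v.
Proof.
move=> mO uL vL; rewrite -ler_sqr ?nnegrE ?addr_ge0 ?L2norm_ge0//.
have sL := vectorL2_D mO uL vL.
rewrite L2norm_sq ipDl// !ipDr// sqrrD !L2norm_sq (ipC _ v u).
have := ip_CauchySchwarz mO uL vL => /(le_trans (ler_norm _)).
rewrite -mulr_natl; lra.
Qed.

Lemma L2normZ O a u : measurable O -> vectorL2 O u ->
  L2norm O (a *: u) = `|a| * L2norm O u.
Proof.
move=> mO uL; rewrite /L2norm ipZl// ?ipZr//; last exact: vectorL2_Z.
by rewrite mulrA -expr2 sqrtrM ?sqr_ge0// sqrtr_sqr.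
Qed.

Lemma L2norm_eq0 O u : measurable O -> vectorL2 O u -> L2norm O u = 0 ->
  ae_eq_on O u 0.
Proof.
by move=> mO uL u0; apply: ip_eq0 => //; rewrite -L2norm_sq u0 expr0n.
Qed.

Lemma L2norm_ae O u v : ae_eq_on O u v -> L2norm O u = L2norm O v.
Proof. by move=> uv; rewrite /L2norm (ip_aeE uv uv). Qed.

End VectorL2.

(** * Matrix square roots and finite-dimensional solvability *)

Section Interpolation.
Variable F : fieldType.

(** Induction on the nodes: the product [m] vanishes at the old nodes and not at [a], so a multiple
    of it corrects the value at [a]. It serves to apply a scalar function, here a root, to the
    spectrum of a matrix. *)
Lemma interpolation_exists (s : seq F) (g : F -> F) : uniq s ->
  exists q : {poly F}, {in s, forall x, q.[x] = g x}.
Proof.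
elim: s => [|a s ih] /=; first by exists 0.
move=> /andP[as_ /ih[q qs]].
pose m : {poly F} := \prod_(y <- s) ('X - y%:P).
have ma : m.[a] != 0.
  by rewrite horner_prod prodf_seq_neq0; apply/allP => y ys /=;
    rewrite hornerXsubC subr_eq0; apply: contraNneq as_ => ->.
have ms x : x \in s -> m.[x] = 0.
  by move=> xs; apply/eqP; rewrite -[_ == 0]/(root m x) root_prod_XsubC.
exists (q + ((g a - q.[a]) / m.[a]) *: m) => x; rewrite inE => /predU1P[->|xs].
  by rewrite hornerD hornerZ divfK// addrC subrK.
by rewrite hornerD hornerZ (ms _ xs) mulr0 addr0 qs.
Qed.

Lemma trmx_horner_mx n (A : 'M[F]_n.+1) p :
  (horner_mx A p)^T = horner_mx A^T p.
Proof.
elim/poly_ind: p => [|p c ih]; first by rewrite !rmorph0 trmx0.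
rewrite !rmorphD !rmorphM /= !horner_mx_X !horner_mx_C linearD /= tr_scalar_mx.
congr (_ + _); rewrite -[LHS]/((horner_mx A p *m A)^T) trmx_mul ih.
by apply: (@comm_mx_horner _ _ A^T A^T p).
Qed.

Lemma horner_mx_intertwine n (P A B : 'M[F]_n.+1) p :
  P *m A = B *m P -> P *m horner_mx A p = horner_mx B p *m P.
Proof.
move=> PAB; elim/poly_ind: p => [|p c ih]; first by rewrite !rmorph0 mulmx0 mul0mx.
rewrite !rmorphD !rmorphM /= !horner_mx_X !horner_mx_C mulmxDr mulmxDl scalar_mxC.
by congr (_ + _); rewrite -!mulmxE mulmxA ih -!mulmxA PAB.
Qed.

End Interpolation.

Section Sqrt.
Variable R : realType.
Import complex.
Local Open Scope complex_scope.
Local Notation C := (complex R).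
Local Notation toC := (real_complex R).

(** Diagonalisation is done over the complex numbers, where the unitary basis may be complex; but
    the eigenvalues are real and nonnegative, so a real polynomial interpolates their fourth roots
    and no complex matrix survives in the conclusion. *)
Lemma psd_fourth_root_poly (A : 'M[R]_3) : A^T = A -> psdmx A ->
  exists q : {poly R}, horner_mx A (q ^+ 4) = A.
Proof.
move=> Asym Apsd.
pose AC : 'M[C]_3 := map_mx toC A.
have ACsym : AC \is symmetricmx.
  by apply/is_hermitianmxP; rewrite expr0 scale1r map_mx_id// /AC map_trmx Asym.
have ACreal : AC \is a realmx.
  apply/mxOverP => i j; rewrite mxE realE !lecE/= eqxx/=.
  exact: le_total.
have ACherm := realsym_hermsym ACsym ACreal.
have dreal := hermitian_spectral_diag_real ACherm.
have /orthomx_spectralP := hermitian_normalmx ACherm.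
move: dreal; set P := spectralmx AC; set dg := spectral_diag AC => dreal ACE.
have Pu : P \in unitmx by exact: spectral_unit.
have PAC : P *m AC = diag_mx dg *m P by rewrite {1}ACE !mulmxA mulmxV// mul1mx.
pose e i := complex.Re (dg 0 i).
have dE i : dg 0 i = toC (e i).
  by have /mxOverP/(_ 0 i) := dreal => /RRe_real.
(* A complex eigenvector says nothing about [psdmx]. The characteristic polynomial is real, so its
   real root [e i] also has a real eigenvector, which is tested against [A]. *)
have e0 i : 0 <= e i.
  have : eigenvalue AC (toC (e i)).
    apply/eigenvalueP; exists (row i P).
      by rewrite -row_mul PAC mul_diag_mx; apply/rowP => j; rewrite !mxE dE.
    apply/eqP => Pi0; have : row i P *m invmx P = 0 by rewrite Pi0 mul0mx.
    rewrite -row_mul mulmxV// => /rowP/(_ i)/eqP.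
    by rewrite !mxE eqxx oner_eq0.
  rewrite eigenvalue_root_char -map_char_poly fmorph_root -eigenvalue_root_char.
  move=> /eigenvalueP[u uA u0].
  have uA' : A *m u^T = e i *: u^T by rewrite -{1}Asym -trmx_mul uA linearZ.
  have := Apsd u^T; rewrite uA' dotZr pmulr_lge0// lt_def dot_ge0 andbT.
  by apply: contra_neq u0 => /dot_eq0 /(congr1 trmx); rewrite trmxK trmx0.
have [q qs] := interpolation_exists (fun x => Num.sqrt (Num.sqrt x))
  (undup_uniq [seq e i | i : 'I_3]).
exists q; apply: (@map_mx_inj _ _ toC).
rewrite map_horner_mx -/AC.
apply: (can_inj (mulKmx Pu)).
rewrite (horner_mx_intertwine _ PAC) PAC; congr (_ *m _).
rewrite horner_mx_diag; congr diag_mx; apply/rowP => i.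
rewrite mxE dE horner_map/= horner_exp qs ?mem_undup ?map_f ?mem_enum//.
by congr (_ %:C); rewrite (exprM _ 2 2) !sqr_sqrtr// sqrtr_ge0.
Qed.

Lemma sqrtmx_spec (A : 'M[R]_3) : A^T = A -> psdmx A ->
  [/\ (sqrtmx A)^T = sqrtmx A, psdmx (sqrtmx A) & sqrtmx A *m sqrtmx A = A].
Proof.
move=> Asym Apsd; have [q qA] := psd_fourth_root_poly Asym Apsd.
have QT : (horner_mx A q)^T = horner_mx A q by rewrite trmx_horner_mx Asym.
rewrite /sqrtmx; apply: (@xgetPex _ 0 [set S | [/\ S^T = S, psdmx S & S *m S = A]]).
(* The fourth root is used so that the candidate is the square of a symmetric matrix, which makes it
   positive semidefinite at once. *)
exists (horner_mx A q *m horner_mx A q); split => /=.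
- by rewrite trmx_mul QT.
- by move=> xi; rewrite -mulmxA dotC dot_mull QT dot_ge0.
- by rewrite -[RHS]qA rmorphXn /= (exprM _ 2 2) !expr2 !mulmxE.
Qed.

End Sqrt.

(** * Linear systems and finite generation *)

Section FiniteDimensional.
Variable K : fieldType.

(** Fredholm alternative: a row lies in the row space of [G] exactly when it kills the columns of
    [cokermx G], and those columns lie in the kernel of [G]. *)
Lemma gram_system_solvable n (G : 'M[K]_n) (L : 'rV[K]_n) :
  (forall c : 'cV[K]_n, G *m c = 0 -> L *m c = 0) -> exists c : 'rV[K]_n, c *m G = L.
Proof.
move=> H; have /submxP[c ->] : (L <= G)%MS; last by exists c.
rewrite submxE; apply/eqP/matrixP => i j.
have Gj : G *m col j (cokermx G) = 0.
  by rewrite colE mulmxA mulmx_coker mul0mx.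
have /matrixP/(_ i 0) := H _ Gj.
by rewrite colE mulmxA -colE !mxE.
Qed.

(** [rho v c] reads: [v] admits the coefficient vector [c]. A family in [S] with independent
    coefficient rows has at most [N] members; for a maximal one, the row of any further [v] is a
    combination of the chosen rows, so the corresponding difference admits the zero vector. *)
Lemma spanning_family N (V : lmodType K) (S : V -> Prop)
    (rho : V -> 'rV[K]_N -> Prop) :
  (forall a u v c c', rho u c -> rho v c' -> rho (a *: u + v) (a *: c + c')) ->
  (forall v, S v -> exists c, rho v c) ->
  exists n (b : 'I_n -> V), (forall i, S (b i)) /\
    forall v, S v -> exists c : 'I_n -> K, rho (v - \sum_i c i *: b i) 0.
Proof.
move=> rlin Srho.
pose P n := `[< exists M : 'M[K]_(n, N), row_free M /\
  exists b : 'I_n -> V, forall i, S (b i) /\ rho (b i) (row i M) >].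
have P0 : exists n, P n.
  exists 0%N; apply/asboolP; exists 0; split.
    by rewrite /row_free mxrank0.
  by exists (fun=> 0) => -[].
have Pmax n : P n -> (n <= N)%N.
  by move=> /asboolP[M [/eqP rM _]]; rewrite -rM rank_leq_col.
have [n /asboolP[M [Mfree [b Sb]]] nmax] := ex_maxnP P0 Pmax.
exists n, b; split=> [i|v Sv]; first by case: (Sb i).
have [c vc] := Srho _ Sv.
have /submxP[x xM] : (c <= M)%MS.
  apply: contrapT => /negP cM.
  suff /nmax : P n.+1 by rewrite ltnn.
  apply/asboolP; rewrite -addn1; exists (col_mx M c); split.
    rewrite /row_free eqn_leq rank_leq_row/= -addsmxE addn1.
    suff : (\rank M < \rank (M + c))%N by rewrite (eqP Mfree).
    apply: rank_ltmx; rewrite ltmxE addsmxSl/=.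
    by apply: contra cM; apply: submx_trans; exact: addsmxSr.
  exists (fun i : 'I_(n + 1) => match fintype.split i with inl j => b j | inr _ => v end) => i.
  case: fintype.splitP => j ij.
    have -> : i = lshift 1 j by exact/val_inj.
    by rewrite rowKu.
  have -> : i = rshift n j by exact/val_inj.
  by rewrite rowKd row_id.
exists (fun i => x 0 i).
(* [rho] is only known to respect one linear combination at a time, so the terms are subtracted one
   by one. *)
have rho_sum (s : seq 'I_n) : rho (v - \sum_(i <- s) x 0 i *: b i)
    (c - \sum_(i <- s) x 0 i *: row i M).
  elim: s => [|i s ih]; first by rewrite !big_nil !subr0.
  have := rlin (- x 0 i) _ _ _ _ (Sb i).2 ih.
  rewrite !big_cons !scaleNr !opprD !addrA.
  by rewrite (addrC (- _) v) (addrC (- _) c).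
have := rho_sum (index_enum _).
by rewrite -mulmx_sum_row -xM subrr.
Qed.

End FiniteDimensional.

Section AbstractSolve.
Variables (K : fieldType) (U : lmodType K) (V : set U).
Hypothesis V0 : V 0.
Hypothesis Vlin : forall c u v, V u -> V v -> V (c *: u + v).

Definition linear_on (f : U -> K) :=
  forall c u v, V u -> V v -> f (c *: u + v) = c * f u + f v.

Lemma linear_on0 f : linear_on f -> f 0 = 0.
Proof. by move=> fl; have := fl (-1) 0 0 V0 V0; rewrite scaler0 addr0 mulN1r addNr. Qed.

Lemma lincomb_closed (I : Type) (s : seq I) (c : I -> K) (b : I -> U) :
  (forall i, V (b i)) -> V (\sum_(i <- s) c i *: b i).
Proof.
move=> Vb; elim: s => [|i s ih]; first by rewrite big_nil.
by rewrite big_cons; exact: Vlin.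
Qed.

Lemma linear_on_sum f (I : Type) (s : seq I) (c : I -> K) (b : I -> U) :
  linear_on f -> (forall i, V (b i)) ->
  f (\sum_(i <- s) c i *: b i) = \sum_(i <- s) c i * f (b i).
Proof.
move=> fl Vb; elim: s => [|i s ih]; first by rewrite !big_nil linear_on0.
by rewrite !big_cons fl ?ih//; exact: lincomb_closed.
Qed.

(* Lax-Milgram on a finitely generated space, without choosing a basis: the Gram
   system is solvable because the right-hand side vanishes on its kernel. *)
Lemma coercive_solve (a : U -> U -> K) (l : U -> K) n (b : 'I_n -> U) :
  (forall w, V w -> linear_on (a ^~ w)) -> (forall u, V u -> linear_on (a u)) ->
  linear_on l -> (forall i, V (b i)) ->
  (forall v, V v -> a v v = 0 -> l v = 0) ->
  (forall v, V v -> exists c : 'I_n -> K, l v = l (\sum_i c i *: b i) /\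
     forall u, V u -> a u v = a u (\sum_i c i *: b i)) ->
  exists2 u, V u & forall v, V v -> a u v = l v.
Proof.
move=> al ar ll Vb pos span.
pose G : 'M[K]_n := \matrix_(i, j) a (b i) (b j).
pose L : 'rV[K]_n := \row_j l (b j).
have [|c cG] := @gram_system_solvable _ _ G L.
  move=> cL Gc; pose v := \sum_j cL j 0 *: b j.
  have Vv : V v by exact: lincomb_closed.
  apply/matrixP => i j; rewrite !ord1 [RHS]mxE.
  suff : l v = 0.
    rewrite /v (linear_on_sum _ _ ll Vb) => <-; rewrite mxE.
    by apply: eq_bigr => k _; rewrite !mxE mulrC.
  apply: pos => //.
  (* Expanding both arguments, [a v v] is a sum of multiples of the entries of [G *m cL], all of
     which vanish. *)
  rewrite {1}/v (linear_on_sum _ _ (al _ Vv) Vb) big1// => k _.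
  rewrite /v (linear_on_sum _ _ (ar _ (Vb k)) Vb).
  have /matrixP/(_ k 0) := Gc; rewrite !mxE => Gk.
  rewrite (eq_bigr (fun m => G k m * cL m 0)) ?Gk ?mulr0// => m _.
  by rewrite mxE mulrC.
exists (\sum_i c 0 i *: b i); first exact: lincomb_closed.
set u := \sum_i _; have Vu : V u by exact: lincomb_closed.
have bj j : a u (b j) = l (b j).
  rewrite /u (linear_on_sum _ _ (al _ (Vb j)) Vb).
  have /matrixP/(_ 0 j) := cG; rewrite !mxE => <-.
  by apply: eq_bigr => i _; rewrite mxE.
move=> v Vv; have [d [-> ->//]] := span _ Vv.
rewrite (linear_on_sum _ _ (ar _ Vu) Vb) (linear_on_sum _ _ ll Vb).
by apply: eq_bigr => j _; rewrite bj.
Qed.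

End AbstractSolve.

(** * Boxes in space *)

Section Boxes.
Variable R : realType.
Implicit Types (a b x : space3 R) (O : set (space3 R)).
Local Notation mu := (leb3 R).

Definition obox a b : set (space3 R) :=
  [set x | [/\ a.1.1 < x.1.1 < b.1.1, a.1.2 < x.1.2 < b.1.2 & a.2 < x.2 < b.2]].

Definition cbox a b : set (space3 R) :=
  [set x | [/\ a.1.1 <= x.1.1 <= b.1.1, a.1.2 <= x.1.2 <= b.1.2 & a.2 <= x.2 <= b.2]].

Lemma obox_cbox a b : obox a b `<=` cbox a b.
Proof.
by move=> x [/andP[/ltW ? /ltW ?] /andP[/ltW ? /ltW ?] /andP[/ltW ? /ltW ?]];
  split; apply/andP.
Qed.

Lemma oboxX a b :
  obox a b = `]a.1.1, b.1.1[ `*` `]a.1.2, b.1.2[ `*` `]a.2, b.2[.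
Proof.
apply/seteqP; split => [[[x y] z]|[[x y] z]] /=; rewrite !in_itv/=.
  by move=> [].
by move=> [[]].
Qed.

Lemma cboxX a b :
  cbox a b = `[a.1.1, b.1.1] `*` `[a.1.2, b.1.2] `*` `[a.2, b.2].
Proof.
apply/seteqP; split => [[[x y] z]|[[x y] z]] /=; rewrite !in_itv/=.
  by move=> [].
by move=> [[]].
Qed.

Lemma measurable_obox a b : measurable (obox a b).
Proof.
rewrite oboxX.
apply: (measurableX (measurableX (measurable_itv _) (measurable_itv _)) (measurable_itv _)).
Qed.

(** The inclusion of closed boxes is recorded because integrals are known to vanish only over boxes
    whose closed version lies inside a given one. *)
Lemma oboxI a b a' b' : exists a'' b'',
  obox a b `&` obox a' b' = obox a'' b'' /\ cbox a'' b'' `<=` cbox a b.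
Proof.
exists (Num.max a.1.1 a'.1.1, Num.max a.1.2 a'.1.2, Num.max a.2 a'.2).
exists (Num.min b.1.1 b'.1.1, Num.min b.1.2 b'.1.2, Num.min b.2 b'.2).
split; last first.
  move=> x [/=]; rewrite !ge_max !le_min.
  move=> /andP[/andP[? ?] /andP[? ?]] /andP[/andP[? ?] /andP[? ?]].
  by move=> /andP[/andP[? ?] /andP[? ?]]; split; apply/andP.
apply/seteqP; split => x /=.
  move=> [[/andP[? ?] /andP[? ?] /andP[? ?]] [/andP[? ?] /andP[? ?] /andP[? ?]]].
  by split; rewrite /= gt_max lt_min; apply/andP; split; apply/andP.
move=> [/=]; rewrite !gt_max !lt_min.
move=> /andP[/andP[? ?] /andP[? ?]] /andP[/andP[? ?] /andP[? ?]].
by move=> /andP[/andP[? ?] /andP[? ?]]; split; split; apply/andP.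
Qed.

Definition rat_point (p : rat * rat * rat) : space3 R :=
  (ratr p.1.1 : R, ratr p.1.2 : R, ratr p.2 : R).

(** Rational corners leave countably many boxes. The closed box must lie in [O], since it is the one
    that contains the supports of the bumps. *)
Lemma open_rat_box O x : open O -> O x ->
  exists p q, obox (rat_point p) (rat_point q) x /\
    cbox (rat_point p) (rat_point q) `<=` O.
Proof.
move=> oO Ox; have /nbhs_ballP[e /= e0 h] : nbhs x O by exact: open_nbhs_nbhs.
have lo (t : R) : exists q : rat, t - e < ratr q < t.
  have /rat_in_itvoo[q] : t - e < t by rewrite ltrBlDr ltrDl.
  by rewrite in_itv/= => ?; exists q.
have hi (t : R) : exists q : rat, t < ratr q < t + e.
  have /rat_in_itvoo[q] : t < t + e by rewrite ltrDl.
  by rewrite in_itv/= => ?; exists q.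
have [p1 /andP[? ?]] := lo x.1.1; have [q1 /andP[? ?]] := hi x.1.1.
have [p2 /andP[? ?]] := lo x.1.2; have [q2 /andP[? ?]] := hi x.1.2.
have [p3 /andP[? ?]] := lo x.2; have [q3 /andP[? ?]] := hi x.2.
exists (p1, p2, p3), (q1, q2, q3); split.
  by split; apply/andP; split.
move=> y [/= /andP[? ?] /andP[? ?] /andP[? ?]]; apply: h.
split; [split|]; rewrite /= -ball_normE /ball_/= ltr_norml; apply/andP; split; lra.
Qed.

Lemma rat_boxes_enum : exists F : nat -> space3 R * space3 R,
  forall p q, exists n, F n = (rat_point p, rat_point q).
Proof.
exists (fun n =>
  if (unpickle n : option ((rat * rat * rat) * (rat * rat * rat))) is Some pq
  then (rat_point pq.1, rat_point pq.2) else (0, 0)).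
move=> p q; exists (pickle (p, q)).
by rewrite pickleK.
Qed.

Lemma open_bigcup_box O : open O -> exists F : nat -> space3 R * space3 R,
  O = \bigcup_(n in [set n | cbox (F n).1 (F n).2 `<=` O]) obox (F n).1 (F n).2.
Proof.
move=> oO; have [F FP] := rat_boxes_enum; exists F.
apply/seteqP; split => [x Ox|x [n /= nO] /obox_cbox /nO//].
have [p [q [xpq pqO]]] := open_rat_box oO Ox.
by have [n Fn] := FP p q; exists n; rewrite /= Fn.
Qed.

(** The sigma-algebra on [space3 R] is the product one; a countable union of boxes links it to the
    topology. *)
Lemma open_measurable3 O : open O -> measurable O.
Proof.
move=> oO; have [F ->] := open_bigcup_box oO.
by apply: bigcup_measurable => n _; exact: measurable_obox.
Qed.

Lemma continuous_measurable3 (f : space3 R -> R) : continuous f ->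
  measurable_fun [set: space3 R] f.
Proof.
move=> cf; apply: (measurability _ (RGenOInfty.measurableE R)) => _ [_ [y ->] <-].
rewrite setTI; apply: open_measurable3.
apply: open_comp; last exact: rray_open.
by move=> x _; exact: cf.
Qed.

Definition oboxes : set (set (space3 R)) := [set A | exists a b, A = obox a b].

(** The identity map into the product space is measurable for the sigma-algebra generated by boxes,
    because each half-space given by one coordinate is a countable union of boxes with growing
    sides. *)
Lemma measurable_oboxes : @measurable _ (space3 R) = <<s oboxes >>.
Proof.
apply/seteqP; split; last first.
  apply: smallest_sub; first exact: sigma_algebra_measurable.
  by move=> _ [a [b ->]]; exact: measurable_obox.
move=> A mA.
pose T' := g_sigma_algebraType oboxes.
have bigger (t : R) : exists n : nat, - n%:R < t < n%:R.
  exists (Num.Def.archi_bound t); rewrite -ltr_norml.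
  by have := archi_boundP (normr_ge0 t); rewrite /Num.Def.archi_bound normr_id.
have in_box (n : nat) (y1 y2 y3 : R) :
  @measurable _ T' (obox (y1, y2, y3) (n%:R, n%:R, n%:R)).
  by apply: sub_sigma_algebra; exists (y1, y2, y3), (n%:R, n%:R, n%:R).
have bigger3 (x : space3 R) : exists n : nat,
   [/\ - n%:R < x.1.1 < n%:R, - n%:R < x.1.2 < n%:R & - n%:R < x.2 < n%:R].
  have [n1 /andP[? ?]] := bigger x.1.1; have [n2 /andP[? ?]] := bigger x.1.2.
  have [n3 /andP[? ?]] := bigger x.2.
  exists (n1 + n2 + n3)%N; rewrite !natrD.
  have := ler0n R n1; have := ler0n R n2; have := ler0n R n3 => ? ? ?.
  by split; apply/andP; split; lra.
have mcoord (i : space3 R -> R) :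
    (forall y, i @^-1` `]y, +oo[ = \bigcup_n
       obox (y, - n%:R, - n%:R) (n%:R, n%:R, n%:R) \/
     i @^-1` `]y, +oo[ = \bigcup_n
       obox (- n%:R, y, - n%:R) (n%:R, n%:R, n%:R) \/
     i @^-1` `]y, +oo[ = \bigcup_n
       obox (- n%:R, - n%:R, y) (n%:R, n%:R, n%:R)) ->
    measurable_fun [set: T'] (i : T' -> R).
  move=> H; apply: (measurability _ (RGenOInfty.measurableE R)) => _ [_ [y ->] <-].
  by rewrite setTI; case: (H y) => [->|[->|->]]; apply: bigcupT_measurable => n;
    exact: in_box.
have m1 : measurable_fun [set: T'] ((fun x : space3 R => x.1.1 : R) : T' -> R).
  apply: mcoord => y; left; apply/seteqP; split => x /=; rewrite in_itv/= andbT.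
    move=> yx; have [n [/andP[_ ?] ? ?]] := bigger3 x; exists n => //; split => //=.
    by apply/andP; split.
  by move=> [n _ [/andP[]]].
have m2 : measurable_fun [set: T'] ((fun x : space3 R => x.1.2 : R) : T' -> R).
  apply: mcoord => y; right; left; apply/seteqP; split => x /=; rewrite in_itv/= andbT.
    move=> yx; have [n [? /andP[_ ?] ?]] := bigger3 x; exists n => //; split => //=.
    by apply/andP; split.
  by move=> [n _ [_ /andP[]]].
have m3 : measurable_fun [set: T'] ((fun x : space3 R => x.2 : R) : T' -> R).
  apply: mcoord => y; right; right; apply/seteqP; split => x /=; rewrite in_itv/= andbT.
    move=> yx; have [n [? ? /andP[_ ?]]] := bigger3 x; exists n => //; split => //=.
    by apply/andP; split.
  by move=> [n _ [_ _ /andP[]]].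
have mid : measurable_fun [set: T'] (fun x : T' =>
   (((x : space3 R).1.1 , (x : space3 R).1.2) , (x : space3 R).2) : space3 R).
  apply: measurable_fun_pair; last exact: m3.
  apply: measurable_fun_pair; [exact: m1|exact: m2].
have := mid measurableT _ mA; rewrite setTI.
by congr (_ _); apply/seteqP; split => [[[x y] z]|[[x y] z]].
Qed.

(* pi-lambda argument: the sets over which [g] restricted to the box has zero
   integral form a Dynkin system containing all boxes. *)
Lemma ae0_of_box_integrals a b (g : space3 R -> R) :
  mu.-integrable (obox a b) (EFin \o g) ->
  (forall a' b', cbox a' b' `<=` cbox a b ->
     (\int[mu]_(x in obox a' b') (g x)%:E = 0)%E) ->
  {ae mu, forall x, obox a b x -> g x = 0}.
Proof.
move=> ig H.
have mB := measurable_obox a b.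
pose P (S : set (space3 R)) := (\int[mu]_(x in obox a b `&` S) (g x)%:E = 0)%E.
have igS S : measurable S -> mu.-integrable (obox a b `&` S) (EFin \o g).
  by move=> mS; apply: integrableS ig => //; exact: measurableI.
have PS S : measurable S -> P S.
  rewrite measurable_oboxes; apply: dynkin_induction.
  - exact: measurable_oboxes.
  - move=> _ _ [a1 [b1 ->]] [a2 [b2 ->]].
    by have [a3 [b3 [-> _]]] := oboxI a1 b1 a2 b2; exists a3, b3.
  - by rewrite /P setIT; exact: H.
  - move=> _ [a1 [b1 ->]]; rewrite /P.
    by have [a3 [b3 [-> ?]]] := oboxI a b a1 b1; exact: H.
  - move=> S' mS' PS; rewrite /P.
    have : (\int[mu]_(x in obox a b) (g x)%:E = 0)%E by exact: H.
    rewrite -{1}[obox a b](setIT) -(setUv S') setIUr integral_setU.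
    + by rewrite PS add0e.
    + exact: measurableI.
    + by apply: measurableI => //; exact: measurableC.
    + rewrite -setIUr setUv setIT; exact: (measurable_int _ ig).
    + rewrite /disj_set; apply/eqP; apply/seteqP; split => // x [[_ Sx] [_]].
      exact.
  - move=> F mF tF PF; rewrite /P setI_bigcupr integral_bigcup.
    + by rewrite eseries0// => n _ _; exact: PF.
    + exact: trivIset_setIl.
    + by move=> n; exact: measurableI.
    + by rewrite -setI_bigcupr; apply: igS; exact: bigcupT_measurable.
have /integral_ae_eq : mu.-integrable (obox a b) (EFin \o g) by [].
move=> /(_ mB (fun=> 0%E) (measurable_cst _)) Hae.
have : ae_eq mu (obox a b) (EFin \o g) (fun=> 0%E).
  apply: Hae => E EB mE; rewrite integral0.
  by have := PS _ mE; rewrite /P setIidr.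
by apply: filterS => x /[apply] -[].
Qed.

(** Countably many boxes exhaust [O], so the exceptional null sets of the single boxes have a null
    union. *)
Lemma ae0_of_boxes O (g : space3 R -> R) : open O ->
  mu.-integrable O (EFin \o g) ->
  (forall a b, cbox a b `<=` O -> (\int[mu]_(x in obox a b) (g x)%:E = 0)%E) ->
  {ae mu, forall x, O x -> g x = 0}.
Proof.
move=> oO ig H; have mO := open_measurable3 oO.
have [F OE] := open_bigcup_box oO.
have aeF n : {ae mu, forall x, cbox (F n).1 (F n).2 `<=` O ->
    obox (F n).1 (F n).2 x -> g x = 0}.
  have [FO|FO] := pselect (cbox (F n).1 (F n).2 `<=` O); last exact: aeW.
  have igF : mu.-integrable (obox (F n).1 (F n).2) (EFin \o g).
    apply: (integrableS mO _ _ ig); first exact: measurable_obox.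
    by move=> x /obox_cbox /FO.
  have /(_ igF) := @ae0_of_box_integrals (F n).1 (F n).2 g.
  have HF a' b' : cbox a' b' `<=` cbox (F n).1 (F n).2 ->
     (\int[mu]_(x in obox a' b') (g x)%:E = 0)%E.
    by move=> sub; apply: H => x /sub /FO.
  by move=> /(_ HF); apply: filterS => x.
have := ae_foralln aeF; apply: filterS => x xF; rewrite OE => -[n /= nO xn].
exact: xF xn.
Qed.

End Boxes.

(** * Bump functions and partial derivatives *)

Section SmoothOneVariable.
Variable R : realType.
Implicit Types (f g : R -> R) (x t : R) (n k : nat).

Fixpoint nsmooth n f : Prop :=
  if n is n'.+1 then (forall x, derivable f x 1) /\ nsmooth n' (derive1 f) else True.

Definition smooth1 f := forall n, nsmooth n f.

Lemma nsmoothS n f : nsmooth n.+1 f -> nsmooth n f.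
Proof. by elim: n f => // n ih f [df /ih]. Qed.

Lemma nsmoothD n f g : nsmooth n f -> nsmooth n g -> nsmooth n (f \+ g).
Proof.
elim: n f g => // n ih f g [df sf] [dg sg]; split; first by move=> x; exact: derivableD.
rewrite (_ : (derive1 _) = (derive1 f) \+ (derive1 g)); first exact: ih.
by apply/funext => x; rewrite /= !derive1E deriveD.
Qed.

Lemma nsmoothM n f g : nsmooth n f -> nsmooth n g -> nsmooth n (f \* g).
Proof.
elim: n f g => // n ih f g; move=> /[dup] /nsmoothS nf [df sf] /[dup] /nsmoothS ng [dg sg].
split; first by move=> x; exact: derivableM.
rewrite (_ : (derive1 _) = (f \* (derive1 g)) \+ (g \* (derive1 f))).
  by apply: nsmoothD; exact: ih.
by apply/funext => x; rewrite /= !derive1E deriveM.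
Qed.

Lemma nsmooth_cst n c : nsmooth n (fun=> c : R).
Proof.
elim: n c => // n ih c; split; first by move=> x; exact: derivable_cst.
rewrite (_ : (derive1 _) = fun=> 0)//.
by apply/funext => x; rewrite derive1E derive_cst.
Qed.

Lemma is_derive_affine a c x : is_derive x 1 (fun x => a * x + c) a.
Proof.
apply: (is_derive_eq (is_deriveD
  (is_deriveM (is_derive_cst a x 1) (is_derive_id x 1)) (is_derive_cst c x 1))).
by rewrite addr0 scaler0 addr0 /GRing.scale/= mulr1.
Qed.

Lemma nsmooth_affine n a c : nsmooth n (fun x => a * x + c).
Proof.
case: n => // n.
have D x : is_derive x 1 (fun x => a * x + c) a.
  exact: is_derive_affine.
split; first by move=> x; have [] := D x.
rewrite (_ : (derive1 _) = fun=> a); first exact: nsmooth_cst.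
by apply/funext => x; rewrite derive1E; have [_ ->] := D x.
Qed.

Lemma nsmooth_comp_affine n f a c : nsmooth n f -> nsmooth n (fun x => f (a * x + c)).
Proof.
elim: n f => // n ih f [df sf].
have D x : is_derive x 1 (fun x => f (a * x + c)) ((derive1 f) (a * x + c) * a).
  apply: (@is_derive1_comp _ f (fun x => a * x + c)).
    by rewrite derive1E; exact/derivableP.
  exact: is_derive_affine.
split; first by move=> x; have [] := D x.
rewrite (_ : (derive1 _) = (fun x => (derive1 f) (a * x + c)) \* (fun=> a)).
  by apply: nsmoothM; [exact: ih|exact: nsmooth_cst].
by apply/funext => x; rewrite derive1E; have [_ ->] := D x.
Qed.

Lemma smooth1M f g : smooth1 f -> smooth1 g -> smooth1 (f \* g).
Proof. by move=> sf sg n; exact: nsmoothM. Qed.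

Lemma smooth1_derivable f x : smooth1 f -> derivable f x 1.
Proof. by move=> /(_ 1%N)[]. Qed.

Lemma smooth1_derive f : smooth1 f -> smooth1 (derive1 f).
Proof. by move=> sf n; have [] := sf n.+1. Qed.

Lemma smooth1_continuous f : smooth1 f -> continuous f.
Proof.
by move=> sf x; apply/differentiable_continuous/derivable1_diffP/smooth1_derivable.
Qed.

Lemma smooth1_exp k : smooth1 (fun x => x ^+ k).
Proof.
elim: k => [|k ih]; first by move=> n; exact: nsmooth_cst.
rewrite (_ : (fun x => _) = (fun x => 1 * x + 0) \* (fun x => x ^+ k)).
  by apply: smooth1M => // n; exact: nsmooth_affine.
by apply/funext => x; rewrite exprS /= mul1r addr0.
Qed.

(** The case [k = 0] is the usual flat function [exp(-1/x)]. The powers of the inverse are included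
    because the derivative of [invexp k] is a combination of [invexp k.+2] and [invexp k.+1], which
    makes the family closed under differentiation. *)
Definition invexp k x : R := if 0 < x then x^-1 ^+ k * expR (- x^-1) else 0.

Lemma invexp_ge0 k x : 0 <= invexp k x.
Proof.
rewrite /invexp; case: ifPn => // x0.
by rewrite mulr_ge0 ?expR_ge0// exprn_ge0// invr_ge0 ltW.
Qed.

(** With [y = 1/x], [exp(y)] is the power [k.+1] of [exp(y / k.+1)], which is at least [y / k.+1].
    One power of [y] more than needed is gained, and it becomes the factor [x]. *)
Lemma invexp_bound k x : 0 < x -> invexp k x <= k.+1%:R ^+ k.+1 * x.
Proof.
move=> x0; rewrite /invexp x0 expRN ler_pdivrMr ?expR_gt0//.
have y0 : 0 < x^-1 by rewrite invr_gt0.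
set y := x^-1 in y0 *; have -> : x = y^-1 by rewrite invrK.
have k0 : 0 < k.+1%:R :> R by [].
rewrite mulrAC ler_pdivlMr// -exprSr.
have -> : expR y = expR (y / k.+1%:R) ^+ k.+1.
  by rewrite -expRM_natl mulrC divfK// gt_eqF.
rewrite -exprMn lerXn2r ?nnegrE ?mulr_ge0 ?expR_ge0 ?(ltW y0)//.
rewrite -ler_pdivrMl// mulrC (le_trans _ (expR_ge1Dx _))// lerDr.
by [].
Qed.

Lemma is_derive_invexp k x :
  is_derive x 1 (invexp k) (invexp k.+2 x - k%:R * invexp k.+1 x).
Proof.
have [x0|x0|->] := ltgtP x 0.
- apply: (@near_eq_is_derive _ _ _ (fun=> 0)).
    by near=> y; rewrite /invexp ltNge ltW//=; near: y; exact: lt_nbhsl.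
  apply: (is_derive_eq (is_derive_cst (0 : R) x 1)).
  by rewrite /invexp !ltNge !ltW//= mulr0 subrr.
- apply: (@near_eq_is_derive R R R (fun y : R => y^-1 ^+ k * expR (- y^-1) : R)).
    by near=> y; rewrite /invexp ifT//; near: y; exact: lt_nbhsr.
  have Dinv : is_derive x 1 (fun y : R => y^-1) (- x ^- 2).
    apply: is_derive_eq; first by apply: is_deriveV; rewrite gt_eqF.
    by rewrite /GRing.scale/= mulr1.
  have Dexp : is_derive x 1 (fun y : R => expR (- y^-1)) (expR (- x^-1) * x ^- 2).
    apply: (@is_derive1_comp _ expR (fun y => - y^-1)).
    by apply: (is_derive_eq (is_deriveN Dinv)); rewrite opprK.
  have Dpow : is_derive x 1 (fun y : R => y^-1 ^+ k) (k%:R * x^-1 ^+ k.-1 * - x ^- 2).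
    have -> : (fun y : R => y^-1 ^+ k) = (fun y : R => y^-1) ^+ k.
      by rewrite exprfctE.
    exact: (is_deriveX k Dinv).
  apply: (is_derive_eq (is_deriveM Dpow Dexp)).
  rewrite /invexp x0 /GRing.scale/=.
  rewrite -!exprVn; move: (x^-1) (expR (- x^-1)) => y E.
  case: k Dpow => [|k] _ /=; first by ring.
  by rewrite -[k.+1%:R]natr1 !exprS; ring.
- have -> : invexp k.+2 0 - k%:R * invexp k.+1 0 = 0.
    by rewrite /invexp ltxx mulr0 subrr.
  (* At the origin the difference quotient is [invexp k.+1 h] for positive [h] and zero otherwise,
     so the linear bound applies with [k.+1]. *)
  have cv : (h^-1 *: ((invexp k \o shift 0) (h *: (1 : R)) - invexp k 0))
      @[h --> 0^'] --> 0.
    apply/cvgr0Pnorm_lt => e e0.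
    have C0 : 0 < k.+2%:R ^+ k.+2 :> R by rewrite exprn_gt0.
    near=> h.
    have h0 : h != 0 by near: h; exact: nbhs_dnbhs_neq.
    have hlt : `|h| < e / k.+2%:R ^+ k.+2.
      near: h; apply: dnbhs0_lt; exact: divr_gt0.
    rewrite /= addr0 /GRing.scale/= mulr1 {2}/invexp ltxx subr0.
    have [hpos|hneg] := ltP 0 h; last first.
      by rewrite /invexp ifN ?mulr0 ?normr0// -leNgt.
    have -> : h^-1 * invexp k h = invexp k.+1 h.
      by rewrite /invexp hpos exprS mulrA.
    rewrite ger0_norm ?invexp_ge0// (le_lt_trans (invexp_bound _ hpos))//.
    by rewrite mulrC -ltr_pdivlMr// -[h]gtr0_norm.
  by apply: DeriveDef; [apply/cvg_ex; exists 0|exact: cvg_lim cv].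
Unshelve. all: by end_near. Qed.

Lemma smooth1_invexp k : smooth1 (invexp k).
Proof.
move=> n; elim: n k => // n ih k.
split; first by move=> x; have [] := is_derive_invexp k x.
rewrite (_ : (derive1 _) = (invexp k.+2) \+ ((fun=> - k%:R) \* invexp k.+1)).
  by apply: nsmoothD => //; apply: nsmoothM => //; exact: nsmooth_cst.
apply/funext => x; rewrite derive1E; have [_ ->] := is_derive_invexp k x.
by rewrite /= mulNr.
Qed.

Definition bump1 (a b : R) n x : R :=
  invexp 0 (n.+1%:R * (x - a)) * invexp 0 (n.+1%:R * (b - x)).

Lemma smooth1_bump1 a b n : smooth1 (bump1 a b n).
Proof.
rewrite (_ : bump1 a b n =
  (fun x => invexp 0 (n.+1%:R * x + - (n.+1%:R * a))) \*
  (fun x => invexp 0 (- n.+1%:R * x + n.+1%:R * b))).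
  by apply: smooth1M => m; apply: nsmooth_comp_affine; exact: smooth1_invexp.
by apply/funext => x; rewrite /bump1 /= mulrBr mulrBr mulNr (addrC (- _)).
Qed.

Lemma invexp0_le1 x : invexp 0 x <= 1.
Proof.
rewrite /invexp; case: ifPn => // x0; rewrite expr0 mul1r.
by rewrite -expR0 ler_expR oppr_le0 invr_ge0 ltW.
Qed.

Lemma bump1_ge0 a b n x : 0 <= bump1 a b n x.
Proof. by rewrite mulr_ge0// invexp_ge0. Qed.

Lemma bump1_le1 a b n x : bump1 a b n x <= 1.
Proof. by rewrite mulr_ile1 ?invexp_ge0 ?invexp0_le1. Qed.

Lemma bump1_out a b n x : ~~ (a < x < b) -> bump1 a b n x = 0.
Proof.
rewrite negb_and -!leNgt => /orP[xa|xb]; rewrite /bump1 /invexp.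
  by rewrite pmulr_rgt0// subr_gt0 ltNge xa mul0r.
by rewrite [X in _ * X]ifF ?mulr0// pmulr_rgt0// subr_gt0 ltNge xb.
Qed.

Lemma invexp0_cvg x : 0 < x -> invexp 0 (n.+1%:R * x) @[n --> \oo] --> (1 : R).
Proof.
move=> x0.
rewrite (_ : (fun n => _) = (fun n => expR (- (n.+1%:R^-1 * x^-1)))); last first.
  apply/funext => n; rewrite /invexp pmulr_rgt0// x0 expr0 mul1r.
  by rewrite invfM.
rewrite -[X in _ --> X]expR0.
apply: continuous_cvg; first exact: continuous_expR.
rewrite -oppr0; apply: cvgN; rewrite -(mul0r x^-1); apply: cvgMl.
exact: cvg_harmonic.
Qed.

Lemma bump1_cvg a b x : a < x < b -> bump1 a b n x @[n --> \oo] --> (1 : R).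
Proof.
move=> /andP[ax xb]; rewrite -[X in _ --> X]mulr1.
by apply: cvgM; apply: invexp0_cvg; rewrite subr_gt0.
Qed.

End SmoothOneVariable.

(** * Partial derivatives along coordinate lines *)

Section Lines.
Variable R : realType.
Implicit Types (x y : space3 R) (f g : space3 R -> R) (i j : 'I_3) (s t : R).

Definition getc x i : R := vec x i 0.

(** As [t] varies this runs through the coordinate line of [x]. It reduces a partial derivative to a
    derivative in one real variable, and the same lines are the fibres in Fubini's theorem. *)
Definition setc x i t : space3 R :=
  (if i == 0 :> nat then t else x.1.1, if i == 1 :> nat then t else x.1.2,
   if i == 2 :> nat then t else x.2).

Lemma getcE x i :
  getc x i = if i == 0 :> nat then x.1.1 else if i == 1 :> nat then x.1.2 else x.2.
Proof. by rewrite /getc /vec mxE; case: i => -[|[|[|]]]. Qed.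

Lemma getc_setc x i j t : getc (setc x i t) j = if j == i then t else getc x j.
Proof. by rewrite !getcE -val_eqE; case: i j => -[|[|[|//]]] ? [] [|[|[|//]]] ?. Qed.

Lemma getc_inj x y : (forall i, getc x i = getc y i) -> x = y.
Proof.
move: x y => [[x1 x2] x3] [[y1 y2] y3] h.
have := h (@Ordinal 3 0 isT); have := h (@Ordinal 3 1 isT).
by have := h (@Ordinal 3 2 isT); rewrite !getcE/= => -> -> ->.
Qed.

Lemma setc_getc x i : setc x i (getc x i) = x.
Proof. by apply: getc_inj => j; rewrite getc_setc; case: eqP => [->|]. Qed.

Lemma setc_setc x i s t : setc (setc x i s) i t = setc x i t.
Proof. by apply: getc_inj => j; rewrite !getc_setc; case: eqP. Qed.

Lemma setcC x i j s t : i != j -> setc (setc x i s) j t = setc (setc x j t) i s.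
Proof.
move=> ij; apply: getc_inj => k; rewrite !getc_setc.
by have [->|] := eqVneq k j; rewrite // eq_sym (negPf ij).
Qed.

Lemma line_setc x i (h : R) :
  h *: std_basis R i + x = setc x i (h *: (1 : R) + getc x i).
Proof.
move: x => [[x1 x2] x3]; rewrite getcE /setc /std_basis.
by case: i => -[|[|[|//]]] ? /=; congr (_, _, _); rewrite /= /GRing.scale/= ?mulr0 ?add0r.
Qed.

Lemma diff_quot_setc f x i :
  (fun h : R => h^-1 *: ((f \o shift x) (h *: std_basis R i) - f x)) =
  (fun h : R => h^-1 *: (((fun t => f (setc x i t)) \o shift (getc x i)) (h *: (1 : R))
     - f (setc x i (getc x i)))).
Proof. by apply/funext => h; rewrite /= line_setc setc_getc. Qed.

Lemma derivable_setc f x i : derivable f x (std_basis R i) =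
  derivable (fun t => f (setc x i t) : R) (getc x i) 1.
Proof. by rewrite /derivable diff_quot_setc. Qed.

Lemma partial_setc f x i : partial i f x = 'D_1 (fun t => f (setc x i t) : R) (getc x i).
Proof. by rewrite /partial /derive diff_quot_setc. Qed.

Lemma is_derive_line f x i t : derivable f (setc x i t) (std_basis R i) ->
  is_derive t 1 (fun s => f (setc x i s) : R) (partial i f (setc x i t)).
Proof.
rewrite derivable_setc partial_setc getc_setc eqxx.
have -> : (fun s => f (setc (setc x i t) i s) : R) = (fun s => f (setc x i s)).
  by apply/funext => s; rewrite setc_setc.
by move=> /derivableP.
Qed.

Lemma partial_eq f x i (d : R) :
  is_derive (getc x i) 1 (fun t => f (setc x i t) : R) d ->
  derivable f x (std_basis R i) /\ partial i f x = d.
Proof. by rewrite derivable_setc partial_setc => -[]. Qed.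

Lemma continuous_getc i : continuous (fun x : space3 R => getc x i).
Proof.
have -> : (fun x : space3 R => getc x i) = (fun x =>
    if i == 0 :> nat then x.1.1 else if i == 1 :> nat then x.1.2 else x.2).
  by apply/funext => x; rewrite getcE.
case: i => -[|[|[|//]]] ? /= x.
- by apply: (@continuous_comp _ _ _ fst fst x); [exact: cvg_fst|exact: cvg_fst].
- by apply: (@continuous_comp _ _ _ fst snd x); [exact: cvg_fst|exact: cvg_snd].
- exact: cvg_snd.
Qed.

Definition tensor3 (F : 'I_3 -> R -> R) x : R := \prod_i F i (getc x i).

Lemma tensor3_setc F x i t : tensor3 F (setc x i t) =
  F i t * \prod_(j | j != i) F j (getc x j).
Proof.
rewrite /tensor3 (bigD1 i)//= getc_setc eqxx; congr (_ * _).
by apply: eq_bigr => j /negPf ji; rewrite getc_setc ji.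
Qed.

Lemma partial_tensor3 F x i : (forall j, smooth1 (F j)) ->
  derivable (tensor3 F) x (std_basis R i) /\
  partial i (tensor3 F) x =
  tensor3 (fun j => if j == i then derive1 (F j) else F j) x.
Proof.
move=> sF; apply: partial_eq.
under [X in is_derive _ _ X]eq_fun do rewrite tensor3_setc.
set c := \prod_(j | j != i) _.
have -> : tensor3 (fun j => if j == i then derive1 (F j) else F j) x =
    derive1 (F i) (getc x i) * c.
  rewrite /tensor3 (bigD1 i)//= eqxx; congr (_ * _).
  by apply: eq_bigr => j /negPf ->.
have D : is_derive (getc x i) 1 (F i) (derive1 (F i) (getc x i)).
  by rewrite derive1E; apply/derivableP; exact: smooth1_derivable.
apply: (is_derive_eq (is_deriveM D (is_derive_cst c (getc x i) 1))).
by rewrite scaler0 add0r /GRing.scale/= mulrC.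
Qed.

Lemma continuous_tensor3 F : (forall j, continuous (F j)) -> continuous (tensor3 F).
Proof.
move=> cF; rewrite /tensor3.
have -> : (fun x => \prod_i F i (getc x i)) = (fun x =>
   F 0 (getc x 0) * (F 1 (getc x 1) * F 2%R (getc x 2%R))).
  apply/funext => x; rewrite !big_ord_recl big_ord0 mulr1.
  by congr (_ * (_ * _)); congr (F _ (getc _ _)); exact/val_inj.
move=> x; apply: cvgM; last apply: cvgM.
all: apply: continuous_comp; [exact: continuous_getc|exact: cF].
Qed.

(** A partial derivative only differentiates one factor, so iterated partial derivatives stay within
    tensor products of smooth functions. *)
Lemma smooth_tensor3 F : (forall j, smooth1 (F j)) -> smooth (tensor3 F).
Proof.
move=> sF s.
have [F' sF' ->] : exists2 F', (forall j, smooth1 (F' j)) &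
    foldr (@partial R) (tensor3 F) s = tensor3 F'.
  elim: s => [|i s [F' sF' IH]]; first by exists F.
  exists (fun j => if j == i then derive1 (F' j) else F' j).
    by move=> j; case: eqP => // _; exact: smooth1_derive.
  by rewrite /= IH; apply/funext => x; exact: (partial_tensor3 x i sF').2.
split; first by apply: continuous_tensor3 => j; exact: smooth1_continuous.
by move=> i x; exact: (partial_tensor3 x i sF').1.
Qed.

Lemma smooth_partial f i : smooth f -> smooth (partial i f).
Proof. by move=> sf s; have := sf (rcons s i); rewrite foldr_rcons. Qed.

Lemma smooth_continuous f : smooth f -> continuous f.
Proof. by move=> sf; have [] := sf [::]. Qed.

Lemma smooth_derivable f x i : smooth f -> derivable f x (std_basis R i).
Proof. by move=> sf; have [_] := sf [::]; apply. Qed.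

Lemma partial_lin a f g i x : derivable f x (std_basis R i) ->
  derivable g x (std_basis R i) ->
  partial i (fun y => a * f y + g y) x = a * partial i f x + partial i g x.
Proof.
move=> df dg; rewrite /partial.
rewrite (_ : (fun y => _) = (a *: f) + g); last by [].
have daf : derivable (a *: f : space3 R -> R) x (std_basis R i).
  exact: derivableZ.
by rewrite (deriveD daf dg) deriveZ.
Qed.

Lemma smooth_lin a f g : smooth f -> smooth g -> smooth (fun x => a * f x + g x).
Proof.
move=> sf sg s.
have E : foldr (@partial R) (fun x => a * f x + g x) s =
    (fun x => a * foldr (@partial R) f s x + foldr (@partial R) g s x).
  elim: s => // i s IH; rewrite /= IH; apply/funext => x.
  by apply: partial_lin; [exact: (sf s).2|exact: (sg s).2].
rewrite E; split.
  move=> x; apply: cvgD; last exact: (sg s).1.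
  by apply: cvgMr; exact: (sf s).1.
move=> i x; apply: derivableD; last exact: (sg s).2.
by apply: derivableZ; exact: (sf s).2.
Qed.

Lemma partial_mul f g i x : derivable f x (std_basis R i) ->
  derivable g x (std_basis R i) ->
  derivable (fun y => f y * g y) x (std_basis R i) /\
  partial i (fun y => f y * g y) x = f x * partial i g x + g x * partial i f x.
Proof.
move=> df dg; split; first exact: (derivableM df dg).
by rewrite /partial (deriveM df dg).
Qed.

Lemma MVT_line f x i a b : a < b -> (forall y, derivable f y (std_basis R i)) ->
  exists2 c, a < c < b &
    f (setc x i b) - f (setc x i a) = partial i f (setc x i c) * (b - a).
Proof.
move=> ab df.
have D t : is_derive t 1 (fun s => f (setc x i s) : R) (partial i f (setc x i t)).
  exact: is_derive_line.
have [c] := MVT ab (fun t _ => D t) (derivable_within_continuous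
  (fun t _ => @ex_derive _ _ _ _ _ _ _ (D t))).
by rewrite in_itv/= => cab E; exists c.
Qed.

(** Mean value theorem in direction [i] for the increment of [f] in direction [j], followed by the
    mean value theorem in direction [j] for [partial i f]. *)
Lemma double_MVT f x i j h : i != j -> 0 < h -> smooth f ->
  exists c d, [/\ getc x i < c < getc x i + h, getc x j < d < getc x j + h &
  f (setc (setc x i (getc x i + h)) j (getc x j + h)) -
  f (setc x i (getc x i + h)) - (f (setc x j (getc x j + h)) - f x) =
  partial j (partial i f) (setc (setc x i c) j d) * h ^+ 2].
Proof.
move=> ij h0 sf; set s := getc x i; set t := getc x j.
pose g y := f (setc y j (t + h)) - f y.
have Dg y : derivable g y (std_basis R i) /\
    partial i g y = partial i f (setc y j (t + h)) - partial i f y.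
  apply: partial_eq.
  have D1 := is_derive_line
    (@smooth_derivable f (setc (setc y j (t + h)) i (getc y i)) i sf).
  have D2 := is_derive_line (@smooth_derivable f (setc y i (getc y i)) i sf).
  have -> : (fun u : R => g (setc y i u)) =
      (fun u => f (setc (setc y j (t + h)) i u)) - (fun u => f (setc y i u)).
    by apply/funext => u; rewrite /g setcC.
  apply: (is_derive_eq (is_deriveB D1 D2)).
  rewrite setc_getc; congr (partial i f _ - _).
  have ji : j != i by rewrite eq_sym.
  by rewrite setcC// setc_getc.
have sh : s < s + h by rewrite ltrDl.
have th : t < t + h by rewrite ltrDl.
have [c csh] := MVT_line x sh (fun y => (Dg y).1).
rewrite (Dg _).2 /s setc_getc -/s => E1.
have [d dth] := MVT_line (setc x i c) th (fun y => @smooth_derivable _ y j (smooth_partial i sf)).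
rewrite (_ : setc (setc x i c) j t = setc x i c); last first.
  by rewrite setcC// setc_getc.
move=> E2; exists c, d; split => //.
rewrite -/(g _) -/(g x).
rewrite [LHS]E1 E2; ring.
Qed.

Lemma ball_setc2 x i j c d h : getc x i < c < getc x i + h ->
  getc x j < d < getc x j + h -> ball x h (setc (setc x i c) j d).
Proof.
move=> ci dj.
have h0 : 0 < h by lra.
have B (k : 'I_3) : `|getc x k - getc (setc (setc x i c) j d) k| < h.
  rewrite !getc_setc; case: eqP => [->|_].
    by rewrite ltr_norml; apply/andP; split; lra.
  case: eqP => [->|_]; last by rewrite subrr normr0.
  by rewrite ltr_norml; apply/andP; split; lra.
have B0 := B (@Ordinal 3 0 isT); have B1 := B (@Ordinal 3 1 isT).
have B2 := B (@Ordinal 3 2 isT); rewrite !getcE in B0 B1 B2.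
by split; [split|]; rewrite -ball_normE.
Qed.

Let tri (p q w : R) : `|p - w| < `|p - q| / 2 -> `|q - w| < `|p - q| / 2 -> False.
Proof.
move=> pw qw; have := ler_normD (p - w) (w - q).
by rewrite addrA subrK (distrC w q) => le; lra.
Qed.

(** The second difference over a small square is symmetric in [i] and [j], so the two mixed
    derivatives agree at two points near [x]. Were they different at [x], continuity would keep both
    within half their distance of a common value. *)
Lemma partialC f i j x : smooth f ->
  partial i (partial j f) x = partial j (partial i f) x.
Proof.
move=> sf; have [->//|ij] := eqVneq i j.
have ci : continuous (partial i (partial j f)).
  exact: smooth_continuous (smooth_partial i (smooth_partial j sf)).
have cj : continuous (partial j (partial i f)).
  exact: smooth_continuous (smooth_partial j (smooth_partial i sf)).
apply/eqP; apply: contraT => ne.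
set u := partial i _ x in ne; set v := partial j _ x in ne.
have e0 : 0 < `|u - v| / 2 by rewrite divr_gt0// normr_gt0 subr_eq0.
have := ci x; move=> /cvgrPdist_lt /(_ _ e0) /nbhs_ballP[h1 /= h10 H1].
have := cj x; move=> /cvgrPdist_lt /(_ _ e0) /nbhs_ballP[h2 /= h20 H2].
pose h := Num.min h1 h2.
have h0 : 0 < h by rewrite lt_min h10 h20.
have [c [d [cc dd E1]]] := double_MVT x ij h0 sf.
have ji : j != i by rewrite eq_sym.
have [d' [c' [dd' cc' E2]]] := double_MVT x ji h0 sf.
have B1 : ball x h2 (setc (setc x i c) j d).
  by apply: (le_ball _ (ball_setc2 cc dd)); rewrite ge_min lexx orbT.
have B2 : ball x h1 (setc (setc x j d') i c').
  by apply: (le_ball _ (ball_setc2 dd' cc')); rewrite ge_min lexx.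
have hn : h ^+ 2 != 0 by rewrite expf_neq0// gt_eqF.
have vw : partial j (partial i f) (setc (setc x i c) j d) =
          partial i (partial j f) (setc (setc x j d') i c').
  apply: (@mulIf _ _ hn); rewrite /=.
  move: E1 E2; rewrite (setcC _ _ _ ij).
  move: (partial _ _ _) (partial _ _ _) (f _) (f _) (f _) (f _).
  by move=> p1 p2 a1 a2 a3 a4 <- <-; ring.
have := H2 _ B1; rewrite /= -/v vw => K2.
by case: (@tri u v _ (H1 _ B2) K2).
Qed.

Lemma grad_compE f y k : grad f y k 0 = partial k f y.
Proof. by rewrite mxE. Qed.

Lemma curl_grad f : smooth f -> curl (grad f) = fun=> 0.
Proof.
move=> sf; apply/funext => x; apply/matrixP => k l; rewrite ord1 !mxE.
under [X in partial _ X _ - _]eq_fun do rewrite grad_compE.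
under [X in _ - partial _ X _]eq_fun do rewrite grad_compE.
by rewrite partialC// subrr.
Qed.

Lemma vsmooth_grad f : smooth f -> vsmooth (grad f).
Proof.
move=> sf k; under [X in smooth X]eq_fun do rewrite grad_compE.
exact: smooth_partial.
Qed.

Lemma partial_support f i K : closed K -> (forall x, ~ K x -> f x = 0) ->
  forall x, ~ K x -> partial i f x = 0.
Proof.
move=> cK fK x Kx.
have oK : open (~` K) by exact: closed_openC.
have nK : \forall y \near x, f y = 0.
  by have := open_nbhs_nbhs (conj oK (Kx : (~` K) x)); apply: filterS.
rewrite /partial (@near_eq_derive _ _ _ _ (fun=> 0) _ _ nK).
exact: derive_cst.
Qed.

End Lines.

(** * The fundamental lemma of the calculus of variations *)

Section FundamentalLemma.
Variable R : realType.
Implicit Types (x a b : space3 R) (O : set (space3 R)).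
Local Notation mu := (leb3 R).

Definition bump3 a b n : space3 R -> R :=
  tensor3 (fun i => bump1 (getc a i) (getc b i) n).

Lemma smooth_bump3 a b n : smooth (bump3 a b n).
Proof. by apply: smooth_tensor3 => j; exact: smooth1_bump1. Qed.

Lemma oboxP a b x : obox a b x <-> forall i, getc a i < getc x i < getc b i.
Proof.
split => [[? ? ?] i|h]; first by rewrite !getcE; case: i => -[|[|[|]]].
by split; [have := h (@Ordinal 3 0 isT)|have := h (@Ordinal 3 1 isT)|
  have := h (@Ordinal 3 2 isT)]; rewrite !getcE.
Qed.

Lemma bump3_out a b n x : ~ obox a b x -> bump3 a b n x = 0.
Proof.
move=> /oboxP /existsNP[i ab]; rewrite /bump3 /tensor3 (bigD1 i)//=.
by rewrite bump1_out ?mul0r//; apply/negP.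
Qed.

Lemma bump3_bound a b n x : 0 <= bump3 a b n x <= 1.
Proof.
rewrite /bump3 /tensor3; apply/andP; split.
  by apply: prodr_ge0 => i _; exact: bump1_ge0.
by apply: prodr_ile1 => i _; rewrite bump1_ge0 bump1_le1.
Qed.

Lemma bump3_cvg a b x : bump3 a b n x @[n --> \oo] --> (\1_(obox a b) x : R).
Proof.
rewrite indicE; case: (boolP (x \in obox a b)) => xab /=; last first.
  rewrite (_ : (fun n => _) = fun=> 0); first exact: cvg_cst.
  by apply/funext => n; apply: bump3_out => /mem_set; apply/negP.
move: xab; rewrite inE => /oboxP xab.
rewrite (_ : (fun n => _) = (fun n =>
    bump1 (getc a 0) (getc b 0) n (getc x 0) *
    (bump1 (getc a 1) (getc b 1) n (getc x 1) *
     bump1 (getc a 2%R) (getc b 2%R) n (getc x 2%R)))); last first.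
  apply/funext => n; rewrite /bump3 /tensor3 !big_ord_recl big_ord0 mulr1.
  by congr (bump1 (getc _ _) (getc _ _) _ (getc _ _) *
    (bump1 (getc _ _) (getc _ _) _ (getc _ _) *
     bump1 (getc _ _) (getc _ _) _ (getc _ _))); exact/val_inj.
have -> : (1%:R : R) = 1 * (1 * 1) by rewrite !mulr1.
by apply: cvgM; [|apply: cvgM]; exact: bump1_cvg.
Qed.

Lemma compact_cbox a b : compact (cbox a b).
Proof.
rewrite cboxX; apply: compact_setX; last exact: segment_compact.
by apply: compact_setX; exact: segment_compact.
Qed.

Lemma bump3_support O a b n : cbox a b `<=` O ->
  compactly_supported_in O (bump3 a b n).
Proof.
move=> abO; exists (cbox a b); split => //; first exact: compact_cbox.
by move=> x xab; apply: bump3_out => /obox_cbox.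
Qed.

(** The bumps of a box take values in [[0, 1]] and converge pointwise to its indicator, so dominated
    convergence with dominating function [|g|] makes the integral of [g] over the box vanish. *)
Lemma fundamental_lemma O (g : space3 R -> R) : open O ->
  mu.-integrable O (EFin \o g) ->
  (forall a b n, cbox a b `<=` O ->
    \int[mu]_(x in O) (g x * bump3 a b n x) = 0) ->
  {ae mu, forall x, O x -> g x = 0}.
Proof.
move=> oO ig H; apply: ae0_of_boxes => // a b abO.
have mO := open_measurable3 oO.
have mg : measurable_fun O g by case/integrableP : ig => /measurable_EFinP.
have mb n : measurable_fun O (bump3 a b n).
  apply: measurable_funTS; apply: continuous_measurable3.
  exact: smooth_continuous (smooth_bump3 a b n).
have ib n : mu.-integrable O (EFin \o (fun x => g x * bump3 a b n x)).
  apply: (le_integrable mO _ _ ig).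
    by apply/measurable_EFinP; exact: measurable_funM.
  move=> x Ox /=; rewrite lee_fin normrM ler_piMr// ger0_norm.
    by have /andP[] := bump3_bound a b n x.
  by have /andP[] := bump3_bound a b n x.
have H0 n : (\int[mu]_(x in O) (g x * bump3 a b n x)%:E = 0)%E.
  apply/eqP; rewrite -fine_eq0; first exact/eqP/H.
  exact: integrable_fin_num (ib n).
have mi : measurable_fun O (fun x => (g x * \1_(obox a b) x)%:E).
  apply/measurable_EFinP/measurable_funM => //.
  by apply: measurable_indic; exact: measurable_obox.
have cvb : {ae mu, forall x, O x ->
    (g x * bump3 a b n x)%:E @[n --> \oo] --> (g x * \1_(obox a b) x)%:E}.
  apply: aeW => x _; apply: cvg_EFin; first exact: nearW.
  by apply: cvgMr; exact: bump3_cvg.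
have dom : {ae mu, forall x n, O x ->
    (`|(g x * bump3 a b n x)%:E| <= `|(EFin \o g) x|)%E}.
  apply: aeW => x n Ox /=; rewrite lee_fin normrM ler_piMr// ger0_norm.
    by have /andP[] := bump3_bound a b n x.
  by have /andP[] := bump3_bound a b n x.
have [_ _] := dominated_convergence mO (fun n => measurable_int _ (ib n)) mi
  cvb (integrable_abse ig) dom.
rewrite (_ : [sequence _]_n = fun=> 0%E); last by apply/funext => n; exact: H0.
move=> /(cvg_unique (@ereal_hausdorff R) (cvg_cst _)) => E.
have OI : O `&` obox a b = obox a b.
  by apply: setIidr => x /obox_cbox /abO.
rewrite -OI integral_mkcondr [RHS]E; apply: eq_integral => x _.
by rewrite patchE indicE; case: ifP; rewrite ?mulr1 ?mulr0.
Qed.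

End FundamentalLemma.

(* The product measure is named so that its sigma-finiteness can be recorded as an
   instance, without which Fubini does not apply to [leb3]. *)
Section Leb2.
Variable R : realType.
Local Notation leb := (@lebesgue_measure R).

Definition leb2 : set (measurableTypeR R * measurableTypeR R) -> \bar R :=
  (leb \x leb)%E.

HB.instance Definition _ := Measure.on leb2.

Lemma sigma_finite_leb2 : sigma_finite [set: measurableTypeR R * measurableTypeR R] leb2.
Proof.
have /sigma_finiteP[F [TF ndF Foo]] := sigma_finiteT leb.
exists (fun n => F n `*` F n).
  rewrite -setXTT TF predeqE => -[x y]; split.
    move=> [/= [n _ Fnx] [k _ Fky]]; exists (maxn n k) => //; split.
    - by move: x Fnx; exact/subsetPset/ndF/leq_maxl.
    - by move: y Fky; exact/subsetPset/ndF/leq_maxr.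
  by move=> [n _ []/= ? ?]; split; exists n.
move=> k; have [? ?] := Foo k.
split; first exact: measurableX.
by rewrite /leb2 /= product_measure1E// lte_mul_pinfty// ge0_fin_numE.
Qed.

HB.instance Definition _ := Measure_isSigmaFinite.Build _ _ _ leb2 sigma_finite_leb2.

End Leb2.

(** * Integration by parts over the whole space *)

Section IntegrationByParts.
Variable R : realType.
Implicit Types (x a b : space3 R) (O : set (space3 R)).
Local Notation mu := (leb3 R).
Local Notation leb := (@lebesgue_measure R).

Lemma leb3_obox_lty a b : (mu (obox a b) < +oo)%E.
Proof.
rewrite oboxX.
have -> : leb3 R = (@leb2 R \x leb)%E by [].
rewrite product_measure1E//; last by apply: measurableX; exact: measurable_itv.
suff H : (leb2 (`]a.1.1, b.1.1[ `*` `]a.1.2, b.1.2[) * leb `]a.2, b.2[ < +oo)%E.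
  exact: H.
have itv_fin (u v : R) : leb `]u, v[ \is a fin_num.
  by rewrite lebesgue_measure_itv/=; case: ifP.
rewrite /leb2 product_measure1E; [|exact: measurable_itv|exact: measurable_itv].
rewrite ltey_eq; apply/orP; left.
by apply: fin_numM; [apply: fin_numM|]; exact: itv_fin.
Qed.

Lemma continuous_setc x i : continuous (fun t : R => setc x i t : space3 R).
Proof.
move=> t; rewrite /setc; case: i => -[|[|[|//]]] ? /=.
- exact: (cvg_pair (cvg_pair cvg_id (cvg_cst _)) (cvg_cst _)).
- exact: (cvg_pair (cvg_pair (cvg_cst _) cvg_id) (cvg_cst _)).
- exact: (cvg_pair (cvg_cst _) cvg_id).
Qed.

Lemma integral_derive_line (F : space3 R -> R) a b x (i : 'I_3) :
  (forall y, derivable F y (std_basis R i)) -> continuous (partial i F) ->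
  (forall y, ~ cbox a b y -> F y = 0) ->
  (\int[leb]_t (partial i F (setc x i t))%:E = 0)%E.
Proof.
move=> dF cF F0.
(* [d] exceeds the absolute values of both end coordinates, so the endpoints [-d] and [d] and
   everything beyond them lie off the box. *)
pose d : R := `|getc a i| + `|getc b i| + 1.
have ha := normr_ge0 (getc a i); have hb := normr_ge0 (getc b i).
have la := ler_norm (- getc a i); have lb := ler_norm (getc b i).
rewrite normrN in la.
have out (t : R) : ~ (- d < t < d) -> ~ cbox a b (setc x i t).
  move=> td; have cboxi y : cbox a b y -> getc a i <= getc y i <= getc b i.
    by move=> [? ? ?]; rewrite !getcE; case: (i) => -[|[|[|]]].
  move=> /cboxi; rewrite getc_setc eqxx => tab; apply: td.
  by rewrite /d; apply/andP; split; lra.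
have dpos : - d < d by rewrite /d; lra.
have cb : closed (cbox a b).
  by apply: compact_closed; [exact: norm_hausdorff|exact: compact_cbox].
have ct : continuous (fun t : R => setc x i t).
  exact: continuous_setc.
have D (t : R) : is_derive t 1 (fun s : R => F (setc x i s) : R) (partial i F (setc x i t)).
  exact: is_derive_line.
transitivity (\int[leb]_(t in `[(- d)%R, d]) (partial i F (setc x i t))%:E)%E; last first.
  rewrite (@continuous_FTC2 _ _ (fun s => F (setc x i s))).
  - rewrite !F0 ?subee//; apply: out; rewrite ltxx ?andbF//.
  - exact: dpos.
  - apply: continuous_subspaceT => t.
    by apply: (continuous_comp (@ct t)); exact: cF.
  - have cFl : continuous (fun s => F (setc x i s) : R).
      by move=> t; apply/differentiable_continuous/derivable1_diffP; exact: (@ex_derive _ _ _ _ _ _ _ (D t)).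
    split.
    + by move=> t _; exact: (@ex_derive _ _ _ _ _ _ _ (D t)).
    + by apply: cvg_at_right_filter; exact: cFl.
    + by apply: cvg_at_left_filter; exact: cFl.
  - by move=> t _; rewrite derive1E; have [_ ->] := D t.
rewrite [RHS]integral_mkcond; apply: eq_integral => t _.
rewrite patchE; case: ifPn => //; rewrite notin_setE/= in_itv/= => td.
congr EFin; apply: (partial_support i cb F0); apply: out => /andP[? ?].
by apply: td; apply/andP; split; exact: ltW.
Qed.

Lemma bounded_support_integrable (G : space3 R -> R) a b : continuous G ->
  (forall y, ~ cbox a b y -> G y = 0) -> mu.-integrable [set: space3 R] (EFin \o G).
Proof.
move=> cG G0.
have cGT : {within cbox a b, continuous G} by exact: continuous_subspaceT.
have [M [_ HM]] := @compact_bounded _ _ _ (continuous_compact cGT (@compact_cbox _ a b)).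
(* Padding by 1 puts the closed box inside an open one of finite measure, whose indicator dominates.
   The bound is [|M| + 1] because every real above [M] bounds the image. *)
pose p : space3 R := (getc a 0 - 1, getc a 1 - 1, getc a 2%R - 1).
pose q : space3 R := (getc b 0 + 1, getc b 1 + 1, getc b 2%R + 1).
have sub : cbox a b `<=` obox p q.
  move=> x [/andP[? ?] /andP[? ?] /andP[? ?]].
  by split; rewrite /= getcE/= getcE/=; apply/andP; split; lra.
have mpq := measurable_obox p q.
apply: (@integrable_ae_eq_le _ _ _ _ _ _ (fun x => (`|M| + 1) * \1_(obox p q) x)) => //.
- exact: continuous_measurable3.
- have ii : mu.-integrable [set: space3 R] (EFin \o (\1_(obox p q) : space3 R -> R)).
    apply/integrableP; split.
      by apply/measurable_EFinP; exact: measurable_indic.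
    rewrite (_ : (fun x => _) = EFin \o (\1_(obox p q) : space3 R -> R)).
      by rewrite integral_indic// setIT leb3_obox_lty.
    by apply/funext => x /=; rewrite ger0_norm.
  exact: (integrableZl measurableT (`|M| + 1) ii).
- apply: aeW => x _.
  have [/[dup] xab /sub xpq|xab] := pselect (cbox a b x).
    rewrite indicE mem_set//= mulr1; apply: (HM (`|M| + 1)).
      by rewrite (le_lt_trans (ler_norm M))// ltrDl.
    by exists x.
  by rewrite G0// normr0 mulr_ge0// addr_ge0.
Qed.

(** Fubini is arranged so that coordinate [i] is integrated innermost, where the fundamental theorem
    of calculus gives zero. *)
Lemma integral_partial0 (F : space3 R -> R) a b (i : 'I_3) :
  (forall y, derivable F y (std_basis R i)) -> continuous (partial i F) ->
  (forall y, ~ cbox a b y -> F y = 0) ->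
  (\int[mu]_y (partial i F y)%:E = 0)%E.
Proof.
move=> dF cF F0.
have cb : closed (cbox a b).
  by apply: compact_closed; [exact: norm_hausdorff|exact: compact_cbox].
have iG : mu.-integrable [set: space3 R] (EFin \o partial i F).
  exact: (bounded_support_integrable cF (partial_support i cb F0)).
have L x := integral_derive_line x dF cF F0.
have E3 : leb3 R = (@leb2 R \x leb)%E by [].
case: i dF cF iG L => -[|[|[|//]]] lti dF cF iG L.
(* Coordinate 0 sits inside the planar factor, so that factor is split again; its sections are
   integrable only for almost every [z]. *)
- rewrite -(@integral21_prod_meas1 _ _ _ _ _ (@leb2 R) leb _ iG) /fubini_G.
  rewrite (@ae_eq_integral_nonmeas _ _ _ _ _ _ (fun=> 0%E)) ?integral0//.
  have := @ae_integrable2 _ _ _ _ _ (@leb2 R) leb _ iG.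
  apply: filterS => z iz _.
  rewrite -(@integral21_prod_meas1 _ _ _ _ _ leb leb _ iz) /fubini_G.
  rewrite integral0_eq// => y _.
  by have := L ((0, y), z).
- rewrite -(@integral21_prod_meas1 _ _ _ _ _ (@leb2 R) leb _ iG) /fubini_G.
  rewrite (@ae_eq_integral_nonmeas _ _ _ _ _ _ (fun=> 0%E)) ?integral0//.
  have := @ae_integrable2 _ _ _ _ _ (@leb2 R) leb _ iG.
  apply: filterS => z iz _.
  rewrite -(@integral12_prod_meas1 _ _ _ _ _ leb leb _ iz) /fubini_F.
  rewrite integral0_eq// => y _.
  by have := L ((y, 0), z).
- rewrite -(@integral12_prod_meas1 _ _ _ _ _ (@leb2 R) leb _ iG) /fubini_F.
  rewrite integral0_eq// => -[y1 y2] _.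
  by have := L ((y1, y2), 0).
Qed.

(** The partial derivative of the product [f g] has zero integral; it is enough that [g] alone is
    supported in the box. *)
Lemma integration_by_parts3 (f g : space3 R -> R) a b (i : 'I_3) :
  smooth f -> smooth g -> (forall y, ~ cbox a b y -> g y = 0) ->
  \int[mu]_y (f y * partial i g y) = - \int[mu]_y (partial i f y * g y).
Proof.
move=> sf sg g0.
have cb : closed (cbox a b).
  by apply: compact_closed; [exact: norm_hausdorff|exact: compact_cbox].
have i1 : mu.-integrable [set: space3 R] (EFin \o (fun y => f y * partial i g y)).
  apply: (@bounded_support_integrable _ a b).
    move=> y; apply: cvgM; first exact: smooth_continuous.
    exact: (smooth_continuous (smooth_partial i sg)).
  by move=> y yab; rewrite (partial_support i cb g0)// mulr0.
have i2 : mu.-integrable [set: space3 R] (EFin \o (fun y => partial i f y * g y)).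
  apply: (@bounded_support_integrable _ a b).
    move=> y; apply: cvgM; first exact: (smooth_continuous (smooth_partial i sf)).
    exact: smooth_continuous.
  by move=> y yab; rewrite g0// mulr0.
have PE y : partial i (fun y => f y * g y) y = f y * partial i g y + partial i f y * g y.
  rewrite (partial_mul (@smooth_derivable _ f y i sf) (@smooth_derivable _ g y i sg)).2.
  by rewrite (mulrC (g y)).
have PEf : partial i (fun y => f y * g y) =
    fun y => f y * partial i g y + partial i f y * g y.
  by apply/funext => y; exact: PE.
apply/eqP; rewrite -addr_eq0 -RintegralD//; apply/eqP.
rewrite /Rintegral.
have := @integral_partial0 (fun y => f y * g y) a b i.
rewrite PEf => ->//.
- move=> y.
  exact: (partial_mul (@smooth_derivable _ f y i sf) (@smooth_derivable _ g y i sg)).1.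
- move=> y; apply: cvgD; apply: cvgM.
  + exact: smooth_continuous.
  + exact: (smooth_continuous (smooth_partial i sg)).
  + exact: (smooth_continuous (smooth_partial i sf)).
  + exact: smooth_continuous.
- by move=> y yab; rewrite g0// mulr0.
Qed.

End IntegrationByParts.

(** * The weak curl *)

Section WeakCurl.
Variable R : realType.
Implicit Types (x a b : space3 R) (O U : set (space3 R)) (u v w phi : vfield R).
Local Notation mu := (leb3 R).

Lemma bounded_sub_box O : bounded_set O ->
  exists a b : space3 R, O `<=` obox a b /\ O `<=` cbox a b.
Proof.
move=> [M [_ HM]].
pose N : R := `|M| + 1.
have N1 : M < N by rewrite /N (le_lt_trans (ler_norm M))// ltrDl.
exists (- (N + 1), - (N + 1), - (N + 1)), (N + 1, N + 1, N + 1).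
suff H : O `<=` obox (- (N + 1), - (N + 1), - (N + 1)) (N + 1, N + 1, N + 1).
  by split => // x /H /obox_cbox.
move=> x /(HM _ N1) /=; rewrite prod_normE ge_max prod_normE ge_max.
move=> /andP[/andP[]]; rewrite !ler_norml => /andP[? ?] /andP[? ?] /andP[? ?].
by split; rewrite /=; apply/andP; split; lra.
Qed.

Lemma bounded_measure_lty O : measurable O -> bounded_set O -> (mu O < +oo)%E.
Proof.
move=> mO /bounded_sub_box[a [b [Oab _]]].
apply: le_lt_trans (leb3_obox_lty a b).
by apply: le_measure; rewrite ?inE//; exact: measurable_obox.
Qed.

Lemma continuous_bounded_on O (f : space3 R -> R) : bounded_set O -> continuous f ->
  exists M, forall x, O x -> `|f x| <= M.
Proof.
move=> /bounded_sub_box[a [b [_ Oab]]] cf.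
have cT : {within cbox a b, continuous f} by exact: continuous_subspaceT.
have [M [_ HM]] := @compact_bounded _ _ _ (continuous_compact cT (@compact_cbox _ a b)).
exists (`|M| + 1) => x /Oab xab; apply: (HM (`|M| + 1)); last by exists x.
by rewrite (le_lt_trans (ler_norm M))// ltrDl.
Qed.

Lemma scalarL2_cst O (c : R) : measurable O -> bounded_set O -> scalarL2 O (fun=> c).
Proof.
move=> mO bO; split; first exact: measurable_cst.
have /integrableP : mu.-integrable O (cst (c ^+ 2)%:E).
  apply/integrableP; split; first exact: measurable_cst.
  rewrite integral_cst// lte_mul_pinfty//.
  exact: bounded_measure_lty.
by move=> [? ?]; apply/integrableP.
Qed.

Lemma scalarL2_continuous O (f : space3 R -> R) : measurable O -> bounded_set O ->
  continuous f -> scalarL2 O f.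
Proof.
move=> mO bO cf; have [M HM] := continuous_bounded_on bO cf.
have := scalarL2_bounded_mul mO _ _ (scalarL2_cst 1 mO bO) => /(_ M f).
under [X in scalarL2 _ X]eq_fun do rewrite mulr1.
apply; first by apply: measurable_funTS; exact: continuous_measurable3.
by apply: aeW => x; exact: HM.
Qed.

Lemma scalarL2_integrable O (f : space3 R -> R) : measurable O -> bounded_set O ->
  scalarL2 O f -> mu.-integrable O (EFin \o f).
Proof.
move=> mO bO fL; have := scalarL2_mul_integrable mO fL (scalarL2_cst 1 mO bO).
by congr (_.-integrable _ _); apply/funext => x /=; rewrite mulr1.
Qed.

Lemma vectorL2_vsmooth O phi : measurable O -> bounded_set O ->
  vsmooth phi -> vectorL2 O phi.
Proof. by move=> mO bO sp i; apply: scalarL2_continuous => //; exact: smooth_continuous. Qed.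

Lemma curl_compE phi x k : curl phi x k 0 =
  partial (k + 1) (fun y => phi y (k + 2) 0) x -
  partial (k + 2) (fun y => phi y (k + 1) 0) x.
Proof. by rewrite mxE. Qed.

Lemma continuous_curl phi k : vsmooth phi -> continuous (fun x => curl phi x k 0).
Proof.
move=> sp; under eq_fun do rewrite curl_compE.
move=> x; apply: cvgB; exact: (smooth_continuous (smooth_partial _ (sp _))).
Qed.

Lemma vectorL2_curl O phi : measurable O -> bounded_set O ->
  vsmooth phi -> vectorL2 O (curl phi).
Proof.
by move=> mO bO sp i; apply: scalarL2_continuous => //; exact: continuous_curl.
Qed.

Definition bumpv a b n (k : 'I_3) : vfield R :=
  fun x => bump3 a b n x *: delta_mx k 0.

Lemma bumpv_compE a b n k x i : bumpv a b n k x i 0 = (i == k)%:R * bump3 a b n x.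
Proof. by rewrite !mxE eqxx andbT mulrC. Qed.

Lemma dot_bumpv v a b n k x : dot (v x) (bumpv a b n k x) = v x k 0 * bump3 a b n x.
Proof.
rewrite /dot (bigD1 k)//= bumpv_compE eqxx mul1r big1 ?addr0// => i /negPf ik.
by rewrite bumpv_compE ik mul0r mulr0.
Qed.

Lemma smooth_zero : smooth (fun _ : space3 R => 0 : R).
Proof.
have := @smooth_bump3 R 0 0 0.
have -> : bump3 0 0 0 = fun _ : space3 R => 0 : R.
  by apply/funext => x; apply: bump3_out => -[/= /andP[h1 h2]]; have := lt_trans h1 h2; rewrite ltxx.
by [].
Qed.

Lemma vsmooth_bumpv a b n k : vsmooth (bumpv a b n k).
Proof.
move=> i; under [X in smooth X]eq_fun do rewrite bumpv_compE.
have := smooth_lin ((i == k)%:R) (smooth_bump3 a b n) smooth_zero.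
by under [X in smooth X -> _]eq_fun do rewrite addr0.
Qed.

Lemma bumpv_support O a b n k : cbox a b `<=` O ->
  compactly_supported_in O (bumpv a b n k).
Proof.
move=> /(bump3_support n)[K [cK KO K0]]; exists K; split => // x Kx.
by rewrite /bumpv K0// scale0r.
Qed.

Lemma ae_eq_on_comp O u v :
  (forall k, {ae mu, forall x, O x -> u x k 0 = v x k 0}) -> ae_eq_on O u v.
Proof.
move=> H; have : {ae mu, forall x, forall k : 'I_3, O x -> u x k 0 = v x k 0}.
  have H0 := H 0; have H1 := H 1; have H2 := H 2%R.
  apply: filterS3 H0 H1 H2 => x h0 h1 h2 k Ox.
  case: k => -[|[|[|//]]] lt.
  - by rewrite (_ : Ordinal lt = 0) ?h0//; exact/val_inj.
  - by rewrite (_ : Ordinal lt = 1) ?h1//; exact/val_inj.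
  - by rewrite (_ : Ordinal lt = 2%R) ?h2//; exact/val_inj.
apply: filterS => x h Ox; apply/matrixP => i j; rewrite ord1; exact: h.
Qed.

(** Test fields with a single nonzero component, a bump, reduce the claim to the fundamental lemma
    for each component of [g - g']. *)
Lemma weak_curl_unique O u g g' : open O -> bounded_set O ->
  vectorL2 O g -> vectorL2 O g' -> weak_curl O u g -> weak_curl O u g' ->
  ae_eq_on O g g'.
Proof.
move=> oO bO gL gL' wg wg'; have mO := open_measurable3 oO.
have dL := vectorL2_B mO gL gL'.
apply: ae_eq_on_comp => k.
have : {ae mu, forall x, O x -> (g - g') x k 0 = 0}.
  apply: fundamental_lemma => //; first exact: scalarL2_integrable.
  move=> a b n abO.
  have sp := vsmooth_bumpv a b n k.
  have : ip O (g - g') (bumpv a b n k) = 0.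
    rewrite ipBl//; last exact: vectorL2_vsmooth.
    rewrite -(wg _ sp (bumpv_support n k abO)).
    by rewrite -(wg' _ sp (bumpv_support n k abO)) subrr.
  by rewrite /ip; under eq_Rintegral do rewrite dot_bumpv.
by apply: filterS => x h Ox; have := h Ox; rewrite !mxE => /eqP; rewrite subr_eq0 => /eqP.
Qed.

Lemma wcurlP O u : Hcurl O u -> vectorL2 O (wcurl O u) /\ weak_curl O u (wcurl O u).
Proof.
move=> [uL [g gL wg]].
by apply: (@xgetPex _ (fun=> 0) [set g | vectorL2 O g /\ weak_curl O u g]); exists g.
Qed.

Lemma Hcurl_L2 O u : Hcurl O u -> vectorL2 O u.
Proof. by case. Qed.

Lemma wcurl_L2 O u : Hcurl O u -> vectorL2 O (wcurl O u).
Proof. by move=> /wcurlP[]. Qed.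

Lemma weak_curl_lin O c u v g g' : open O -> bounded_set O ->
  vectorL2 O u -> vectorL2 O v -> vectorL2 O g -> vectorL2 O g' ->
  weak_curl O u g -> weak_curl O v g' -> weak_curl O (c *: u + v) (c *: g + g').
Proof.
move=> oO bO uL vL gL gL' wg wg' phi sp cp; have mO := open_measurable3 oO.
have pL := vectorL2_vsmooth mO bO sp; have cL := vectorL2_curl mO bO sp.
by rewrite (ip_linl c mO uL vL cL) (ip_linl c mO gL gL' pL) wg// wg'.
Qed.

Lemma Hcurl_lin O c u v : open O -> bounded_set O ->
  Hcurl O u -> Hcurl O v -> Hcurl O (c *: u + v).
Proof.
move=> oO bO Hu Hv; have mO := open_measurable3 oO.
split; first by apply: vectorL2_lin => //; exact: Hcurl_L2.
exists (c *: wcurl O u + wcurl O v).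
  by apply: vectorL2_lin => //; exact: wcurl_L2.
have [uc wu] := wcurlP Hu; have [vc wv] := wcurlP Hv.
exact: (weak_curl_lin c oO bO (Hcurl_L2 Hu) (Hcurl_L2 Hv) uc vc wu wv).
Qed.

(** Both sides are weak curls of the same field, hence equal almost everywhere; the choice made by
    [wcurl] permits no pointwise identity. *)
Lemma wcurl_lin O c u v : open O -> bounded_set O ->
  Hcurl O u -> Hcurl O v ->
  ae_eq_on O (wcurl O (c *: u + v)) (c *: wcurl O u + wcurl O v).
Proof.
move=> oO bO Hu Hv; have mO := open_measurable3 oO.
have [uc wu] := wcurlP Hu; have [vc wv] := wcurlP Hv.
have [sc ws] := wcurlP (Hcurl_lin c oO bO Hu Hv).
refine (weak_curl_unique oO bO sc (vectorL2_lin c mO uc vc) ws _).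
exact (weak_curl_lin c oO bO (Hcurl_L2 Hu) (Hcurl_L2 Hv) uc vc wu wv).
Qed.

Lemma wcurl_ae O u v : open O -> bounded_set O -> Hcurl O u -> Hcurl O v ->
  ae_eq_on O u v -> ae_eq_on O (wcurl O u) (wcurl O v).
Proof.
move=> oO bO /wcurlP[uc wu] /wcurlP[vc wv] uv.
have wuv : weak_curl O u (wcurl O v).
  by move=> phi sp cp; rewrite (ip_ael _ uv); exact: wv.
exact (weak_curl_unique oO bO uc vc wu wuv).
Qed.

Lemma H0curl_lin O c u v : open O -> bounded_set O ->
  H0curl O u -> H0curl O v -> H0curl O (c *: u + v).
Proof.
move=> oO bO [Hu tu] [Hv tv]; have mO := open_measurable3 oO.
split; first exact: Hcurl_lin.
move=> phi sp; rewrite /tangential_trace (ip_ael _ (wcurl_lin c oO bO Hu Hv)).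
have pL := vectorL2_vsmooth mO bO sp; have cL := vectorL2_curl mO bO sp.
rewrite (ip_linl c mO (Hcurl_L2 Hu) (Hcurl_L2 Hv) cL).
rewrite (ip_linl c mO (wcurl_L2 Hu) (wcurl_L2 Hv) pL).
have := tu _ sp; have := tv _ sp; rewrite /tangential_trace.
set p := ip _ _ _; set q := ip _ _ _; set r := ip _ _ _; set s := ip _ _ _.
move=> /eqP; rewrite subr_eq0 => /eqP -> /eqP; rewrite subr_eq0 => /eqP ->.
by rewrite subrr.
Qed.

Lemma grad_support O f : compactly_supported_in O f -> compactly_supported_in O (@grad R f).
Proof.
move=> [K [cK KO K0]]; exists K; split => // x Kx.
have clK : closed K by apply: compact_closed => //; exact: norm_hausdorff.
by apply/matrixP => i j; rewrite ord1 !mxE (partial_support i clK K0).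
Qed.

(** The weak divergence is 0: the gradient of a test function is itself a test field for the weak
    curl, and its curl vanishes by symmetry of second derivatives. *)
Lemma Hdiv_wcurl O u : open O -> bounded_set O -> Hcurl O u -> Hdiv O (wcurl O u).
Proof.
move=> oO bO /wcurlP[uc wu]; have mO := open_measurable3 oO.
split => //; exists (fun=> 0); first exact: scalarL2_0.
move=> f sf cf; rewrite -wu; [|exact: vsmooth_grad|exact: grad_support].
rewrite curl_grad// (_ : (fun=> 0) = 0 :> vfield R)// ip0r.
by rewrite /Rintegral integral0_eq ?oppr0// => x _; rewrite mul0r.
Qed.

Lemma ip_restrict O U u v : measurable O -> measurable U -> U `<=` O ->
  (forall x, ~ U x -> u x = 0) -> ip O v u = ip U v u.
Proof.
move=> mO mU UO u0; rewrite /ip -[in RHS](setIidr UO) Rintegral_mkcondr.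
apply: eq_Rintegral => x _; rewrite patchE; case: ifPn => // /negP xU.
by rewrite u0 ?dot0r// => /mem_set.
Qed.

Lemma Rintegral_restrict (U : set (space3 R)) (f : space3 R -> R) :
  (forall x, ~ U x -> f x = 0) -> \int[mu]_(x in U) f x = \int[mu]_x f x.
Proof.
move=> f0; rewrite Rintegral_mkcond; apply: eq_Rintegral => x _.
by rewrite patchE; case: ifPn => // /negP xU; rewrite f0// => /mem_set.
Qed.

(** Index arithmetic modulo 3 for a field paired with the curl of a bump in component [k]: only the
    two components other than [k] contribute, with opposite signs. *)
Let cyclic_sum (Q X : 'I_3 -> R) (k : 'I_3) :
  \sum_l Q l * ((l + 2 == k)%:R * X (l + 1) - (l + 1 == k)%:R * X (l + 2)) =
  Q (k + 1) * X (k + 2) - Q (k + 2) * X (k + 1).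
Proof.
have pick (f : 'I_3 -> R) j : \sum_l (l == j)%:R * f l = f j.
  rewrite (bigD1 j)//= eqxx mul1r big1 ?addr0// => l /negPf ->.
  by rewrite mul0r.
have E2 (l : 'I_3) : (l + 2 == k) = (l == k + 1).
  by case: l (k) => [[|[|[|//]]] ?] [[|[|[|//]]] ?].
have E1 (l : 'I_3) : (l + 1 == k) = (l == k + 2).
  by case: l (k) => [[|[|[|//]]] ?] [[|[|[|//]]] ?].
have E3 : k + 1 + 1 = k + 2 by apply/val_inj; case: (k) => -[|[|[|//]]] ?.
have E4 : k + 2 + 2 = k + 1 by apply/val_inj; case: (k) => -[|[|[|//]]] ?.
transitivity (\sum_l (l == k + 1)%:R * (Q l * X (l + 1)) -
              \sum_l (l == k + 2)%:R * (Q l * X (l + 2))).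
  rewrite -sumrB; apply: eq_bigr => l _; rewrite E1 E2 mulrBr.
  by rewrite (mulrCA (Q l)) (mulrCA (Q l)).
by rewrite !pick E3 E4.
Qed.

Lemma dot_curl_bumpv q a b n k x : dot (q x) (curl (bumpv a b n k) x) =
  q x (k + 1) 0 * partial (k + 2) (bump3 a b n) x -
  q x (k + 2) 0 * partial (k + 1) (bump3 a b n) x.
Proof.
have P j l : partial j (fun y => bumpv a b n k y l 0) x =
    (l == k)%:R * partial j (bump3 a b n) x.
  under [X in partial _ X]eq_fun do rewrite bumpv_compE -[_ * _]addr0.
  rewrite (@partial_lin _ _ _ (fun=> 0)).
  - by rewrite [partial j (fun=> 0) x]derive_cst addr0.
  - exact: smooth_derivable (smooth_bump3 a b n).
  - exact: smooth_derivable smooth_zero.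
have C l : curl (bumpv a b n k) x l 0 =
   (l + 2 == k)%:R * partial (l + 1) (bump3 a b n) x -
   (l + 1 == k)%:R * partial (l + 2) (bump3 a b n) x.
  by rewrite curl_compE !P.
rewrite /dot; under eq_bigr do rewrite C.
exact: (cyclic_sum (fun l => q x l 0) (fun l => partial l (bump3 a b n) x) k).
Qed.

(** The weak curl is a local notion: bumps supported in [U] are test fields on [O] and see only the
    values of [u] on [U], which are those of the smooth [q]. *)
Lemma wcurl_local O U u q : open O -> bounded_set O -> open U -> U `<=` O ->
  Hcurl O u -> vsmooth q -> {ae mu, forall x, U x -> u x = q x} ->
  {ae mu, forall x, U x -> wcurl O u x = curl q x}.
Proof.
move=> oO bO oU UO Hu sq uq; have mO := open_measurable3 oO.
have mU := open_measurable3 oU.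
have bU : bounded_set U.
  by case: bO => M [Mr HM]; exists M; split => // M' MM' x /UO; exact: HM.
have [uc wu] := wcurlP Hu.
apply: ae_eq_on_comp => k.
have ucU i : scalarL2 U (fun x => wcurl O u x i 0).
  have [m1 i1] := uc i; split; first exact: measurable_funS m1.
  exact: integrableS i1.
have cqU := vectorL2_curl mU bU sq.
have : {ae mu, forall x, U x -> wcurl O u x k 0 - curl q x k 0 = 0}.
  apply: fundamental_lemma => //.
    apply: scalarL2_integrable => //.
    have := scalarL2_lin (-1) mU (cqU k) (ucU k).
    by congr scalarL2; apply/funext => x; rewrite mulN1r addrC.
  move=> a b n abU.
  have sp := vsmooth_bumpv a b n k.
  have b0 x : ~ U x -> bump3 a b n x = 0.
    by move=> Ux; apply: bump3_out => /obox_cbox /abU.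
  have bc x : ~ cbox a b x -> bump3 a b n x = 0.
    by move=> ab; apply: bump3_out => /obox_cbox.
  have clab : closed (cbox a b).
    by apply: compact_closed; [exact: norm_hausdorff|exact: compact_cbox].
  have pc j x : ~ cbox a b x -> partial j (bump3 a b n) x = 0.
    exact: partial_support.
  have abO : cbox a b `<=` O by move=> x /abU /UO.
  have wE : \int[mu]_(x in U) (wcurl O u x k 0 * bump3 a b n x) =
            \int[mu]_(x in U) (curl q x k 0 * bump3 a b n x).
    transitivity (ip U (wcurl O u) (bumpv a b n k)).
      by apply: eq_Rintegral => x _; rewrite dot_bumpv.
    rewrite -(@ip_restrict O)//; last by move=> x Ux; rewrite /bumpv b0// scale0r.
    rewrite -wu//; last exact: bumpv_support.
    rewrite (@ip_restrict O U)//; last first.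
      move=> x Ux; have nab : ~ cbox a b x by move=> /abU.
      by apply: dot_eq0; rewrite dot_curl_bumpv !pc// !mulr0 subrr.
    rewrite (ip_ael _ uq) /ip.
    under eq_Rintegral do rewrite dot_curl_bumpv.
    (* [q] is smooth on the whole space and the bump vanishes off [U], so both integrals may be
       taken over the whole space, where integration by parts holds. *)
    rewrite [LHS]Rintegral_restrict; last first.
      by move=> x Ux; rewrite !pc ?mulr0 ?subrr// => /abU.
    rewrite [RHS]Rintegral_restrict; last first.
      by move=> x Ux; rewrite b0// mulr0.
    under [RHS]eq_Rintegral do rewrite curl_compE mulrBl.
    have iL j l : mu.-integrable [set: space3 R]
        (EFin \o (fun x => q x j 0 * partial l (bump3 a b n) x)).
      apply: (@bounded_support_integrable _ _ a b).
        move=> y; apply: cvgM; first exact: (smooth_continuous (sq j)).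
        exact: (smooth_continuous (smooth_partial l (smooth_bump3 a b n))).
      by move=> y yab; rewrite pc// mulr0.
    have iR j l : mu.-integrable [set: space3 R]
        (EFin \o (fun x => partial l (fun y => q y j 0) x * bump3 a b n x)).
      apply: (@bounded_support_integrable _ _ a b).
        move=> y; apply: cvgM; last exact: (smooth_continuous (smooth_bump3 a b n)).
        exact: (smooth_continuous (smooth_partial l (sq j))).
      by move=> y yab; rewrite bc// mulr0.
    have sb := smooth_bump3 a b n.
    have I1 := @integration_by_parts3 _ _ _ a b (k + 2) (sq (k + 1)) sb bc.
    have I2 := @integration_by_parts3 _ _ _ a b (k + 1) (sq (k + 2)) sb bc.
    rewrite (RintegralB measurableT (iL _ _) (iL _ _)).
    rewrite (RintegralB measurableT (iR _ _) (iR _ _)).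
    have alg (p1 p2 r s : R) : p1 = - r -> p2 = - s -> p1 - p2 = s - r.
      by move=> -> ->; rewrite opprK addrC.
    exact (alg _ _ _ _ I1 I2).
  under eq_Rintegral do rewrite mulrBl.
  have bL : scalarL2 U (bump3 a b n).
    apply: scalarL2_continuous => //; exact: (smooth_continuous (smooth_bump3 a b n)).
  rewrite RintegralB//; last 2 first.
  - exact: scalarL2_mul_integrable (ucU k) bL.
  - exact: scalarL2_mul_integrable (cqU k) bL.
  by rewrite wE subrr.
by apply: filterS => x h Ux; apply/eqP; rewrite -subr_eq0; apply/eqP; exact: h.
Qed.

End WeakCurl.

(** * Local polynomial spaces *)

Section Polynomials.
Variable R : realType.
Implicit Types (x : space3 R) (p q : space3 R -> R) (D : pred nat) (e : 'I_3 -> nat).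

Definition mono e x : R := \prod_i vec x i 0 ^+ e i.

Lemma polyfun_lin k D c p q : polyfun k D p -> polyfun k D q ->
  polyfun k D (fun x => c * p x + q x).
Proof.
move=> [cp Ep] [cq Eq]; exists (fun a => c * cp a + cq a) => x.
rewrite Ep Eq mulr_sumr -big_split; apply: eq_bigr => a _.
by rewrite /= mulrDl mulrA.
Qed.

Lemma polyfun_0 k D : polyfun k D (fun=> 0 : R).
Proof. by exists (fun=> 0) => x; rewrite big1// => a _; rewrite mul0r. Qed.

Lemma polyfun_mono k D e : (forall i, (e i <= k)%N) -> D (\sum_i e i)%N ->
  polyfun k D (mono e).
Proof.
move=> ek De; pose a0 := [ffun i : 'I_3 => inord (e i) : 'I_k.+1].
have a0E i : a0 i = e i :> nat by rewrite ffunE inordK// ltnS.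
exists (fun a => (a == a0)%:R) => x.
rewrite (bigD1 a0)/=; last by rewrite (eq_bigr e)// => i _; rewrite a0E.
rewrite eqxx mul1r [X in _ + X]big1 ?addr0; last by move=> a /andP[_ /negPf ->]; rewrite mul0r.
by apply: eq_bigr => i _; rewrite a0E.
Qed.

(** The induction runs over lists of multi-indices; a property stable under linear combinations has
    to be checked on monomials only. *)
Lemma polyfun_ind k D (S : (space3 R -> R) -> Prop) :
  S (fun=> 0) -> (forall c p q, S p -> S q -> S (fun x => c * p x + q x)) ->
  (forall e, (forall i, (e i <= k)%N) -> D (\sum_i e i)%N -> S (mono e)) ->
  forall p, polyfun k D p -> S p.
Proof.
move=> S0 Slin Smono p [c /funext ->].
have H (s : seq {ffun 'I_3 -> 'I_k.+1}) : S (fun x =>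
    \sum_(a <- s | D (\sum_i a i)%N) c a * \prod_i vec x i 0 ^+ a i).
  elim: s => [|a s ih].
    by rewrite (_ : (fun x => _) = fun=> 0)//; apply/funext => x; rewrite big_nil.
  have [Da|Da] := boolP (D (\sum_i a i)%N); last first.
    rewrite (_ : (fun x => _) = (fun x => \sum_(a <- s | D (\sum_i a i)%N)
        c a * \prod_i vec x i 0 ^+ a i))//.
    by apply/funext => x; rewrite big_cons (negPf Da).
  rewrite (_ : (fun x => _) = (fun x => c a * mono (fun i => a i) x +
      \sum_(a <- s | D (\sum_i a i)%N) c a * \prod_i vec x i 0 ^+ a i)).
    by apply: Slin => //; apply: Smono => // i; rewrite -ltnS.
  by apply/funext => x; rewrite big_cons Da.
exact: H.
Qed.

Lemma mono_tensor3 e : mono e = tensor3 (fun i t => t ^+ e i).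
Proof. by []. Qed.

Lemma smooth_mono e : smooth (mono e).
Proof. by rewrite mono_tensor3; apply: smooth_tensor3 => j; exact: smooth1_exp. Qed.

Lemma smooth_polyfun k D p : polyfun k D p -> smooth p.
Proof.
apply: polyfun_ind; first exact: smooth_zero.
- by move=> *; exact: smooth_lin.
- by move=> *; exact: smooth_mono.
Qed.

Lemma partial_mono e i x : partial i (mono e) x =
  (e i)%:R * mono (fun j => if j == i then (e i).-1 else e j) x.
Proof.
rewrite mono_tensor3 (partial_tensor3 x i (fun j => @smooth1_exp R (e j))).2.
rewrite /tensor3 (bigD1 i)//= eqxx /mono [in RHS](bigD1 i)//= eqxx mulrA.
congr (_ * _); last by apply: eq_bigr => j /negPf ->.
rewrite derive1E exp_derive /GRing.scale/= mulr1.
by rewrite /getc.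
Qed.

Lemma partial_mono_degree e i : (0 < e i)%N ->
  (\sum_j (if j == i then (e i).-1 else e j)).+1 = (\sum_j e j)%N.
Proof.
move=> ei; rewrite [in LHS](bigD1 i)// [in RHS](bigD1 i)//= eqxx -addSn prednK//.
by congr (_ + _)%N; apply: eq_bigr => j /negPf ->.
Qed.

(** The degree predicates are kept abstract so that total degree at most [k] and homogeneity are
    treated together. *)
Lemma partial_polyfun k D k' D' i p :
  (forall e, (forall j, (e j <= k)%N) -> D (\sum_j e j)%N -> (0 < e i)%N ->
     (forall j, (e j - (j == i) <= k')%N) /\ D' (\sum_j e j).-1) ->
  polyfun k D p -> polyfun k' D' (partial i p).
Proof.
(* Smoothness is carried through the induction because the partial derivative of a sum splits only
   for derivable terms. *)
move=> H pD; have [sp //] : smooth p /\ polyfun k' D' (partial i p).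
move: p pD; apply: polyfun_ind => //.
- split; first exact: smooth_zero.
  rewrite (_ : partial i _ = fun=> 0); first exact: polyfun_0.
  by apply/funext => x; rewrite /partial derive_cst.
- move=> c p q [sp pp] [sq pq]; split; first exact: smooth_lin.
  rewrite (_ : partial i _ = fun x => c * partial i p x + partial i q x).
    exact: polyfun_lin.
  by apply/funext => x; apply: partial_lin; exact: smooth_derivable.
- move=> e ek De; split; first exact: smooth_mono.
  rewrite (_ : partial i _ = fun x => (e i)%:R *
      mono (fun j => if j == i then (e i).-1 else e j) x + 0); last first.
    by apply/funext => x; rewrite partial_mono addr0.
  (* With exponent 0 the derivative is zero and the truncated predecessor [(e i).-1] is harmless. *)
  have [->|ei] := posnP (e i).
    rewrite (_ : (fun x => _) = fun=> 0); first exact: polyfun_0.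
    by apply/funext => x; rewrite mul0r addr0.
  have [ek' De'] := H e ek De ei.
  apply: polyfun_lin; last exact: polyfun_0.
  apply: polyfun_mono.
    move=> j; have := ek' j; case: eqP => [->|_]; first by rewrite subn1.
    by rewrite subn0.
  by move: De'; rewrite -(partial_mono_degree ei).
Qed.

Lemma poly_leE k e : (\sum_(i < 3) e i <= k)%N -> forall i, (e i <= k)%N.
Proof. by move=> ek i; apply: leq_trans ek; rewrite (bigD1 i)//= leq_addr. Qed.

Lemma partial_poly_le k i p : poly_le k p -> poly_le k (partial i p).
Proof.
apply: partial_polyfun => e ek De ei; split.
  by move=> j; rewrite (leq_trans (leq_subr _ _)).
by rewrite (leq_trans (leq_pred _)).
Qed.

(** Before differentiation a single exponent may reach [k.+1]; afterwards the total degree is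
    exactly [k], which bounds every exponent by [k]. *)
Lemma partial_poly_homog k i p : poly_homog k.+1 p -> poly_le k (partial i p).
Proof.
apply: partial_polyfun => e ek /eqP De ei; have {De} : (\sum_j e j).-1 = k by rewrite De.
rewrite -(partial_mono_degree ei) => /= Dk; split; last by rewrite Dk.
move=> j; have := @poly_leE k _ (eq_leq Dk) j.
by case: eqP => [->|_]; rewrite ?subn1 ?subn0.
Qed.

Lemma poly_leS k p : poly_le k p -> poly_le k.+1 p.
Proof.
apply: polyfun_ind; first exact: polyfun_0.
  by move=> *; exact: polyfun_lin.
move=> e ek De; apply: polyfun_mono; last exact: leqW.
by move=> i; exact: leqW.
Qed.

Lemma poly_homog_le k p : poly_homog k p -> poly_le k p.
Proof.
apply: polyfun_ind; first exact: polyfun_0.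
  by move=> *; exact: polyfun_lin.
by move=> e ek /eqP De; apply: polyfun_mono; rewrite // De.
Qed.

Lemma nedelec_lin k c (u v : vfield R) : nedelec k u -> nedelec k v ->
  nedelec k (c *: u + v).
Proof.
move=> [p [s [pk sk s0 ->]]] [p' [s' [pk' sk' s0' ->]]].
exists (c *: p + p'), (c *: s + s'); split.
- move=> i; have := polyfun_lin c (pk i) (pk' i).
  by congr polyfun; apply/funext => x; rewrite !mxE.
- move=> i; have := polyfun_lin c (sk i) (sk' i).
  by congr polyfun; apply/funext => x; rewrite !mxE.
- move=> x; have := dot_linl c (s x) (s' x) (vec x).
  by rewrite s0 s0' mulr0 addr0.
- by rewrite scalerDr addrACA.
Qed.

Lemma nedelec_poly_le k (q : vfield R) i : nedelec k q ->
  poly_le k.+1 (fun x => q x i 0).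
Proof.
move=> [p [s [pk sk _ ->]]].
have := polyfun_lin 1 (poly_leS (pk i)) (poly_homog_le (sk i)).
by congr polyfun; apply/funext => x; rewrite !mxE mul1r.
Qed.

Lemma vsmooth_nedelec k (q : vfield R) : nedelec k q -> vsmooth q.
Proof. by move=> nq i; apply: smooth_polyfun; exact: (nedelec_poly_le i nq). Qed.

Lemma partial_nedelec k (q : vfield R) i j : nedelec k q ->
  poly_le k (partial i (fun x => q x j 0)).
Proof.
move=> [p [s [pk sk _ ->]]].
have := polyfun_lin 1 (partial_poly_le i (pk j)) (partial_poly_homog i (sk j)).
congr polyfun; apply/funext => x.
rewrite -(partial_lin 1 (@smooth_derivable _ _ x i (smooth_polyfun (pk j)))
  (@smooth_derivable _ _ x i (smooth_polyfun (sk j)))).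
by congr (partial i _ x); apply/funext => y; rewrite !mxE mul1r.
Qed.

(** Differentiation lowers the homogeneous part of degree [k.+1] to degree [k], so the curl already
    lies in the full polynomial part and the summand along [x] is taken to be zero. *)
Lemma raviart_thomas_curl k (q : vfield R) : nedelec k q -> raviart_thomas k (curl q).
Proof.
move=> nq; exists (curl q), (fun=> 0); split.
- move=> i; have := polyfun_lin (-1) (partial_nedelec (i + 2) (i + 1) nq)
    (partial_nedelec (i + 1) (i + 2) nq).
  by congr polyfun; apply/funext => x; rewrite curl_compE mulN1r addrC.
- exact: polyfun_0.
- by apply/funext => x; rewrite scale0r addr0.
Qed.

Lemma raviart_thomas_lin k c (u v : vfield R) : raviart_thomas k u ->
  raviart_thomas k v -> raviart_thomas k (c *: u + v).
Proof.
move=> [p [s [pk sk ->]]] [p' [s' [pk' sk' ->]]].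
exists (c *: p + p'), (fun x => c * s x + s' x); split.
- move=> i; have := polyfun_lin c (pk i) (pk' i).
  by congr polyfun; apply/funext => x; rewrite !mxE.
- exact: polyfun_lin.
- apply/funext => x; apply/matrixP => i j; rewrite !mxE; ring.
Qed.

(** Absorbing the degree condition into the coefficients leaves one free coefficient per
    multi-index, hence a coordinate space of fixed size. *)
Lemma poly_le_coef k p : poly_le k p ->
  exists c : {ffun 'I_3 -> 'I_k.+1} -> R, forall x, p x = \sum_a c a * mono (fun i => a i) x.
Proof.
move=> [c Ec]; exists (fun a : {ffun 'I_3 -> 'I_k.+1} => if (\sum_i a i <= k)%N then c a else 0) => x.
rewrite Ec big_mkcond; apply: eq_bigr => a _.
by case: ifP => // _; rewrite mul0r.
Qed.

End Polynomials.

(** * Meshes and discrete spaces *)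

Section TetrahedronBoundary.
Variable R : realType.
Implicit Types (x : space3 R) (A K : set (space3 R)).
Local Notation mu := (leb3 R).
Local Notation leb := (@lebesgue_measure R).

Lemma measurable_line A x (i : 'I_3) : measurable A ->
  measurable [set t : measurableTypeR R | A (setc x i t)].
Proof.
move=> mA; have mid : measurable_fun [set: measurableTypeR R] (fun t => t : measurableTypeR R).
  exact: measurable_id.
have mset : measurable_fun [set: measurableTypeR R] (fun t => setc x i t : space3 R).
  rewrite /setc; case: i => -[|[|[|//]]] ? /=; do ! apply: measurable_fun_pair;
    by [exact: measurable_cst|exact: mid].
by have := mset measurableT _ mA; rewrite setTI.
Qed.

(** Tonelli for the indicator of [A], with the coordinate [i] integrated innermost. *)
Lemma null_of_null_lines A (i : 'I_3) : measurable A ->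
  (forall x, leb [set t | A (setc x i t)] = 0%E) -> mu A = 0%E.
Proof.
move=> mA L.
pose f : space3 R -> \bar R := fun x => (\1_A x)%:E.
have mf : measurable_fun [set: space3 R] f.
  by apply/measurable_EFinP; exact: measurable_indic.
have f0 x : (0 <= f x)%E by rewrite lee_fin.
have I0 x : (\int[leb]_t f (setc x i t) = 0)%E.
  have ml := measurable_line x i mA.
  by rewrite -[RHS](L x) -[X in leb X](setIT [set t | _]) -integral_indic.
have -> : mu A = (\int[mu]_x f x)%E by rewrite integral_indic// setIT.
case: i I0 L => -[|[|[|//]]] lti I0 L.
- rewrite (@fubini_tonelli2 _ _ _ _ _ (@leb2 R) leb f mf f0) /fubini_G.
  rewrite integral0_eq// => z _.
  have mz : measurable_fun setT (fun y => f (y, z)).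
    by apply: measurableT_comp => //; exact: pair2_measurable.
  rewrite (@fubini_tonelli2 _ _ _ _ _ leb leb _ mz) ?/fubini_G//.
  rewrite integral0_eq// => y _.
  by have := I0 ((0, y), z).
- rewrite (@fubini_tonelli2 _ _ _ _ _ (@leb2 R) leb f mf f0) /fubini_G.
  rewrite integral0_eq// => z _.
  have mz : measurable_fun setT (fun y => f (y, z)).
    by apply: measurableT_comp => //; exact: pair2_measurable.
  rewrite (@fubini_tonelli1 _ _ _ _ _ leb leb _ mz) ?/fubini_F//.
  rewrite integral0_eq// => y _.
  by have := I0 ((y, 0), z).
- rewrite (@fubini_tonelli1 _ _ _ _ _ (@leb2 R) leb f mf f0) /fubini_F.
  rewrite integral0_eq// => -[y1 y2] _.
  by have := I0 ((y1, y2), 0).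
Qed.

(** An affine function in homogeneous coordinates: the row [r] acts on [x] extended by a fourth
    coordinate 1. Barycentric coordinates then become rows of an inverse matrix. *)
Definition aff (r : 'rV[R]_(3 + 1)) x : R := (r *m col_mx (vec x) 1%:M) 0 0.

Lemma affE r x : aff r x = \sum_i r 0 (lshift 1 i) * getc x i + r 0 (rshift 3 0).
Proof.
rewrite /aff mxE big_split_ord/=; congr (_ + _).
  by apply: eq_bigr => i _; rewrite col_mxEu.
by rewrite big_ord1 col_mxEd !mxE eqxx mulr1.
Qed.

Lemma continuous_aff r : continuous (aff r).
Proof.
have -> : aff r = fun x => \sum_i r 0 (lshift 1 i) * getc x i + r 0 (rshift 3 0).
  by apply/funext => x; exact: affE.
move=> x; apply: cvgD; last exact: cvg_cst.
rewrite !big_ord_recl big_ord0.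
under eq_fun do rewrite !big_ord_recl big_ord0.
by do ! (apply: cvgD || (apply: cvgM; [exact: cvg_cst|exact: continuous_getc])
  || exact: cvg_cst).
Qed.

(** If a linear coefficient is nonzero, every line in that direction meets the zero set in at most
    one point; otherwise the function is a nonzero constant. *)
Lemma ae_aff_neq0 r : r != 0 -> {ae mu, forall x, aff r x != 0}.
Proof.
move=> r0.
have mA : measurable [set x | aff r x = 0].
  have := continuous_measurable3 (@continuous_aff r) measurableT (measurable_set1 (0 : R)).
  by rewrite setTI.
exists [set x | aff r x = 0]; split => //; last first.
  by move=> x /= /negP; rewrite negbK => /eqP.
have [[i ri]|nr] := pselect (exists i : 'I_3, r 0 (lshift 1 i) != 0).
  apply: (null_of_null_lines (i := i)) => // x.
  have [t0 Ht0] : exists t0, [set t | aff r (setc x i t) = 0] `<=` [set t0].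
    pose c := \sum_(j | j != i) r 0 (lshift 1 j) * getc x j + r 0 (rshift 3 0).
    exists (- c / r 0 (lshift 1 i)) => t /=.
    rewrite affE (bigD1 i)//= getc_setc eqxx.
    rewrite (eq_bigr (fun j => r 0 (lshift 1 j) * getc x j)); last first.
      by move=> j /negPf ji; rewrite getc_setc ji.
    rewrite -addrA -/c => /eqP; rewrite addr_eq0 => /eqP h.
    by rewrite -h mulrAC divff// mul1r.
  apply/eqP; rewrite eq_le measure_ge0 andbT -(lebesgue_measure_set1 t0).
  by apply: le_measure; rewrite ?inE//; exact: (measurable_line x i mA).
rewrite (_ : [set x | _] = set0) ?measure0//; apply/seteqP; split => // x /=.
have rz i : r 0 (lshift 1 i) = 0 by apply: contrapT => h; apply: nr; exists i; apply/eqP.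
rewrite affE big1 => [|i _]; last by rewrite rz mul0r.
rewrite add0r => r3; move/eqP: r0; apply.
apply/rowP => j; rewrite mxE -(splitK j); case: fintype.splitP => j' _ /=.
  exact: rz.
by rewrite ord1.
Qed.

(** The columns of [N] are the vertices in homogeneous coordinates. Either the tetrahedron is flat,
    or its boundary lies in the zero sets of its four barycentric coordinates; both are null. *)
Lemma ae_tetrahedron_interior (v : 'I_4 -> space3 R) :
  {ae mu, forall x, tetrahedron v x -> interior (tetrahedron v) x}.
Proof.
pose N : 'M[R]_(3 + 1) := \matrix_(i, j) (col_mx (vec (v j)) 1%:M) i 0.
have NE1 j m : N (lshift 1 j) m = vec (v m) j 0 by rewrite mxE col_mxEu.
have NE2 m : N (rshift 3 0) m = 1 by rewrite mxE col_mxEd mxE eqxx.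
have colN (l : 'I_4 -> R) x : \sum_i l i = 1 -> vec x = \sum_i l i *: vec (v i) ->
    col_mx (vec x) 1%:M = N *m (\col_i l i).
  move=> l1 xl; apply/colP => i; rewrite [RHS]mxE.
  rewrite -(splitK i); case: fintype.splitP => j _ /=.
    rewrite col_mxEu xl summxE; apply: eq_bigr => m _.
    by rewrite NE1 [LHS]mxE mulrC; congr (_ * _); rewrite [RHS]mxE.
  rewrite col_mxEd ord1 mxE eqxx -l1; apply: eq_bigr => m _.
  by rewrite NE2 mxE mul1r.
(* In the singular case a nonzero row killing [N] is an affine function that vanishes at all
   vertices, hence on the whole tetrahedron. *)
have [Nu|Nu] := boolP (N \in unitmx); last first.
  have [r r0 rN] : exists2 r : 'rV_(3 + 1), r != 0 & r *m N = 0.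
    by move: Nu; rewrite unitmxE unitfE negbK => /det0P[r r0 rN]; exists r.
  apply: filterS (ae_aff_neq0 r0) => x /eqP rx [l [_ l1 xl]]; exfalso; apply: rx.
  by rewrite /aff (colN l)// mulmxA rN mul0mx mxE.
(* [aff (r i)] is the barycentric coordinate of vertex [i]. Off its zero sets a point of the
   tetrahedron has only positive coordinates, and their positivity is an open condition that implies
   membership. *)
pose r i := row i (invmx N).
have r0 i : r i != 0.
  apply/eqP => ri; have : row i (invmx N) *m N = 0 by rewrite -/(r i) ri mul0mx.
  rewrite -row_mul mulVmx// => /rowP/(_ i)/eqP.
  by rewrite !mxE eqxx oner_eq0.
have affl (l : 'I_4 -> R) x i : \sum_i l i = 1 -> vec x = \sum_i l i *: vec (v i) ->
    aff (r i) x = l i.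
  by move=> l1 xl; rewrite /aff (colN l)// -row_mul mulmxA mulVmx// mul1mx !mxE.
have inT x : (forall i, 0 < aff (r i) x) -> tetrahedron v x.
  move=> pos; exists (fun i => aff (r i) x).
  have E : N *m (\col_i aff (r i) x) = col_mx (vec x) 1%:M.
    rewrite (_ : \col_i _ = invmx N *m col_mx (vec x) 1%:M).
      by rewrite mulmxA mulmxV// mul1mx.
    by apply/colP => i; rewrite mxE /aff -row_mul mxE.
  split=> [i||]; first exact: ltW.
    have := congr1 (fun M : 'cV_(3 + 1) => M (rshift 3 0) 0) E.
    rewrite col_mxEd [X in _ = X]mxE eqxx mulr1n => <-; rewrite mxE; apply: eq_bigr => m _.
    by rewrite NE2 mxE mul1r.
  apply/colP => j.
  have := congr1 (fun M : 'cV_(3 + 1) => M (lshift 1 j) 0) E.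
  rewrite col_mxEu => <-; rewrite mxE summxE; apply: eq_bigr => m _.
  by rewrite NE1 [RHS]mxE mulrC; congr (_ * _); rewrite [LHS]mxE.
have oP : open [set x | forall i, 0 < aff (r i) x].
  rewrite openE => x h; rewrite /interior /=.
  have hn i : \forall y \near x, 0 < aff (r i) y.
    exact: (cvgr_gt _ (@continuous_aff (r i) x) _ (h i)).
  have fx : Filter (nbhs x) by exact: nbhs_filter.
  exact: (@filter_forall _ 'I_4 (fun i y => 0 < aff (r i) y) (nbhs x) fx hn).
have H : {ae mu, forall x, forall i, aff (r i) x != 0}.
  by apply: filter_forall => i; exact: ae_aff_neq0.
apply: filterS H => x nx [l [l0 l1 xl]].
suff : [set x | forall i, 0 < aff (r i) x] x.
  have sub : [set x | forall i, 0 < aff (r i) x] `<=` tetrahedron v by exact: inT.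
  by move=> xP; apply: filterS sub _; exact: open_nbhs_nbhs.
by move=> i /=; rewrite lt_def nx/= (affl l).
Qed.

End TetrahedronBoundary.

Section Spaces.
Variable R : realType.
Implicit Types (O : set (space3 R)) (T : set (set (space3 R))) (u v w : vfield R).
Local Notation mu := (leb3 R).

Lemma nedelec_space_lin O T k c u v : open O -> bounded_set O ->
  nedelec_space O T k u -> nedelec_space O T k v -> nedelec_space O T k (c *: u + v).
Proof.
move=> oO bO [Hu Pu] [Hv Pv]; split; first exact: Hcurl_lin.
move=> K TK; have [p np up] := Pu _ TK; have [q nq vq] := Pv _ TK.
exists (c *: p + q); first exact: nedelec_lin.
apply: filterS2 up vq => x up vq Kx.
by rewrite (_ : (c *: u + v) x = c *: u x + v x)// up// vq.
Qed.

Lemma nedelec_space0_lin O T k c u v : open O -> bounded_set O ->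
  nedelec_space0 O T k u -> nedelec_space0 O T k v ->
  nedelec_space0 O T k (c *: u + v).
Proof.
move=> oO bO [Hu Pu] [Hv Pv].
by split; [exact: nedelec_space_lin|exact: H0curl_lin].
Qed.

Lemma Hdiv_lin O c u v : open O -> bounded_set O ->
  Hdiv O u -> Hdiv O v -> Hdiv O (c *: u + v).
Proof.
move=> oO bO [uL [g gL wg]] [vL [g' gL' wg']]; have mO := open_measurable3 oO.
split; first exact: vectorL2_lin.
exists (fun x => c * g x + g' x); first exact: scalarL2_lin.
move=> f sf cf; have gfL : vectorL2 O (grad f).
  by apply: vectorL2_vsmooth => //; exact: vsmooth_grad.
have fL : scalarL2 O f by apply: scalarL2_continuous => //; exact: smooth_continuous.
rewrite (ip_linl c mO uL vL gfL) wg// wg'//.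
have i1 := scalarL2_mul_integrable mO gL fL.
have i2 := scalarL2_mul_integrable mO gL' fL.
under [in RHS]eq_Rintegral do rewrite mulrDl -mulrA.
rewrite [in RHS]RintegralD//; last exact: (integrableZl mO c i1).
by rewrite RintegralZl// opprD mulrN.
Qed.

Lemma raviart_thomas_space_lin O T k c u v : open O -> bounded_set O ->
  raviart_thomas_space O T k u -> raviart_thomas_space O T k v ->
  raviart_thomas_space O T k (c *: u + v).
Proof.
move=> oO bO [Hu Pu] [Hv Pv]; split; first exact: Hdiv_lin.
move=> K TK; have [p np up] := Pu _ TK; have [q nq vq] := Pv _ TK.
exists (c *: p + q); first exact: raviart_thomas_lin.
apply: filterS2 up vq => x up vq Kx.
by rewrite (_ : (c *: u + v) x = c *: u x + v x)// up// vq.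
Qed.

Lemma wcurl_nedelec_space O T k v : open O -> bounded_set O -> is_mesh O T ->
  nedelec_space O T k v -> raviart_thomas_space O T k (wcurl O v).
Proof.
move=> oO bO [_ meshT _ _] [Hv Pv]; split; first exact: Hdiv_wcurl.
move=> K TK; have [q nq vq] := Pv _ TK.
have [[vs KE] _ KO] := meshT _ TK.
exists (curl q); first exact: raviart_thomas_curl.
have vq' : {ae mu, forall x, interior K x -> v x = q x}.
  by apply: filterS vq => x vq /interior_subset; exact: vq.
have := wcurl_local oO bO (open_interior K) KO Hv (vsmooth_nedelec nq) vq'.
have := ae_tetrahedron_interior vs; rewrite -KE.
by apply: filterS2 => x Ki wq Kx; exact/wq/Ki.
Qed.

(** A field whose coefficients all vanish is zero almost everywhere on each cell, hence on [O],
    which the cells cover. The subset [S] is arbitrary so that the generators can respect the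
    boundary condition. *)
Lemma nedelec_space_spanning O T k (S : set (vfield R)) : open O -> bounded_set O ->
  is_mesh O T -> S `<=` nedelec_space O T k ->
  exists n (b : 'I_n -> vfield R), (forall i, S (b i)) /\
    forall v, S v -> exists c : 'I_n -> R, ae_eq_on O v (\sum_i c i *: b i).
Proof.
move=> oO bO [finT _ coverT _] SV.
have /finite_seqP[s Ts] := finT.
(* One slot per cell, component and multi-index; exponents go up to [k.+1], the degree of the
   homogeneous part of a local Nédélec field. *)
pose J : finType := ('I_(size s) * ('I_3 * {ffun 'I_3 -> 'I_k.+2}))%type.
pose K (j : 'I_(size s)) := nth set0 s j.
pose pol (c : 'rV[R]_#|J|) j i x : R :=
  \sum_(a : {ffun 'I_3 -> 'I_k.+2}) c 0 (enum_rank ((j, (i, a)) : J)) * mono (fun l => a l) x.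
pose rho v c := forall j, {ae mu, forall x, K j x -> forall i, v x i 0 = pol c j i x}.
have [||n [b [Sb bS]]] := @spanning_family R #|J| (vfield R) S rho.
- move=> a u v c c' uc vc' j; apply: filterS2 (uc j) (vc' j) => x up vp Kx i.
  rewrite !mxE up// vp// /pol mulr_sumr -big_split; apply: eq_bigr => l _.
  by rewrite /= !mxE mulrDl mulrA.
- move=> v /SV[Hv Pv].
  have coefs (j : 'I_(size s)) : exists cj : 'I_3 -> {ffun 'I_3 -> 'I_k.+2} -> R,
      {ae mu, forall x, K j x -> forall i, v x i 0 = \sum_a cj i a * mono (fun l => a l) x}.
    have TK : T (K j) by rewrite Ts /=; apply: mem_nth.
    have [q nq vq] := Pv _ TK.
    have /choice[cj Hcj] : forall i, exists c : {ffun 'I_3 -> 'I_k.+2} -> R,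
        forall x, q x i 0 = \sum_a c a * mono (fun l => a l) x.
      by move=> i; exact: poly_le_coef (nedelec_poly_le i nq).
    by exists cj; apply: filterS vq => x vq Kx i; rewrite vq.
  have /choice[cc Hcc] := coefs.
  exists (\row_m (let p := enum_val m in cc p.1 p.2.1 p.2.2)) => j.
  apply: filterS (Hcc j) => x h Kx i; rewrite h// /pol.
  by apply: eq_bigr => a _; rewrite mxE enum_rankK.
exists n, b; split => // v /bS[c vc]; exists c.
have : {ae mu, forall x, forall j, K j x -> forall i, (v - \sum_i c i *: b i) x i 0 = 0}.
  apply: filter_forall => j; apply: filterS (vc j) => x h Kx i.
  by rewrite h// /pol big1// => a _; rewrite mxE mul0r.
apply: filterS => x h Ox.
have : closure O x by exact: subset_closure.
rewrite coverT Ts => -[K' /= sK' K'x].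
have ltK : (index K' s < size s)%N by rewrite index_mem.
have Kx : K (Ordinal ltK) x by rewrite /K /= nth_index.
apply/eqP; rewrite -subr_eq0; apply/eqP/matrixP => i j.
by rewrite ord1 [RHS]mxE -(h _ Kx i).
Qed.

End Spaces.

(** * Averages of a vanishing source *)

Section Bochner.
Variable R : realType.
Implicit Types (O : set (space3 R)) (u v w g : vfield R).
Local Notation mu := (leb3 R).
Local Notation leb := (@lebesgue_measure R).

(** [h] may change sign, so it is replaced by its positive part, still below the nonnegative [k]. *)
Lemma integral_le_nonmeas d (X : measurableType d) (m : {measure set X -> \bar R})
    (D : set X) (h k : X -> \bar R) :
  (forall t, D t -> (0 <= k t)%E) -> (forall t, D t -> (h t <= k t)%E) ->
  (\int[m]_(t in D) h t <= \int[m]_(t in D) k t)%E.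
Proof.
move=> k0 hk; rewrite integralE.
apply: (@le_trans _ _ (\int[m]_(t in D) h^\+ t)%E).
  by apply: geeDl; rewrite oppe_le0; exact: integral_ge0.
apply: ae_ge0_le_integral_nonmeas => //.
apply: aeW => t Dt; rewrite funeposE ge_max; apply/andP; split; [exact: hk|exact: k0].
Qed.

(* Duality: testing the integral of a simple function against itself. *)
Lemma L2norm_simple_integral O (a b : R) (s : seq (set (measurableTypeR R) * vfield R)) :
  measurable O -> is_simple O a b s ->
  ((L2norm O (simple_integral s))%:E <=
   \int[leb]_(t in `]a, b[) (L2norm O (simple_eval s t))%:E)%E.
Proof.
move=> mO simp.
pose A (i : 'I_(size s)) := (nth (set0, fun=> 0) s i).1.
pose v (i : 'I_(size s)) := (nth (set0, fun=> 0) s i).2.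
have mA i : measurable (A i) by have [] := simp i (ltn_ord i).
have subA i : A i `<=` `]a, b[ by have [_] := simp i (ltn_ord i).
have vL i : vectorL2 O (v i) by have [] := simp i (ltn_ord i).
pose w := simple_integral s.
have wE : w = \sum_i fine (leb (A i)) *: v i.
  by rewrite /w /simple_integral (big_nth (set0, fun=> 0)) big_mkord.
have evE t : simple_eval s t = \sum_i (\1_(A i) t : R) *: v i.
  by rewrite /simple_eval (big_nth (set0, fun=> 0)) big_mkord.
have wL : vectorL2 O w.
  by rewrite wE; apply: vectorL2_sum => // i; exact: vectorL2_Z.
have eL t : vectorL2 O (simple_eval s t).
  by rewrite evE; apply: vectorL2_sum => // i; exact: vectorL2_Z.
have mI : measurable (`]a, b[%classic : set (measurableTypeR R)) by exact: measurable_itv.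
have [w0|w0] := eqVneq (L2norm O w) 0.
  by rewrite -/w w0; apply: integral_ge0 => t _; rewrite lee_fin L2norm_ge0.
have wpos : 0 < L2norm O w by rewrite lt_def w0 L2norm_ge0.
have fA i : (leb (A i) < +oo)%E.
  apply: (@le_lt_trans _ _ (leb `]a, b[)).
    by apply: le_measure; rewrite ?inE//; exact: subA.
  by rewrite lebesgue_measure_itv/=; case: ifP => // _; rewrite -EFinB ltry.
pose h t : R := \sum_i \1_(A i) t * (ip O (v i) w / L2norm O w).
have hE t : h t = ip O (simple_eval s t) w / L2norm O w.
  rewrite evE ip_suml//; last by move=> i; exact: vectorL2_Z.
  by rewrite mulr_suml; apply: eq_bigr => i _; rewrite ipZl// mulrA.
have int1 i : leb.-integrable `]a, b[ (EFin \o (\1_(A i) : R -> R)).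
  apply/integrableP; split.
    by apply/measurable_EFinP; exact: measurable_indic.
  rewrite (_ : (fun x => _) = EFin \o (\1_(A i) : R -> R)).
    rewrite (integral_indic leb mI (mA i)).
    apply: le_lt_trans (fA i); apply: le_measure; rewrite ?inE//.
    exact: measurableI.
  by apply/funext => x /=; rewrite ger0_norm.
have inth : \int[leb]_(t in `]a, b[) h t = L2norm O w.
  rewrite /h (Rintegral_sum _ _ mI); last first.
    move=> i; rewrite (_ : _ \o _ = fun t => ((ip O (v i) w / L2norm O w)%:E * (\1_(A i) t)%:E)%E).
      exact: (integrableZl mI _ (int1 i)).
    by apply/funext => t /=; rewrite -EFinM mulrC.
  transitivity (\sum_i fine (leb (A i)) * (ip O (v i) w / L2norm O w)).
    apply: eq_bigr => i _; rewrite (RintegralZr _ mI (int1 i)).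
    congr (_ * _); rewrite /Rintegral (integral_indic leb mI (mA i)).
    by rewrite setIidl.
  have ww : ip O w w = \sum_i fine (leb (A i)) * ip O (v i) w.
    rewrite {1}wE ip_suml//; last by move=> i; exact: vectorL2_Z.
    by apply: eq_bigr => i _; rewrite ipZl.
  rewrite (eq_bigr (fun i => fine (leb (A i)) * ip O (v i) w / L2norm O w)); last first.
    by move=> i _; rewrite mulrA.
  by rewrite -mulr_suml -ww -L2norm_sq expr2 mulfK.
have ihint : leb.-integrable `]a, b[ (EFin \o h).
  rewrite (_ : _ \o _ = fun t => (\sum_i (ip O (v i) w / L2norm O w)%:E * (\1_(A i) t)%:E)%E).
    apply: (integrable_sum mI).
    by move=> i _; exact: (integrableZl mI _ (int1 i)).
  apply/funext => t /=; rewrite /h -sumEFin; apply: eq_bigr => i _.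
  by rewrite -EFinM mulrC.
rewrite -/w -inth /Rintegral fineK; last first.
  exact: (integrable_fin_num mI ihint).
apply: integral_le_nonmeas => t _; first by rewrite lee_fin L2norm_ge0.
rewrite lee_fin hE ler_pdivrMr// (le_trans (ler_norm _))//.
exact: ip_CauchySchwarz.
Qed.

(** As [f] vanishes almost everywhere, the approximation error of [s j] is the integral of its own
    norm, which bounds its integral; so the integrals tend to 0 as well as to [g]. *)
Lemma bochner_integral_zero O (a b : R) (f : R -> vfield R) g : measurable O ->
  is_bochner_integral O a b f g ->
  {ae leb, forall t, t \in `]a, b[ -> ae_eq_on O (f t) (fun=> 0)} ->
  ae_eq_on O g 0.
Proof.
move=> mO [gL [s [simp cvf cvg]]] f0; apply: L2norm_eq0 => //.
apply/eqP; rewrite eq_le L2norm_ge0 andbT.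
pose I j := (\int[leb]_(t in `]a, b[) (L2norm O (f t - simple_eval (s j) t))%:E)%E.
have wI j : ((L2norm O (simple_integral (s j)))%:E <= I j)%E.
  apply: (le_trans (L2norm_simple_integral mO (simp j))).
  rewrite /I; have -> : (\int[leb]_(t in `]a, b[) (L2norm O (f t - simple_eval (s j) t))%:E =
    \int[leb]_(t in `]a, b[) (L2norm O (simple_eval (s j) t))%:E)%E; last by [].
  apply: ae_eq_integral_nonmeas; case: f0 => N [mN N0 subN].
  exists N; split => // t nt; apply: subN => ft; apply: nt => tab; congr EFin.
  have {}ft : ae_eq_on O (f t) (fun=> 0) by exact: ft.
  rewrite (@L2norm_ae _ O _ (- simple_eval (s j) t)).
    by rewrite /L2norm; congr (Num.sqrt _); apply: eq_Rintegral => x _;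
      rewrite /dot; apply: eq_bigr => i _; rewrite !mxE mulrNN.
  apply: filterS ft => x ft Ox.
  by rewrite (_ : (f t - simple_eval (s j) t) x = f t x - simple_eval (s j) t x)// ft// sub0r.
apply/ler_addgt0Pr => e e0; rewrite add0r.
have e2 : 0 < e / 2 by rewrite divr_gt0.
have [j [wg wj]] : exists j, L2norm O (simple_integral (s j) - g) < e / 2 /\
    L2norm O (simple_integral (s j)) < e / 2.
  have c1 : \forall j \near \oo, L2norm O (simple_integral (s j) - g) < e / 2.
    by apply: (cvgr_lt (0 : R) cvg).
  have c2 : \forall j \near \oo, (I j < (e / 2)%:E)%E.
    move/fine_cvgP : cvf => [fin cvf].
    have : \forall j \near \oo, (fine \o I) j < e / 2 by apply: (cvgr_lt (0 : R) cvf).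
    by apply: filterS2 fin => j fin; rewrite /= -lte_fin fineK.
  case: c1 => N1 _ H1; case: c2 => N2 _ H2; pose j := maxn N1 N2.
  have h1 := H1 j (leq_maxl _ _); have h2 := H2 j (leq_maxr _ _).
  by exists j; split => //; rewrite -lte_fin; apply: le_lt_trans (wI j) _.
have sL : vectorL2 O (simple_integral (s j)).
  rewrite /simple_integral (big_nth (set0, fun=> 0)) big_mkord.
  apply: vectorL2_sum => // i; apply: vectorL2_Z => //.
  by have [] := simp j i (ltn_ord i).
have -> : g = simple_integral (s j) + (-1) *: (simple_integral (s j) - g).
  by rewrite scaleN1r opprB addrC subrK.
have dL := vectorL2_B mO sL gL.
apply: (le_trans (L2norm_triangle mO sL (vectorL2_Z _ mO dL))).
by rewrite L2normZ// normrN1 mul1r; lra.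
Qed.

End Bochner.

(** * Material tensors *)

Section MatrixBounds.
Variable R : realType.
Implicit Types (A S : 'M[R]_3) (u v : 'cV[R]_3).

(** Cauchy-Schwarz on each of the three rows, whose squared norms are at most three times [C ^+ 2];
    this gives the factor 9. *)
Lemma dot_mulmx_bound A (C : R) u : (forall i j, `|A i j| <= C) ->
  dot (A *m u) (A *m u) <= (3 * C) ^+ 2 * dot u u.
Proof.
move=> AC; have C0 : 0 <= C by apply: le_trans (AC ord0 ord0).
have entry i : (A *m u) i 0 ^+ 2 <= 3 * C ^+ 2 * dot u u.
  have -> : (A *m u) i 0 = dot (row i A)^T u.
    by rewrite mxE; apply: eq_bigr => j _; rewrite !mxE.
  apply: (le_trans (dot_CauchySchwarz _ _)); rewrite ler_wpM2r ?dot_ge0//.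
  apply: (@le_trans _ _ (\sum_(j < 3) C ^+ 2)); last first.
    by rewrite sumr_const card_ord mulr_natl.
  apply: ler_sum => j _; rewrite !mxE -expr2 -(real_normK (num_real _)).
  by rewrite lerXn2r// nnegrE.
apply: (@le_trans _ _ (\sum_(i < 3) 3 * C ^+ 2 * dot u u)).
  by apply: ler_sum => i _; rewrite -expr2.
rewrite sumr_const card_ord; move: (dot u u) => d.
by rewrite le_eqVlt; apply/orP; left; apply/eqP; ring.
Qed.

Lemma dot_quad_bound A (C : R) u : (forall i j, `|A i j| <= C) ->
  dot u (A *m u) <= 3 * C * dot u u.
Proof.
move=> AC; have C0 : 0 <= C by apply: le_trans (AC ord0 ord0).
have := dot_CauchySchwarz u (A *m u).
have := ler_wpM2l (dot_ge0 u) (dot_mulmx_bound u AC).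
move=> h1 /le_trans /(_ h1).
rewrite mulrCA -expr2 -exprMn => h2.
have k0 : 0 <= 3 * C * dot u u by rewrite !mulr_ge0 ?dot_ge0.
have [n|p] := ltP (dot u (A *m u)) 0; first by rewrite (le_trans (ltW n)).
by rewrite -ler_sqr ?nnegrE.
Qed.

Lemma elliptic_unit A (c : R) : 0 < c ->
  (forall xi : 'cV[R]_3, c * enorm xi ^+ 2 <= dot xi (A *m xi)) -> A \in unitmx.
Proof.
move=> c0 ell; rewrite unitmxE unitfE; apply/negP => /det0P[r r0 rA].
have := ell r^T; rewrite dotC dot_mull -trmx_mul rA trmx0 dot0r enorm_sq.
rewrite pmulr_rle0// => rr; move/eqP: r0; apply.
have /dot_eq0 r00 : dot r^T r^T = 0 by apply/eqP; rewrite eq_le rr dot_ge0.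
by rewrite -[r]trmxK r00 trmx0.
Qed.

(** With [eta = invmx A *m u], ellipticity gives [c |eta|^2 <= eta . u], and Cauchy-Schwarz removes
    one factor [|eta|]. *)
Lemma elliptic_inv_bound A (c : R) u : 0 < c ->
  (forall xi : 'cV[R]_3, c * enorm xi ^+ 2 <= dot xi (A *m xi)) ->
  c ^+ 2 * dot (invmx A *m u) (invmx A *m u) <= dot u u.
Proof.
move=> c0 ell; have Au := elliptic_unit c0 ell.
set eta := invmx A *m u; have uE : u = A *m eta by rewrite mulKVmx.
have := ell eta; rewrite -uE enorm_sq => h1.
have h2 := dot_CauchySchwarz eta u.
have e0 := dot_ge0 eta; have u0 := dot_ge0 u.
have [->|ne] := eqVneq (dot eta eta) 0; first by rewrite mulr0.
have ep : 0 < dot eta eta by rewrite lt_def ne.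
rewrite -(ler_pM2l ep).
apply: le_trans h2.
have : (c * dot eta eta) ^+ 2 <= dot eta u ^+ 2.
  by rewrite ler_sqr ?nnegrE ?mulr_ge0 ?(ltW c0)// (le_trans _ h1)// mulr_ge0// ltW.
by rewrite exprMn expr2; apply: le_trans; rewrite mulrCA -expr2.
Qed.

(** The entry is a component of the image of a unit vector; ellipticity alone bounds the inverse
    tensor. *)
Lemma elliptic_inv_entry A (c : R) i j : 0 < c ->
  (forall xi : 'cV[R]_3, c * enorm xi ^+ 2 <= dot xi (A *m xi)) ->
  `|invmx A i j| <= c^-1.
Proof.
move=> c0 ell; have := elliptic_inv_bound (delta_mx j 0) c0 ell.
have -> : dot (delta_mx j 0) (delta_mx j 0 : 'cV[R]_3) = 1.
  rewrite /dot (bigD1 j)//= big1 ?addr0 ?mxE ?eqxx ?mulr1// => k /negPf kj.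
  by rewrite mxE kj mul0r.
have le : (invmx A i j) ^+ 2 <= dot (invmx A *m delta_mx j 0) (invmx A *m delta_mx j 0).
  rewrite -colE /dot (bigD1 i)//= mxE -expr2 lerDl.
  by apply: sumr_ge0 => k _; rewrite -expr2 sqr_ge0.
move=> h; have {h} : c ^+ 2 * invmx A i j ^+ 2 <= 1.
  by apply: le_trans h; rewrite ler_wpM2l ?sqr_ge0.
rewrite -exprMn -(real_normK (num_real _)) -[X in _ <= X -> _](expr1n _ 2).
rewrite ler_sqr ?nnegrE// normrM (gtr0_norm c0) => h.
by rewrite -ler_pdivlMl// mulr1 in h.
Qed.

Lemma invmx_sym A : A^T = A -> (invmx A)^T = invmx A.
Proof. by move=> As; rewrite trmx_inv As. Qed.

Lemma elliptic_psd A (c : R) : 0 < c ->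
  (forall xi : 'cV[R]_3, c * enorm xi ^+ 2 <= dot xi (A *m xi)) -> psdmx A.
Proof.
by move=> c0 ell xi; apply: le_trans (ell xi); rewrite mulr_ge0 ?sqr_ge0// ltW.
Qed.

Lemma dot_sqrtmx A u : A^T = A -> psdmx A ->
  dot (sqrtmx A *m u) (sqrtmx A *m u) = dot (A *m u) u.
Proof.
move=> As Ap; have [Ss _ SS] := sqrtmx_spec As Ap.
by rewrite dot_mull Ss mulmxA SS [RHS]dotC.
Qed.

Lemma sqrtmx_unit A : A^T = A -> psdmx A -> A \in unitmx -> sqrtmx A \in unitmx.
Proof.
move=> As Ap; have [_ _ SS] := sqrtmx_spec As Ap.
by rewrite -{1}SS unitmx_mul => /andP[].
Qed.

Lemma dot_inv_sqrtmx A u : A^T = A -> psdmx A -> A \in unitmx ->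
  dot (invmx (sqrtmx A) *m u) (invmx (sqrtmx A) *m u) = dot (invmx A *m u) u.
Proof.
move=> As Ap Au; have Su := sqrtmx_unit As Ap Au.
have [Ss _ SS] := sqrtmx_spec As Ap.
have -> : invmx A = invmx (sqrtmx A) *m invmx (sqrtmx A).
  apply: (can_inj (mulKmx Au)); rewrite mulmxV// -{1}SS -!mulmxA mulKVmx//.
  by rewrite mulmxV.
by rewrite dot_mull invmx_sym// [RHS]dotC mulmxA.
Qed.

End MatrixBounds.

Section Tensors.
Variable R : realType.
Implicit Types (O : set (space3 R)) (M : space3 R -> 'M[R]_3) (u v w : vfield R).
Local Notation mu := (leb3 R).

(** An entrywise form of [tensorLinf], easily checked for inverse tensors as well. *)
Definition bounded_tensor O M :=
  (forall i j, measurable_fun O (fun x => M x i j)) /\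
  exists C : R, {ae mu, forall x, O x -> forall i j, `|M x i j| <= C}.

Lemma entry_le_norm (A : 'M[R]_3) i j : `|A i j| <= `|A|.
Proof.
rewrite [leRHS]mx_normrE.
exact: (le_bigmax _ (fun ij : 'I_3 * 'I_3 => `|A ij.1 ij.2|) (i, j)).
Qed.

Lemma bounded_tensor_Linf O M : tensorLinf O M -> bounded_tensor O M.
Proof.
move=> [mM bM]; split => //.
have ge := ess_sup_ge mu ((fun x => (`|M x|)%:E) \_ O).
move: bM ge; rewrite /tensor_esssup; case: (ess_sup _ _) => [s _|//|_] ge.
- exists s; apply: filterS ge => x ge Ox i j.
  move: ge; rewrite patchE mem_set// lee_fin; apply: le_trans.
  exact: entry_le_norm.
(* An essential supremum equal to minus infinity would bound a nonnegative norm, so almost no point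
   of [O] is left and any constant serves. *)
- exists 0; apply: filterS ge => x ge Ox i j.
  by move: ge; rewrite patchE mem_set// leeNy_eq.
Qed.

Lemma tapp_L2 O M u : measurable O -> bounded_tensor O M -> vectorL2 O u ->
  vectorL2 O (tapp M u).
Proof.
move=> mO [mM [C MC]] uL i.
have H (s : seq 'I_3) : scalarL2 O (fun x => \sum_(j <- s) M x i j * u x j 0).
  elim: s => [|j s ih].
    under [X in scalarL2 _ X]eq_fun do rewrite big_nil.
    exact: scalarL2_0.
  have jL : scalarL2 O (fun x => M x i j * u x j 0).
    apply: (scalarL2_bounded_mul (C := C)) => //.
    by apply: filterS MC => x MC Ox; exact: MC.
  have := scalarL2_lin 1 mO jL ih.
  by congr scalarL2; apply/funext => x; rewrite big_cons mul1r.
by have := H (index_enum _); congr scalarL2; apply/funext => x; rewrite mxE.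
Qed.

Lemma tapp_lin M c u v : tapp M (c *: u + v) = c *: tapp M u + tapp M v.
Proof.
apply/funext => x; rewrite /tapp -[RHS]/(c *: (M x *m u x) + M x *m v x).
by rewrite (_ : (c *: u + v) x = c *: u x + v x)// mulmxDr -scalemxAr.
Qed.

Lemma tapp_ae O M u v : ae_eq_on O u v -> ae_eq_on O (tapp M u) (tapp M v).
Proof. by apply: filterS => x uv Ox; rewrite /tapp uv. Qed.

(** The inverse of [f] is [f] times a real power of its square, also at zeros of [f], where the
    inverse is 0 by convention. *)
Lemma measurable_inv_fun (f : space3 R -> R) O : measurable_fun O f ->
  measurable_fun O (fun x => (f x)^-1).
Proof.
move=> mf.
rewrite (_ : (fun x => _) = (fun x => f x * powR (f x ^+ 2) (-1))).
  apply: measurable_funM => //.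
  exact: (measurableT_comp (measurable_powR (-1)) (measurable_funX 2 mf)).
apply/funext => x; rewrite powR_inv1 ?sqr_ge0// expr2 invfM.
by have [->|f0] := eqVneq (f x) 0; [rewrite invr0 !mul0r|rewrite mulrA divff// mul1r].
Qed.

Lemma measurable_det n O (F : space3 R -> 'M[R]_n) :
  (forall i j, measurable_fun O (fun x => F x i j)) ->
  measurable_fun O (fun x => \det (F x)).
Proof.
move=> mF; apply: measurable_sum => s; apply: measurable_funM.
  exact: measurable_cst.
by apply: measurable_prod => i _.
Qed.

Lemma bounded_tensor_inv O M (c : R) : measurable O -> bounded_tensor O M -> 0 < c ->
  tensor_elliptic O c M -> bounded_tensor O (tinv M).
Proof.
move=> mO [mM _] c0 ell; split; last first.
  exists c^-1; apply: filterS ell => x ell Ox i j.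
  by apply: elliptic_inv_entry => //; exact: ell.
move=> i j.
(* Cofactor formula; on a singular matrix [invmx] returns its argument. *)
rewrite (_ : (fun x => _) = (fun x => if \det (M x) == 0 then M x i j
   else (\det (M x))^-1 * ((-1) ^+ (j + i) * \det (row' j (col' i (M x)))))).
  have md := measurable_det mM.
  apply: (measurable_fun_if mO).
  - by apply: measurable_fun_eqr => //; exact: measurable_cst.
  - exact: measurable_funS (mM i j).
  - apply: (measurable_funS mO) => //; apply: measurable_funM.
      exact: measurable_inv_fun.
    apply: measurable_funM; first exact: measurable_cst.
    apply: measurable_det => i' j'.
    rewrite (_ : (fun x => _) = (fun x => M x (lift j i') (lift i j')))//.
    by apply/funext => x; rewrite !mxE.
apply/funext => x; rewrite /tinv /invmx unitmxE unitfE.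
by case: eqP => //= _; rewrite !mxE.
Qed.

Lemma tensor_sym_inv O M : tensor_sym O M -> tensor_sym O (tinv M).
Proof. by apply: filterS => x As Ox; apply: invmx_sym; exact: As. Qed.

Lemma tensor_psd_inv O M (c : R) : 0 < c -> tensor_elliptic O c M ->
  tensor_psd O (tinv M).
Proof.
move=> c0; apply: filterS => x ell Ox xi.
have Au := elliptic_unit c0 (ell Ox).
have := elliptic_psd c0 (ell Ox) (tinv M x *m xi).
by rewrite /tinv mulKVmx// dotC.
Qed.

Lemma tensor_elliptic_psd O M (c : R) : 0 < c -> tensor_elliptic O c M -> tensor_psd O M.
Proof. by move=> c0; apply: filterS => x ell Ox; exact: (elliptic_psd c0 (ell Ox)). Qed.

Lemma ip_tapp_sym O M u v : tensor_sym O M -> ip O (tapp M u) v = ip O u (tapp M v).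
Proof.
move=> Ms; apply: ae_eq_Rintegral; apply: filterS Ms => x Ms Ox.
by rewrite /tapp dot_mull Ms.
Qed.

Lemma ip_tapp_ge0 O M u : tensor_psd O M -> 0 <= ip O (tapp M u) u.
Proof.
move=> Mp; rewrite /ip.
(* The integrand is nonnegative only off a null set; the absolute value makes it so everywhere. *)
rewrite (@ae_eq_Rintegral _ _ _ _ _ _ (fun x => `|dot (tapp M u x) (u x)|)).
  exact: Rintegral_ge0.
by apply: filterS Mp => x Mp Ox; rewrite ger0_norm// dotC; exact: Mp.
Qed.

Lemma Rintegral_ae_le O (f g : space3 R -> R) : measurable O ->
  mu.-integrable O (EFin \o f) -> mu.-integrable O (EFin \o g) ->
  {ae mu, forall x, O x -> f x <= g x} ->
  \int[mu]_(x in O) f x <= \int[mu]_(x in O) g x.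
Proof.
move=> mO fi gi fg; rewrite -subr_ge0 -RintegralB//.
rewrite (@ae_eq_Rintegral _ _ _ _ _ _ (fun x => `|g x - f x|)).
  exact: Rintegral_ge0.
by apply: filterS fg => x fg Ox; rewrite ger0_norm// subr_ge0; exact: fg.
Qed.

Lemma ip_tapp_elliptic O M (c : R) u : measurable O -> bounded_tensor O M ->
  vectorL2 O u -> tensor_elliptic O c M -> c * ip O u u <= ip O (tapp M u) u.
Proof.
move=> mO Mb uL ell; have iu := dot_integrable mO uL uL.
rewrite /ip -RintegralZl//; apply: Rintegral_ae_le => //.
- exact: (integrableZl mO c iu).
- by apply: dot_integrable => //; exact: tapp_L2.
- by apply: filterS ell => x ell Ox; rewrite -enorm_sq [leRHS]dotC; exact: ell.
Qed.

Lemma ip_tapp_upper O M : measurable O -> bounded_tensor O M ->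
  exists2 C : R, 0 < C & forall u, vectorL2 O u -> ip O (tapp M u) u <= C * ip O u u.
Proof.
move=> mO /[dup] Mb [_ [C MC]]; exists (3 * (`|C| + 1)) => [|u uL].
  by rewrite mulr_gt0// ltr_wpDl.
have iu := dot_integrable mO uL uL.
rewrite /ip -RintegralZl//; apply: Rintegral_ae_le => //.
- by apply: dot_integrable => //; exact: tapp_L2.
- exact: (integrableZl mO _ iu).
- apply: filterS MC => x MC Ox; rewrite [leLHS]dotC; apply: dot_quad_bound => i j.
  by rewrite (le_trans (MC Ox i j))// (le_trans (ler_norm _))// lerDl.
Qed.

(** With [eta = invmx M u] pointwise, the form equals [eta . M eta], at least [c |eta|^2], while
    [|u|^2 <= D |eta|^2] by boundedness of [M]. *)
Lemma ip_tapp_inv_lower O M (c : R) : measurable O -> bounded_tensor O M -> 0 < c ->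
  tensor_elliptic O c M ->
  exists2 C : R, 0 < C & forall u, vectorL2 O u -> C * ip O u u <= ip O (tapp (tinv M) u) u.
Proof.
move=> mO /[dup] Mb [_ [C MC]] c0 ell.
pose D : R := (3 * (`|C| + 1)) ^+ 2.
have D0 : 0 < D by rewrite exprn_gt0// mulr_gt0// ltr_wpDl.
exists (c / D) => [|u uL]; first exact: divr_gt0.
have iu := dot_integrable mO uL uL.
rewrite /ip -RintegralZl//; apply: Rintegral_ae_le => //.
- exact: (integrableZl mO _ iu).
- by apply: dot_integrable => //; apply: tapp_L2 => //; exact: (bounded_tensor_inv mO Mb c0).
- apply: filterS2 MC ell => x MC ell Ox; rewrite /tapp /tinv.
  have Au := elliptic_unit c0 (ell Ox).
  set eta := invmx (M x) *m u x.
  have uE : u x = M x *m eta by rewrite mulKVmx.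
  rewrite {3}uE -mulrA mulrC -mulrA ler_pdivrMl//.
  have := ell Ox eta; rewrite enorm_sq => h.
  have MC' i j : `|M x i j| <= `|C| + 1.
    by rewrite (le_trans (MC Ox i j))// (le_trans (ler_norm _))// lerDl.
  have := dot_mulmx_bound eta MC'; rewrite -uE -/D => h2.
  apply: (@le_trans _ _ (c * (D * dot eta eta))).
    by rewrite mulrC ler_pM2l.
  by rewrite mulrCA ler_pM2l// uE.
Qed.

Lemma L2norm_tsqrt O M u : tensor_sym O M -> tensor_psd O M ->
  L2norm O (tapp (tsqrt M) u) ^+ 2 = ip O (tapp M u) u.
Proof.
move=> Ms Mp; rewrite L2norm_sq; apply: ae_eq_Rintegral.
by apply: filterS2 Ms Mp => x Ms Mp Ox; rewrite /tapp /tsqrt dot_sqrtmx ?Ms//; exact: Mp.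
Qed.

Lemma L2norm_tinv_tsqrt O M (c : R) u : 0 < c -> tensor_sym O M -> tensor_elliptic O c M ->
  L2norm O (tapp (tinv (tsqrt M)) u) ^+ 2 = ip O (tapp (tinv M) u) u.
Proof.
move=> c0 Ms ell; rewrite L2norm_sq; apply: ae_eq_Rintegral.
apply: filterS2 Ms ell => x Ms ell Ox; rewrite /tapp /tsqrt /tinv dot_inv_sqrtmx ?Ms//.
  exact: (elliptic_psd c0 (ell Ox)).
exact: (elliptic_unit c0 (ell Ox)).
Qed.

(** Discriminant of the nonnegative polynomial in [t] obtained by applying the form of [M] to
    [invmx M u - t v]. It lets the source be measured in the dual weight. *)
Lemma ip_dual_CauchySchwarz O M (c : R) u v : measurable O -> bounded_tensor O M ->
  0 < c -> tensor_sym O M -> tensor_elliptic O c M -> vectorL2 O u -> vectorL2 O v ->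
  ip O u v ^+ 2 <= ip O (tapp (tinv M) u) u * ip O (tapp M v) v.
Proof.
move=> mO Mb c0 Ms ell uL vL.
have Ib := bounded_tensor_inv mO Mb c0 ell.
have iuL := tapp_L2 mO Ib uL; have mvL := tapp_L2 mO Mb vL.
have Mp := tensor_elliptic_psd c0 ell.
have vv0 := ip_tapp_ge0 v Mp.
have inv : ae_eq_on O (tapp M (tapp (tinv M) u)) u.
  apply: filterS ell => x ell Ox; rewrite /tapp /tinv mulKVmx//.
  exact: (elliptic_unit c0 (ell Ox)).
have Q (t : R) : 0 <= t ^+ 2 * ip O (tapp M v) v - 2 * t * ip O u v + ip O (tapp (tinv M) u) u.
  have := ip_tapp_ge0 ((- t) *: v + tapp (tinv M) u) Mp.
  rewrite tapp_lin.
  have sL : vectorL2 O ((- t) *: v + tapp (tinv M) u) by exact: vectorL2_lin.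
  rewrite (ip_linl (- t) mO mvL (tapp_L2 mO Mb iuL) sL) !ip_linr// ?(ip_ael _ inv)//; try exact: tapp_L2.
  have E1 : ip O (tapp M v) (tapp (tinv M) u) = ip O u v.
    by rewrite ip_tapp_sym// (ip_aer _ inv) ipC.
  rewrite E1 (ipC _ u (tapp _ _)).
  move: (ip O u v) (ip O (tapp M v) v) (ip O (tapp (tinv M) u) u) => p q r h.
  by have -> : t ^+ 2 * q - 2 * t * p + r = - t * (- t * q + p) + (- t * p + r) by ring.
have [v0|v0] := eqVneq (ip O (tapp M v) v) 0.
  rewrite v0 mulr0; have [->|uv] := eqVneq (ip O u v) 0; first by rewrite expr0n.
  (* Without its quadratic term the polynomial is affine in [t]; this [t] gives it the value -1. *)
  exfalso; have := Q ((ip O (tapp (tinv M) u) u + 1) / (2 * ip O u v)).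
  rewrite v0 mulr0 sub0r (_ : 2 * _ * _ = ip O (tapp (tinv M) u) u + 1); last first.
    by field.
  lra.
have vp : 0 < ip O (tapp M v) v by rewrite lt_def v0.
have := Q (ip O u v / ip O (tapp M v) v).
set p := ip O u v; set q := ip O (tapp M v) v in vp v0 *; set r := ip O _ u.
have -> : (p / q) ^+ 2 * q - 2 * (p / q) * p + r = r - p ^+ 2 / q.
  by field.
by rewrite subr_ge0 ler_pdivrMr.
Qed.

End Tensors.

(** * The Crank-Nicolson scheme *)

Section LinearOn.
Variables (K : fieldType) (U : lmodType K) (D : set U).
Hypothesis D0 : D 0.
Hypothesis Dlin : forall c u v, D u -> D v -> D (c *: u + v).

Lemma lin_closedZ c u : D u -> D (c *: u).
Proof. by move=> Du; rewrite -[_ *: _]addr0; exact: Dlin. Qed.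

Lemma lin_closedD u v : D u -> D v -> D (u + v).
Proof. by move=> Du Dv; rewrite -[u]scale1r; exact: Dlin. Qed.

Lemma lin_closedB u v : D u -> D v -> D (u - v).
Proof. by move=> Du Dv; rewrite addrC -scaleN1r; exact: Dlin. Qed.

Variable f : U -> K.
Hypothesis fl : linear_on D f.

Lemma linear_onZ c u : D u -> f (c *: u) = c * f u.
Proof. by move=> Du; rewrite -[_ *: _]addr0 fl// (linear_on0 D0 fl) addr0. Qed.

Lemma linear_onD u v : D u -> D v -> f (u + v) = f u + f v.
Proof. by move=> Du Dv; rewrite -[u in LHS]scale1r fl// mul1r. Qed.

Lemma linear_onB u v : D u -> D v -> f (u - v) = f u - f v.
Proof. by move=> Du Dv; rewrite addrC -scaleN1r fl// mulN1r addrC. Qed.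

End LinearOn.

Section SymmetricForms.
Variables (K : realFieldType) (U : lmodType K) (D : set U).
Hypothesis D0 : D 0.
Hypothesis Dlin : forall c u v, D u -> D v -> D (c *: u + v).
Variable b : U -> U -> K.
Hypothesis bl : forall w, D w -> linear_on D (b ^~ w).
Hypothesis bC : forall u v, b u v = b v u.

Let br u : D u -> linear_on D (b u).
Proof. by move=> Du c v w Dv Dw; rewrite bC bl// ![b _ u]bC. Qed.

(** The cross terms cancel by symmetry. This identity is why the balance is exact, with no remainder
    in [dt]. *)
Lemma form_dquot_midpoint (dt : K) u v : D u -> D v ->
  b (dt^-1 *: (v - u)) (2^-1 *: (v + u)) = (2 * dt)^-1 * (b v v - b u u).
Proof.
move=> Du Dv.
have Ds := lin_closedD Dlin Dv Du; have Dd := lin_closedB Dlin Dv Du.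
have Dm := lin_closedZ D0 Dlin 2^-1 Ds.
rewrite (linear_onZ D0 (bl Dm))// (linear_onZ D0 (br Dd))// (linear_onB (bl Ds))//.
rewrite (linear_onD (br Dv))// (linear_onD (br Du))// (bC u v) invfM.
by ring.
Qed.

(** The gap between the two sides is a quarter of [b (v - u) (v - u)]. *)
Lemma form_midpoint_le u v : D u -> D v -> (forall w, D w -> 0 <= b w w) ->
  b (2^-1 *: (v + u)) (2^-1 *: (v + u)) <= 2^-1 * (b v v + b u u).
Proof.
move=> Du Dv b0.
have Ds := lin_closedD Dlin Dv Du; have Dd := lin_closedB Dlin Dv Du.
have Dm := lin_closedZ D0 Dlin 2^-1 Ds.
rewrite (linear_onZ D0 (bl Dm))// (linear_onZ D0 (br Ds))// (linear_onD (bl Ds))//.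
rewrite (linear_onD (br Dv))// (linear_onD (br Du))// (bC u v).
have := b0 _ Dd; rewrite (linear_onB (bl Dd))//.
rewrite (linear_onB (br Dv))// (linear_onB (br Du))// (bC u v).
by move: (b u u) (b v u) (b v v) => x y z; lra.
Qed.

End SymmetricForms.

Section RealLemmas.
Variable R : realType.

(** [y - x] factors as a difference of squares of the roots, and the common factor is divided
    out. *)
Lemma sqrt_growth (x y c : R) : 0 <= x -> 0 <= y -> 0 <= c ->
  y - x <= c * (Num.sqrt y + Num.sqrt x) -> Num.sqrt y <= Num.sqrt x + c.
Proof.
move=> x0 y0 c0; rewrite -{1}(sqr_sqrtr x0) -{1}(sqr_sqrtr y0).
have := sqrtr_ge0 x; have := sqrtr_ge0 y.
move: (Num.sqrt x) (Num.sqrt y) => a b b0 a0.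
by rewrite subr_sqr => h; rewrite leNgt; apply/negP => ab; nra.
Qed.

Lemma le_mul_sqrt (p x y z c : R) : 0 <= c -> 0 <= x -> 0 <= y ->
  p ^+ 2 <= c ^+ 2 * z -> z <= 2^-1 * (y + x) -> p <= c * (Num.sqrt y + Num.sqrt x).
Proof.
move=> c0 x0 y0 pz zyx.
have s0 : 0 <= Num.sqrt y + Num.sqrt x by rewrite addr_ge0 ?sqrtr_ge0.
apply: (le_trans (ler_norm p)); rewrite -[leRHS]ger0_norm ?mulr_ge0//.
rewrite -ler_sqr ?nnegrE// !real_normK ?num_real// exprMn.
apply: (le_trans pz); rewrite ler_wpM2l ?sqr_ge0// (le_trans zyx)//.
rewrite -{1}(sqr_sqrtr x0) -{1}(sqr_sqrtr y0).
have := sqrtr_ge0 x; have := sqrtr_ge0 y.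
by move: (Num.sqrt x) (Num.sqrt y) => a b b0 a0; nra.
Qed.

Lemma le_add_nonneg (p p' q q' x y : R) : 0 <= q -> 0 <= q' -> 0 <= x -> 0 <= y ->
  p + p' <= (p + q) + (x + y) + ((p' + q') + x).
Proof. by lra. Qed.

Lemma lincomb3 (c x x' y y' z z' : R) :
  (c * x + x') + (c * y + y') - (c * z + z') = c * (x + y - z) + (x' + y' - z').
Proof. by ring. Qed.

Lemma lincomb3_weighted (p q c x x' y y' z z' : R) :
  p * (c * x + x') + (c * y + y') + q * (c * z + z') =
  c * (p * x + y + q * z) + (p * x' + y' + q * z').
Proof. by ring. Qed.

Lemma lincomb3_weighted_mid (p c x x' y y' z z' : R) :
  (c * x + x') + p * (c * y + y') + (c * z + z') =
  c * (x + p * y + z) + (x' + p * y' + z').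
Proof. by ring. Qed.

Lemma eliminate_known (p q x y s z f w : R) : p * x + s + q * z = f + p * y + w ->
  p * (x - y) + s - (- q * z + w) = f.
Proof. by move=> h; rewrite -[f](addrK (p * y + w)) [f + (_ + _)]addrA -h; ring. Qed.

Lemma sum_sqr_le (F : nat -> R) m :
  (\sum_(0 <= n < m) F n) ^+ 2 <= m%:R * \sum_(0 <= n < m) F n ^+ 2.
Proof.
case: m => [|m]; first by rewrite !big_geq// expr0n mul0r.
set S := \sum_(_ <= _ < _) F _; set Q := \sum_(_ <= _ < _) _ ^+ 2.
have H (t : R) : 2 * t * S <= Q + m.+1%:R * t ^+ 2.
  have -> : m.+1%:R * t ^+ 2 = \sum_(0 <= n < m.+1) t ^+ 2.
    by rewrite sumr_const_nat subn0 mulr_natl.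
  rewrite /S mulr_sumr /Q -big_split/=.
  apply: ler_sum => n _; have := sqr_ge0 (F n - t).
  by rewrite !expr2; move: (F n) => a; lra.
have m0 : 0 < m.+1%:R :> R by rewrite ltr0n.
(* The mean is the optimal [t] in the sum of the squares of [F n - t]. *)
have := H (S / m.+1%:R); rewrite -(ler_pM2l m0) => h.
rewrite -(lerD2r (S ^+ 2)); apply: le_trans _ (le_trans h _).
  by rewrite le_eqVlt; apply/orP; left; apply/eqP; field; rewrite lt0r_neq0.
by rewrite le_eqVlt; apply/orP; left; apply/eqP; field; rewrite lt0r_neq0.
Qed.

End RealLemmas.

(** * One time step in abstract linear spaces with the curl of [V] inside [W] *)

Section Scheme.
Variable R : realType.
Variables (O : set (space3 R)) (V W : set (vfield R)).
Variables (eps mu sigma : space3 R -> 'M[R]_3) (eps0 mu0 dt : R).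
Hypotheses (oO : open O) (bO : bounded_set O).
Hypotheses (epsb : bounded_tensor O eps) (mub : bounded_tensor O mu)
  (sigmab : bounded_tensor O sigma).
Hypotheses (epss : tensor_sym O eps) (mus : tensor_sym O mu)
  (sigmas : tensor_sym O sigma).
Hypotheses (eps0_gt0 : 0 < eps0) (mu0_gt0 : 0 < mu0).
Hypotheses (epse : tensor_elliptic O eps0 eps) (mue : tensor_elliptic O mu0 mu).
Hypothesis sigmap : tensor_psd O sigma.
Hypothesis dt_gt0 : 0 < dt.
Hypotheses (VH : V `<=` Hcurl O) (WL : W `<=` vectorL2 O).
Hypothesis Vlin : forall c u v, V u -> V v -> V (c *: u + v).
Hypothesis Wlin : forall c u v, W u -> W v -> W (c *: u + v).
Hypothesis VW : forall v, V v -> W (wcurl O v).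
Implicit Types u v w E B g : vfield R.

Let mO : measurable O := open_measurable3 oO.
Let VL : V `<=` vectorL2 O := fun v Vv => Hcurl_L2 (VH Vv).
Let muinvb : bounded_tensor O (tinv mu) := bounded_tensor_inv mO mub mu0_gt0 mue.
Let muinvs : tensor_sym O (tinv mu) := tensor_sym_inv mus.
Let muinvp : tensor_psd O (tinv mu) := tensor_psd_inv mu0_gt0 mue.
Let epsp : tensor_psd O eps := tensor_elliptic_psd eps0_gt0 epse.

Local Notation L2 := (vectorL2 O).
Local Notation form M := (fun u v => ip O (tapp M u) v).
Local Notation step := (cn_step O V W eps mu sigma dt).

Let L20 : L2 0 := vectorL2_0 mO.
Let L2lin c u v : L2 u -> L2 v -> L2 (c *: u + v) := vectorL2_lin c mO.

Lemma form_linl M : bounded_tensor O M ->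
  forall w, L2 w -> linear_on L2 (form M ^~ w).
Proof.
move=> Mb w wL c u v uL vL /=.
by rewrite tapp_lin (ip_linl c mO (tapp_L2 mO Mb uL) (tapp_L2 mO Mb vL) wL).
Qed.

Lemma form_linr M : bounded_tensor O M ->
  forall u, L2 u -> linear_on L2 (form M u).
Proof.
move=> Mb w wL c u v uL vL /=.
by rewrite (ip_linr c mO uL vL (tapp_L2 mO Mb wL)).
Qed.

Lemma formC M u v : tensor_sym O M -> form M u v = form M v u.
Proof. by move=> Ms /=; rewrite (ip_tapp_sym _ _ Ms) ipC. Qed.

(** Twice the energy, as a sum of two quadratic forms, so that energy identities become bilinear
    algebra. *)
Definition discrete_energy E B := form eps E E + form (tinv mu) B B.

Lemma discrete_energy_ge0 E B : 0 <= discrete_energy E B.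
Proof.
by rewrite /discrete_energy; apply: addr_ge0; exact: ip_tapp_ge0.
Qed.

Lemma energyE E B : energy O eps mu E B = 2^-1 * discrete_energy E B.
Proof.
by rewrite /energy (L2norm_tsqrt _ epss epsp) (L2norm_tinv_tsqrt _ mu0_gt0 mus mue).
Qed.

Let V0 E : V E -> V 0.
Proof.
by move=> VE; have := Vlin (-1) VE VE; rewrite scaleN1r addNr.
Qed.

Let W0 B : W B -> W 0.
Proof.
by move=> WB; have := Wlin (-1) WB WB; rewrite scaleN1r addNr.
Qed.

Lemma midpoint_closed E0 E1 : V E0 -> V E1 -> V (midpoint E0 E1).
Proof.
move=> VE0 VE1; exact: (lin_closedZ (V0 VE0) Vlin _ (lin_closedD Vlin VE1 VE0)).
Qed.

Lemma dquot_closed B0 B1 : W B0 -> W B1 -> W (dquot dt B0 B1).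
Proof.
move=> WB0 WB1; exact: (lin_closedZ (W0 WB0) Wlin _ (lin_closedB Wlin WB1 WB0)).
Qed.

Lemma L2_midpoint u v : L2 u -> L2 v -> L2 (midpoint u v).
Proof.
move=> uL vL; exact: (lin_closedZ L20 L2lin _ (lin_closedD L2lin vL uL)).
Qed.

(* curl V is contained in W, so the second equation of the scheme holds almost
   everywhere. *)
Lemma faraday E0 B0 g E1 B1 : V E0 -> W B0 -> V E1 -> W B1 ->
  step E0 B0 g E1 B1 ->
  ae_eq_on O (wcurl O (midpoint E0 E1)) ((-1) *: dquot dt B0 B1).
Proof.
move=> VE0 WB0 VE1 WB1 [_ far].
have WE := VW (midpoint_closed VE0 VE1); have WB := dquot_closed WB0 WB1.
have Ws := lin_closedD Wlin WB WE.
have : ae_eq_on O (dquot dt B0 B1 + wcurl O (midpoint E0 E1)) 0.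
  apply: (ip_eq0 mO (WL Ws)).
  by rewrite (ipDl mO (WL WB) (WL WE) (WL Ws)); exact: (far _ Ws).
apply: filterS => x h Ox; have /eqP := h Ox.
rewrite (_ : (_ + _) x = dquot dt B0 B1 x + wcurl O (midpoint E0 E1) x)//.
rewrite (_ : (0 : vfield R) x = 0)// addrC addr_eq0 => /eqP ->.
by rewrite -[RHS]/(-1 *: dquot dt B0 B1 x) scaleN1r.
Qed.

Lemma step_energy E0 B0 g E1 B1 : V E0 -> W B0 -> V E1 -> W B1 ->
  step E0 B0 g E1 B1 ->
  (2 * dt)^-1 * (discrete_energy E1 B1 - discrete_energy E0 B0) +
    form sigma (midpoint E0 E1) (midpoint E0 E1) = ip O g (midpoint E0 E1).
Proof.
move=> VE0 WB0 VE1 WB1 st; have far := faraday VE0 WB0 VE1 WB1 st.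
have [amp _] := st; have Vm := midpoint_closed VE0 VE1.
rewrite -(amp _ Vm) (ip_aer _ far).
have LdB := WL (dquot_closed WB0 WB1).
have LmB : L2 (midpoint B0 B1) by exact: (L2_midpoint (WL WB0) (WL WB1)).
rewrite (ipZr (-1) mO LdB (tapp_L2 mO muinvb LmB)).
rewrite (formC _ (dquot _ _ _) muinvs).
have eE := form_dquot_midpoint L20 L2lin (form_linl epsb)
  (fun u v => formC u v epss) dt (VL VE0) (VL VE1).
have eB := form_dquot_midpoint L20 L2lin (form_linl muinvb)
  (fun u v => formC u v muinvs) dt (WL WB0) (WL WB1).
rewrite -/(dquot dt E0 E1) -/(midpoint E0 E1) in eE.
rewrite -/(dquot dt B0 B1) -/(midpoint B0 B1) in eB.
rewrite eE eB /discrete_energy; move: (form sigma _ _) => s.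
by ring.
Qed.

Definition source_norm g := L2norm O (tapp (tinv (tsqrt eps)) g).

Lemma source_norm_sq g : source_norm g ^+ 2 = form (tinv eps) g g.
Proof. exact: (L2norm_tinv_tsqrt _ eps0_gt0 epss epse). Qed.

(* x is the dissipation accumulated before the step. *)
Lemma step_growth x E0 B0 g E1 B1 : 0 <= x -> V E0 -> W B0 -> L2 g -> V E1 -> W B1 ->
  step E0 B0 g E1 B1 ->
  Num.sqrt (discrete_energy E1 B1 +
    (x + 2 * dt * form sigma (midpoint E0 E1) (midpoint E0 E1))) <=
  Num.sqrt (discrete_energy E0 B0 + x) + 2 * dt * source_norm g.
Proof.
move=> x0 VE0 WB0 gL VE1 WB1 st; have := step_energy VE0 WB0 VE1 WB1 st.
have s0 : 0 <= form sigma (midpoint E0 E1) (midpoint E0 E1).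
  exact: (ip_tapp_ge0 _ sigmap).
have mL := L2_midpoint (VL VE0) (VL VE1).
have CS := ip_dual_CauchySchwarz mO epsb eps0_gt0 epss epse gL mL.
have mid := form_midpoint_le L20 L2lin (form_linl epsb)
  (fun u v => formC u v epss) (VL VE0) (VL VE1) (fun w _ => ip_tapp_ge0 w epsp).
rewrite -/(midpoint E0 E1) /= in mid; rewrite -source_norm_sq in CS.
have e0 := discrete_energy_ge0 E0 B0; have e1 := discrete_energy_ge0 E1 B1.
have b0 := ip_tapp_ge0 B0 muinvp; have b1 := ip_tapp_ge0 B1 muinvp.
have a0 : 0 <= source_norm g by exact: L2norm_ge0.
set s := form sigma _ _ in s0 *; set q0 := discrete_energy E0 B0 in e0 *.
set q1 := discrete_energy E1 B1 in e1 *; set p := ip O g _ in CS *.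
set z := ip O _ _ in CS mid.
(* The midpoint costs only the mean of the two electric energies; nonnegative magnetic energies and
   dissipation are added to reach the quantities under the roots. *)
have zq : z <= 2^-1 * ((q1 + (x + 2 * dt * s)) + (q0 + x)).
  apply: (le_trans mid); rewrite ler_pM2l ?invr_gt0//.
  have ds : 0 <= 2 * dt * s by rewrite !mulr_ge0// ltW.
  exact: le_add_nonneg.
have y0 : 0 <= q0 + x by exact: addr_ge0.
have y1 : 0 <= q1 + (x + 2 * dt * s).
  by rewrite (addr_ge0 e1)// (addr_ge0 x0)// mulr_ge0// mulr_ge0// ltW.
move=> bal; apply: sqrt_growth => //; first by rewrite !mulr_ge0// ltW.
have pa := le_mul_sqrt a0 y0 y1 CS zq.
have -> : q1 + (x + 2 * dt * s) - (q0 + x) = 2 * dt * p.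
  by rewrite -bal; field; rewrite lt0r_neq0.
by rewrite -[leRHS]mulrA ler_pM2l// mulr_gt0.
Qed.

Lemma dquot_lin c u0 u1 v0 v1 :
  dquot dt (c *: u0 + v0) (c *: u1 + v1) = c *: dquot dt u0 u1 + dquot dt v0 v1.
Proof.
rewrite /dquot scalerA mulrC -scalerA -scalerDr; congr (_ *: _).
by rewrite scalerBr opprD addrACA.
Qed.

Lemma midpoint_lin c u0 u1 v0 v1 :
  midpoint (c *: u0 + v0) (c *: u1 + v1) = c *: midpoint u0 u1 + midpoint v0 v1.
Proof.
rewrite /midpoint scalerA mulrC -scalerA -scalerDr; congr (_ *: _).
by rewrite scalerDr addrACA.
Qed.

Lemma form_wcurl_linl w : L2 w ->
  linear_on V (fun u => form (tinv mu) (wcurl O u) w).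
Proof.
move=> wL c u v Vu Vv /=.
rewrite (ip_ael _ (tapp_ae _ (wcurl_lin c oO bO (VH Vu) (VH Vv)))).
exact: (form_linl muinvb wL c (WL (VW Vu)) (WL (VW Vv))).
Qed.

Lemma form_wcurl_linr w : L2 w ->
  linear_on V (fun u => form (tinv mu) w (wcurl O u)).
Proof.
move=> wL c u v Vu Vv /=; rewrite !(formC w _ muinvs).
exact: (form_wcurl_linl wL c Vu Vv).
Qed.

Lemma step_lin c E0 B0 g E1 B1 E0' B0' g' E1' B1' :
  V E0 -> W B0 -> L2 g -> V E1 -> W B1 ->
  V E0' -> W B0' -> L2 g' -> V E1' -> W B1' ->
  step E0 B0 g E1 B1 -> step E0' B0' g' E1' B1' ->
  step (c *: E0 + E0') (c *: B0 + B0') (c *: g + g') (c *: E1 + E1') (c *: B1 + B1').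
Proof.
move=> VE0 WB0 gL VE1 WB1 VE0' WB0' gL' VE1' WB1' [st1 st2] [st1' st2'].
have Vm := midpoint_closed VE0 VE1; have Vm' := midpoint_closed VE0' VE1'.
have dE := lin_closedZ L20 L2lin dt^-1 (lin_closedB L2lin (VL VE1) (VL VE0)).
have dE' := lin_closedZ L20 L2lin dt^-1 (lin_closedB L2lin (VL VE1') (VL VE0')).
have mB := L2_midpoint (WL WB0) (WL WB1); have mB' := L2_midpoint (WL WB0') (WL WB1').
have dB := WL (dquot_closed WB0 WB1); have dB' := WL (dquot_closed WB0' WB1').
split=> [psi Vpsi|phi Wphi]; rewrite !dquot_lin !midpoint_lin.
- have pL := VL Vpsi; have cL := WL (VW Vpsi).
  rewrite (form_linl epsb pL c dE dE') (form_linl sigmab pL c (VL Vm) (VL Vm')).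
  rewrite (form_linl muinvb cL c mB mB') (ip_linl c mO gL gL' pL).
  rewrite -(st1 _ Vpsi) -(st1' _ Vpsi).
  exact: lincomb3.
- have pL := WL Wphi.
  rewrite (ip_ael _ (wcurl_lin c oO bO (VH Vm) (VH Vm'))).
  rewrite (ip_linl c mO dB dB' pL) (ip_linl c mO (WL (VW Vm)) (WL (VW Vm')) pL).
  have h := st2 _ Wphi; have h' := st2' _ Wphi.
  by rewrite addrACA -mulrDr h h' mulr0 addr0.
Qed.

Lemma L2norm_discrete_energy : exists2 c : R, 0 < c &
  forall E B, L2 E -> L2 B ->
    L2norm O E + L2norm O B <= c * Num.sqrt (discrete_energy E B).
Proof.
have [m m0 Hm] := ip_tapp_inv_lower mO mub mu0_gt0 mue.
pose k := Num.min eps0 m; have k0 : 0 < k by rewrite lt_min eps0_gt0.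
(* [k] is a common coercivity constant, and 2 comes from bounding the square of a sum of two
   norms. *)
exists (Num.sqrt (2 / k)) => [|E B EL BL]; first by rewrite sqrtr_gt0 divr_gt0.
have kE := le_trans _ (ip_tapp_elliptic mO epsb EL epse).
have {}kE : k * ip O E E <= form eps E E.
  by apply: kE; rewrite ler_wpM2r ?ip_ge0// ge_min lexx.
have kB : k * ip O B B <= form (tinv mu) B B.
  by apply: (le_trans _ (Hm _ BL)); rewrite ler_wpM2r ?ip_ge0// ge_min lexx orbT.
rewrite -sqrtrM ?divr_ge0 ?(ltW k0)//.
have nE := L2norm_ge0 O E; have nB := L2norm_ge0 O B.
rewrite -[leLHS]ger0_norm ?addr_ge0// -sqrtr_sqr ler_wsqrtr//.
rewrite mulrAC ler_pdivlMr//; move: kE kB; rewrite -!L2norm_sq /discrete_energy.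
move: (form eps E E) (form (tinv mu) B B) (L2norm O E) (L2norm O B) => p q x y pk qk.
have := mulr_ge0 (ltW k0) (sqr_ge0 (x - y)).
rewrite !expr2 in pk qk *.
move: k pk qk {k0 nE nB} => k; nra.
Qed.

Lemma discrete_energy_L2norm : exists2 c : R, 0 < c &
  forall E B, L2 E -> L2 B ->
    Num.sqrt (discrete_energy E B) <= c * (L2norm O E + L2norm O B).
Proof.
have [m m0 Hm] := ip_tapp_upper mO epsb; have [m' m'0 Hm'] := ip_tapp_upper mO muinvb.
pose k := m + m'; have k0 : 0 < k by exact: addr_gt0.
exists (Num.sqrt k) => [|E B EL BL]; first by rewrite sqrtr_gt0.
have nE := L2norm_ge0 O E; have nB := L2norm_ge0 O B.
rewrite -[X in _ * X]ger0_norm ?addr_ge0// -sqrtr_sqr -sqrtrM ?(ltW k0)//.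
rewrite ler_wsqrtr// (le_trans (lerD (Hm _ EL) (Hm' _ BL)))//.
rewrite -!L2norm_sq /k; move: (L2norm O E) (L2norm O B) nE nB => x y x0 y0.
have h1 := mulr_ge0 (ltW m0) (sqr_ge0 y); have h2 := mulr_ge0 (ltW m'0) (sqr_ge0 x).
have h3 := mulr_ge0 (ltW k0) (mulr_ge0 x0 y0).
by rewrite /k in h3; nra.
Qed.

Lemma source_norm_L2norm : exists2 c : R, 0 < c &
  forall g, L2 g -> source_norm g <= c * L2norm O g.
Proof.
have epsib := bounded_tensor_inv mO epsb eps0_gt0 epse.
have [m m0 Hm] := ip_tapp_upper mO epsib.
exists (Num.sqrt m) => [|g gL]; first by rewrite sqrtr_gt0.
rewrite -[source_norm g]ger0_norm ?L2norm_ge0// -sqrtr_sqr.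
rewrite -[X in _ * X]ger0_norm ?L2norm_ge0// -sqrtr_sqr -sqrtrM ?(ltW m0)//.
by rewrite ler_wsqrtr// source_norm_sq L2norm_sq; exact: Hm.
Qed.

Lemma step_stable : exists2 C : R, 0 < C & forall E0 B0 g E1 B1,
  V E0 -> W B0 -> L2 g -> V E1 -> W B1 -> step E0 B0 g E1 B1 ->
  L2norm O E1 + L2norm O B1 <= C * (L2norm O E0 + L2norm O B0 + L2norm O g).
Proof.
have [c c0 Hc] := L2norm_discrete_energy; have [d d0 Hd] := discrete_energy_L2norm.
have [e e0 He] := source_norm_L2norm.
(* [c] and [d] compare norms with the root of the energy, and [2 * dt * e] carries the source; this
   constant belongs to a single step and may depend on [dt]. *)
exists (c * (d + 2 * dt * e)); first by rewrite mulr_gt0// addr_gt0// !mulr_gt0.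
move=> E0 B0 g E1 B1 VE0 WB0 gL VE1 WB1 st.
have := step_growth (lexx 0) VE0 WB0 gL VE1 WB1 st; rewrite !add0r addr0 => gr.
apply: (le_trans (Hc _ _ (VL VE1) (WL WB1))).
rewrite -mulrA ler_pM2l//.
have s0 : 0 <= 2 * dt * form sigma (midpoint E0 E1) (midpoint E0 E1).
  by rewrite mulr_ge0 ?ip_tapp_ge0// mulr_ge0// ltW.
have h1 : Num.sqrt (discrete_energy E1 B1) <=
    Num.sqrt (discrete_energy E0 B0) + 2 * dt * source_norm g.
  by apply: (le_trans _ gr); rewrite ler_wsqrtr// lerDl.
apply: (le_trans h1); have h2 := Hd _ _ (VL VE0) (WL WB0).
have h3 : 2 * dt * source_norm g <= 2 * dt * (e * L2norm O g).
  by rewrite ler_pM2l ?He// mulr_gt0.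
apply: (le_trans (lerD h2 h3)).
have nE := L2norm_ge0 O E0; have nB := L2norm_ge0 O B0; have ng := L2norm_ge0 O g.
rewrite [leRHS](mulrDl d) [X in _ + X <= _](mulrA (2 * dt)); apply: lerD.
  by rewrite ler_pM2l// lerDl.
by rewrite ler_pM2l ?mulr_gt0// lerDr addr_ge0.
Qed.

Lemma step_continuous : exists2 C : R, 0 < C &
  forall E0 B0 g E1 B1 E0' B0' g' E1' B1',
  V E0 -> W B0 -> L2 g -> V E1 -> W B1 ->
  V E0' -> W B0' -> L2 g' -> V E1' -> W B1' ->
  step E0 B0 g E1 B1 -> step E0' B0' g' E1' B1' ->
  L2norm O (E1 - E1') + L2norm O (B1 - B1') <=
  C * (L2norm O (E0 - E0') + L2norm O (B0 - B0') + L2norm O (g - g')).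
Proof.
have [C C0 HC] := step_stable; exists C => //.
move=> E0 B0 g E1 B1 E0' B0' g' E1' B1'.
move=> VE0 WB0 gL VE1 WB1 VE0' WB0' gL' VE1' WB1' st st'.
have := step_lin (-1) VE0' WB0' gL' VE1' WB1' VE0 WB0 gL VE1 WB1 st' st.
have eq u v : -1 *: u + v = v - u by rewrite scaleN1r addrC.
rewrite !{}eq; apply: HC.
- exact: (lin_closedB Vlin).
- exact: (lin_closedB Wlin).
- exact: (lin_closedB L2lin).
- exact: (lin_closedB Vlin).
- exact: (lin_closedB Wlin).
Qed.

Lemma L2norm_sub_eq0 u v : L2 u -> L2 v -> L2norm O (u - v) = 0 -> ae_eq_on O u v.
Proof.
move=> uL vL /(L2norm_eq0 mO (vectorL2_B mO uL vL)).
apply: filterS => x h Ox; apply/eqP; rewrite -subr_eq0; apply/eqP.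
exact: (h Ox).
Qed.

Lemma step_unique E0 B0 g E1 B1 E1' B1' :
  V E0 -> W B0 -> L2 g -> V E1 -> W B1 -> V E1' -> W B1' ->
  step E0 B0 g E1 B1 -> step E0 B0 g E1' B1' ->
  ae_eq_on O E1' E1 /\ ae_eq_on O B1' B1.
Proof.
move=> VE0 WB0 gL VE1 WB1 VE1' WB1' st st'; have [C C0 HC] := step_continuous.
have := HC _ _ _ _ _ _ _ _ _ _ VE0 WB0 gL VE1' WB1' VE0 WB0 gL VE1 WB1 st' st.
have n0 : L2norm O 0 = 0 by rewrite /L2norm ip0l sqrtr0.
rewrite !subrr !n0 !addr0 mulr0 => le0.
have nE := L2norm_ge0 O (E1' - E1); have nB := L2norm_ge0 O (B1' - B1).
have := paddr_eq0 nE nB; rewrite eq_le le0 addr_ge0//= => /esym/andP[/eqP zE /eqP zB].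
by split; apply: L2norm_sub_eq0 => //; try exact: VL; exact: WL.
Qed.

Section Existence.
Hypothesis Vspan : exists n (b : 'I_n -> vfield R), (forall i, V (b i)) /\
  forall v, V v -> exists c : 'I_n -> R, ae_eq_on O v (\sum_i c i *: b i).

(* The equation for the midpoint obtained by eliminating the new magnetic field. *)
Let lhs u v := 2 / dt * form eps u v + form sigma u v +
  dt / 2 * form (tinv mu) (wcurl O u) (wcurl O v).

Let rhs E0 B0 g v := ip O g v + 2 / dt * form eps E0 v +
  form (tinv mu) B0 (wcurl O v).

Lemma step_exists E0 B0 g : V E0 -> W B0 -> L2 g ->
  exists E1 B1, [/\ V E1, W B1 & step E0 B0 g E1 B1].
Proof.
move=> VE0 WB0 gL; have V00 := V0 VE0.
have lhsl w : V w -> linear_on V (lhs ^~ w).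
  move=> Vw c u v Vu Vv; rewrite /lhs.
  rewrite (form_linl epsb (VL Vw) c (VL Vu) (VL Vv)).
  rewrite (form_linl sigmab (VL Vw) c (VL Vu) (VL Vv)).
  rewrite (form_wcurl_linl (WL (VW Vw)) c Vu Vv).
  exact: lincomb3_weighted.
have lhsC u v : lhs u v = lhs v u.
  rewrite /lhs (formC u v epss) (formC u v sigmas).
  by rewrite (formC (wcurl O u) (wcurl O v) muinvs).
have lhsr w : V w -> linear_on V (lhs w).
  by move=> Vw c u v Vu Vv; rewrite lhsC (lhsl _ Vw c _ _ Vu Vv) ![lhs _ w]lhsC.
have rhsl : linear_on V (rhs E0 B0 g).
  move=> c u v Vu Vv; rewrite /rhs (ip_linr c mO (VL Vu) (VL Vv) gL).
  rewrite (form_linr epsb (VL VE0) c (VL Vu) (VL Vv)).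
  rewrite (form_wcurl_linr (WL WB0) c Vu Vv).
  exact: lincomb3_weighted_mid.
(* Fields equal almost everywhere have weak curls equal almost everywhere, so the forms may be
   evaluated on representatives built from the generators. *)
have rhs_ae u v : V u -> V v -> ae_eq_on O u v -> rhs E0 B0 g u = rhs E0 B0 g v.
  move=> Vu Vv uv; rewrite /rhs !(ip_aer _ uv).
  by rewrite (ip_aer _ (wcurl_ae oO bO (VH Vu) (VH Vv) uv)).
have lhs_ae w u v : V u -> V v -> ae_eq_on O u v -> lhs w u = lhs w v.
  move=> Vu Vv uv; rewrite /lhs !(ip_aer _ uv).
  by rewrite (ip_aer _ (wcurl_ae oO bO (VH Vu) (VH Vv) uv)).
have [n [b [Vb span]]] := Vspan.
have [||Eh VEh HEh] := coercive_solve V00 Vlin lhsl lhsr rhsl Vb.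
- move=> v Vv lhs0; rewrite (rhs_ae _ 0)//; first exact: (linear_on0 V00 rhsl).
  have e0 := ip_tapp_ge0 v epsp; have s0 := ip_tapp_ge0 v sigmap.
  have m0 := ip_tapp_ge0 (wcurl O v) muinvp.
  have ell := ip_tapp_elliptic mO epsb (VL Vv) epse.
  apply: (ip_eq0 mO (VL Vv)); apply/eqP; rewrite eq_le ip_ge0 andbT.
  rewrite -(pmulr_rle0 _ eps0_gt0) (le_trans ell)//.
  have k0 : 0 < 2 / dt by rewrite divr_gt0.
  (* All three terms of [lhs v v] are nonnegative, so its vanishing forces the electric one to
     vanish. *)
  rewrite -(pmulr_rle0 _ k0) -lhs0 /lhs -addrA lerDl addr_ge0//.
  by rewrite mulr_ge0// divr_ge0// ltW.
- move=> v Vv; have [c vc] := span v Vv; exists c.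
  have Vc := lincomb_closed V00 Vlin (index_enum 'I_n) c Vb.
  by split=> [|u Vu]; [exact: rhs_ae|exact: lhs_ae].
(* [Eh] is the midpoint, and the magnetic equation dictates [B1]. Hence the difference quotient of
   the electric field is [2 / dt] times [Eh - E0], and the magnetic midpoint is [B0] minus [dt / 2]
   times the curl of [Eh]: the coefficients of [lhs] and [rhs]. *)
pose E1 := 2 *: Eh - E0; pose B1 := (- dt) *: wcurl O Eh + B0.
have mE : midpoint E0 E1 = Eh.
  by rewrite /midpoint subrK scalerA mulVf ?scale1r ?pnatr_eq0.
have dE : dquot dt E0 E1 = (2 / dt) *: (Eh - E0).
  have -> : 2 / dt = dt^-1 * 2 by exact: mulrC.
  rewrite /dquot /E1 -scalerA; congr (_ *: _).
  by rewrite scalerBr -addrA -opprD [in RHS](scaler_nat 2 E0) mulr2n.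
have mB : midpoint B0 B1 = (- (dt / 2)) *: wcurl O Eh + B0.
  rewrite /midpoint /B1 -addrA scalerDr scalerA mulrN [2^-1 * dt]mulrC; congr (_ + _).
  rewrite -[B0 in LHS]scale1r -scalerDl scalerA mulVf ?scale1r//.
have dB : dquot dt B0 B1 = (- 1) *: wcurl O Eh.
  by rewrite /dquot addrK scalerA mulrN mulVf ?lt0r_neq0.
exists E1, B1; split.
- exact: (lin_closedB Vlin (lin_closedZ V00 Vlin _ VEh) VE0).
- exact: (Wlin _ (VW VEh) WB0).
- split=> [psi Vpsi|phi Wphi]; rewrite mE ?dE ?mB ?dB.
    have pL := VL Vpsi; have cL := WL (VW Vpsi).
    have dL := lin_closedB L2lin (VL VEh) (VL VE0).
    have dl := linear_onZ L20 (form_linl epsb pL) (2 / dt) dL.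
    have dl2 := linear_onB (form_linl epsb pL) (VL VEh) (VL VE0).
    rewrite /= in dl dl2; rewrite dl dl2.
    rewrite (form_linl muinvb cL _ (WL (VW VEh)) (WL WB0)).
    have := HEh _ Vpsi; rewrite /lhs /rhs => h.
    exact: (eliminate_known h).
  rewrite (ipZl (-1) mO (WL (VW VEh)) (WL Wphi)).
  by rewrite mulN1r addNr.
Qed.

End Existence.

End Scheme.

(** * Stability over many steps *)

Section Trajectory.
Variable R : realType.
Variables (O : set (space3 R)) (V W : set (vfield R)).
Variables (eps mu sigma : space3 R -> 'M[R]_3) (eps0 mu0 dt : R).
Hypotheses (oO : open O) (bO : bounded_set O).
Hypotheses (epsb : bounded_tensor O eps) (mub : bounded_tensor O mu).
Hypotheses (epss : tensor_sym O eps) (mus : tensor_sym O mu).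
Hypotheses (eps0_gt0 : 0 < eps0) (mu0_gt0 : 0 < mu0).
Hypotheses (epse : tensor_elliptic O eps0 eps) (mue : tensor_elliptic O mu0 mu).
Hypothesis sigmap : tensor_psd O sigma.
Hypothesis dt_gt0 : 0 < dt.
Hypotheses (VH : V `<=` Hcurl O) (WL : W `<=` vectorL2 O).
Hypothesis Vlin : forall c u v, V u -> V v -> V (c *: u + v).
Hypothesis Wlin : forall c u v, W u -> W v -> W (c *: u + v).
Hypothesis VW : forall v, V v -> W (wcurl O v).
Variables E B g : nat -> vfield R.

Local Notation de n := (discrete_energy O eps mu (E n) (B n)).
Local Notation Eh n := (midpoint (E n) (E n.+1)).
Local Notation ds n := (ip O (tapp sigma (Eh n)) (Eh n)).
Local Notation a n := (source_norm O eps (g n)).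

(** The dissipation stays under the root at each step, so one telescoping bound controls both the
    final energy and the accumulated dissipation. *)
Lemma trajectory_growth m :
  (forall n, (n <= m)%N -> V (E n) /\ W (B n)) ->
  (forall n, (n < m)%N -> vectorL2 O (g n)) ->
  (forall n, (n < m)%N -> cn_step O V W eps mu sigma dt (E n) (B n) (g n) (E n.+1) (B n.+1)) ->
  Num.sqrt (de m + \sum_(0 <= n < m) 2 * dt * ds n) <=
  Num.sqrt (de 0%N) + \sum_(0 <= n < m) 2 * dt * a n.
Proof.
elim: m => [_ _ _|m ih EB gL st]; first by rewrite !big_geq// !addr0.
have [VE0 WB0] := EB m (leqnSn m); have [VE1 WB1] := EB m.+1 (leqnn _).
rewrite !big_nat_recr//=.
have S0 : 0 <= \sum_(0 <= n < m) 2 * dt * ds n.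
  apply: sumr_ge0 => n _; apply: mulr_ge0; first by rewrite mulr_ge0// ltW.
  exact: ip_tapp_ge0.
have := step_growth oO epsb mub epss mus eps0_gt0 mu0_gt0 epse mue sigmap dt_gt0
  VH WL Vlin Wlin VW S0 VE0 WB0 (gL _ (leqnn _)) VE1 WB1 (st _ (leqnn _)).
move=> /le_trans; apply; rewrite addrA lerD2r.
by apply: ih => n nm; [apply: EB|apply: gL|apply: st]; rewrite ltnW.
Qed.

Lemma trajectory_bound m (T : R) : m%:R * dt <= T ->
  (forall n, (n <= m)%N -> V (E n) /\ W (B n)) ->
  (forall n, (n < m)%N -> vectorL2 O (g n)) ->
  (forall n, (n < m)%N -> cn_step O V W eps mu sigma dt (E n) (B n) (g n) (E n.+1) (B n.+1)) ->
  2^-1 * de m + dt * \sum_(0 <= n < m) ds n <=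
  (2 + 4 * T) * (2^-1 * de 0%N + \sum_(0 <= n < m) dt * a n ^+ 2).
Proof.
move=> mT EB gL st; have := trajectory_growth EB gL st.
have y0 : 0 <= de m + \sum_(0 <= n < m) 2 * dt * ds n.
  apply: addr_ge0; first exact: (discrete_energy_ge0 eps0_gt0 mu0_gt0 epse mue).
  apply: sumr_ge0 => n _; apply: mulr_ge0; first by rewrite mulr_ge0// ltW.
  exact: ip_tapp_ge0.
have x0 : 0 <= de 0%N by exact: (discrete_energy_ge0 eps0_gt0 mu0_gt0 epse mue).
have CS := sum_sqr_le (fun n => a n) m.
rewrite -!mulr_sumr in y0 *.
set Q := \sum_(_ <= _ < _) _ ^+ 2 in CS *; set A := \sum_(_ <= _ < _) a _ in CS *.
set D := \sum_(_ <= _ < _) _ in y0 *.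
have Q0 : 0 <= Q by apply: sumr_ge0 => n _; exact: sqr_ge0.
have A0 : 0 <= A by apply: sumr_ge0 => n _; exact: L2norm_ge0.
have m0 : 0 <= m%:R * dt by rewrite mulr_ge0 ?ler0n// ltW.
(* The number of steps is traded for the final time, uniformly in [dt]. *)
have {}CS : dt * A ^+ 2 <= T * Q.
  apply: (@le_trans _ _ (m%:R * dt * Q)); last by rewrite ler_wpM2r.
  by rewrite mulrAC mulrC ler_wpM2r// ltW.
move: (de m) (de 0%N) y0 x0 => y x y0 x0.
rewrite -ler_sqr ?nnegrE ?sqrtr_ge0//; last first.
  by rewrite addr_ge0 ?sqrtr_ge0// !mulr_ge0// ltW.
rewrite sqr_sqrtr// => h.
(* The square of a sum is at most twice the sum of squares, which produces 2 and 8. *)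
have h2 : (Num.sqrt x + 2 * dt * A) ^+ 2 <= 2 * x + 8 * (dt * (dt * A ^+ 2)).
  rewrite -[in leRHS](sqr_sqrtr x0).
  have := sqr_ge0 (Num.sqrt x - 2 * dt * A).
  by move: (Num.sqrt x) => s; nra.
have h3 : dt * (dt * A ^+ 2) <= dt * (T * Q) by rewrite ler_pM2l.
have T0 : 0 <= T by exact: le_trans mT.
have h4 := mulr_ge0 T0 x0; have h5 := mulr_ge0 (ltW dt_gt0) Q0.
have {}h : y + 2 * dt * D <= 2 * x + 8 * (T * (dt * Q)).
  by rewrite [T * _]mulrCA (le_trans h)// (le_trans h2)// lerD2l ler_pM2l.
move: (dt * Q) h h5 => z h h5.
(* Halving leaves [x + 4 T z] on the right, where [x] is twice the initial energy; both terms fit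
   under [2 + 4 T] times [x / 2 + z]. *)
rewrite (_ : _ + dt * D = 2^-1 * (y + 2 * dt * D)); last by field.
apply: (@le_trans _ _ (2^-1 * (2 * x + 8 * (T * z)))); first by rewrite ler_pM2l ?invr_gt0.
by move: h4 h5 x0; lra.
Qed.

End Trajectory.

(** * Averages of the source over one time step *)

Section SourceFree.
Variable R : realType.
Implicit Types (O : set (space3 R)) (f : R -> vfield R).

Lemma average_L2 O (a b : R) f g : measurable O -> a < b ->
  is_average O a b f g -> vectorL2 O g.
Proof.
move=> mO ab [gL _]; have := vectorL2_Z (b - a)^-1 mO gL.
by rewrite scalerA mulVf ?scale1r// subr_eq0 gt_eqF.
Qed.

Lemma average_zero O (T a b : R) f g : measurable O -> 0 <= a -> a < b -> b <= T ->
  is_average O a b f g -> zero_in_time O T f -> ae_eq_on O g 0.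
Proof.
move=> mO a0 ab bT avg [N [mN N0 sN]].
have : ae_eq_on O ((b - a) *: g) 0.
  apply: (bochner_integral_zero mO avg); exists N; split => // t nt.
  apply: sN => /= h; apply: nt => tab; apply: h; move: tab.
  rewrite !in_itv/= => /andP[at1 tb].
  by rewrite (le_lt_trans a0 at1) (lt_le_trans tb bT).
apply: filterS => x h Ox; have := h Ox.
rewrite -[LHS]/((b - a) *: g x) => /eqP.
by rewrite scaler_eq0 subr_eq0 gt_eqF//= => /eqP.
Qed.

End SourceFree.

Unset Implicit Arguments.

Theorem lemma1 (R : realType) :
  exists CT : R -> R -> R -> R -> R -> R,
  (forall T eps0 mu0 epsinf muinvinf : R,
     0 < CT T eps0 mu0 epsinf muinvinf) /\
  forall (Omega : set (space3 R)) (T : R)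
    (eps mu sigma : space3 R -> 'M[R]_3) (eps0 mu0 : R)
    (I : Type) (Th : I -> set (set (space3 R))) (h : I)
    (k Nt : nat) (f : R -> vfield R) (favg : nat -> vfield R),
  bounded_lipschitz_domain Omega ->
  0 < T ->
  tensorLinf Omega eps -> tensorLinf Omega mu -> tensorLinf Omega sigma ->
  tensor_sym Omega eps -> tensor_sym Omega mu -> tensor_sym Omega sigma ->
  0 < eps0 -> 0 < mu0 ->
  tensor_elliptic Omega eps0 eps -> tensor_elliptic Omega mu0 mu ->
  tensor_psd Omega sigma ->
  (forall i, is_mesh Omega (Th i)) -> shape_regular Th ->
  (0 < Nt)%N ->
  let dt := T / Nt%:R in
  let t := fun n : nat => n%:R * dt in
  let V := nedelec_space0 Omega (Th h) k in
  let W := raviart_thomas_space Omega (Th h) k in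
  let step := cn_step Omega V W eps mu sigma dt in
  let norm := L2norm Omega in
  L2_in_time Omega T f ->
  (forall n, (n < Nt)%N -> is_average Omega (t n) (t n.+1) f (favg n)) ->
  [/\ 
      forall E0 B0 g, V E0 -> W B0 -> vectorL2 Omega g ->
        exists E1 B1, [/\ V E1, W B1, step E0 B0 g E1 B1 &
          forall E1' B1', V E1' -> W B1' -> step E0 B0 g E1' B1' ->
            ae_eq_on Omega E1' E1 /\ ae_eq_on Omega B1' B1],
      exists2 C : R, 0 < C &
        forall E0 B0 g E1 B1 E0' B0' g' E1' B1',
          V E0 -> W B0 -> vectorL2 Omega g -> V E1 -> W B1 ->
          V E0' -> W B0' -> vectorL2 Omega g' -> V E1' -> W B1' ->
          step E0 B0 g E1 B1 -> step E0' B0' g' E1' B1' ->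
          norm (E1 - E1') + norm (B1 - B1') <=
            C * (norm (E0 - E0') + norm (B0 - B0') + norm (g - g'))
    & forall E B : nat -> vfield R,
        (forall n, (n <= Nt)%N -> V (E n) /\ W (B n)) ->
        (forall n, (n < Nt)%N ->
           step (E n) (B n) (favg n) (E n.+1) (B n.+1)) ->
        let en := fun n => energy Omega eps mu (E n) (B n) in
        let Ehalf := fun n => midpoint (E n) (E n.+1) in
        let diss := fun n => norm (tapp (tsqrt sigma) (Ehalf n)) ^+ 2 in
        [/\ forall n, (n < Nt)%N ->
              (en n.+1 - en n) / dt + diss n = ip Omega (favg n) (Ehalf n),
            zero_in_time Omega T f ->
              forall n, (n < Nt)%N -> en n.+1 <= en n,
            zero_in_time Omega T f ->
            {ae leb3 R, forall x, Omega x -> sigma x = 0} ->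
              forall n, (n < Nt)%N -> en n.+1 = en n
          & forall m, (1 <= m <= Nt)%N ->
              en m + dt * \sum_(0 <= n < m) diss n <=
              CT T eps0 mu0 (Linf_norm Omega eps) (Linf_norm Omega (tinv mu))
              * (en 0%N + \sum_(0 <= n < m)
                   dt * norm (tapp (tinv (tsqrt eps)) (favg n)) ^+ 2)]].
Proof.
(* The constant must be positive at every real argument, hence the absolute value; at a positive
   final time it is [2 + 4 * T]. *)
exists (fun T _ _ _ _ => 2 + 4 * `|T|); split=> [T *|].
  by rewrite ltr_pwDl// mulr_ge0.
move=> O T eps mu sigma eps0 mu0 I Th h k Nt f favg.
move=> [oO _ _ bO _] T0 /bounded_tensor_Linf epsb /bounded_tensor_Linf mub
  /bounded_tensor_Linf sigmab epss mus sigmas eps0_gt0 mu0_gt0 epse mue sigmap.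
move=> mesh _ Nt0 dt t V W step norm _ avg.
have mO := open_measurable3 oO.
have dt0 : 0 < dt by rewrite divr_gt0// ltr0n.
have VH : V `<=` Hcurl O by move=> v [[]].
have WL : W `<=` vectorL2 O by move=> w [[]].
have Vlin c u v : V u -> V v -> V (c *: u + v) by exact: nedelec_space0_lin.
have Wlin c u v : W u -> W v -> W (c *: u + v) by exact: raviart_thomas_space_lin.
have VW v : V v -> W (wcurl O v).
  by move=> [Nv _]; exact: (wcurl_nedelec_space oO bO (mesh h) Nv).
have tT n : (n < Nt)%N -> [/\ 0 <= t n, t n < t n.+1 & t n.+1 <= T].
  move=> nN; split; first by rewrite mulr_ge0 ?ler0n// ltW.
    by rewrite ltr_pM2r// ltr_nat.
  by rewrite /t /dt mulrCA ler_piMr ?(ltW T0)// ler_pdivrMr ?ltr0n// mul1r ler_nat.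
have gL n : (n < Nt)%N -> vectorL2 O (favg n).
  by move=> nN; have [_ lt _] := tT n nN; exact: (average_L2 mO lt (avg _ nN)).
split.
- move=> E0 B0 g VE0 WB0 gL0.
  have span := nedelec_space_spanning oO bO (mesh h) (@subIsetl _ _ _ : V `<=` _).
  have [E1 [B1 [VE1 WB1 st]]] := step_exists oO bO epsb mub sigmab epss mus sigmas
    eps0_gt0 mu0_gt0 epse mue sigmap dt0 VH WL Vlin Wlin VW span VE0 WB0 gL0.
  exists E1, B1; split=> [|||E1' B1' VE1' WB1' st']; [exact: VE1|exact: WB1|exact: st|].
  exact (step_unique oO bO epsb mub sigmab epss mus
    eps0_gt0 mu0_gt0 epse mue sigmap dt0 VH WL Vlin Wlin VW VE0 WB0 gL0 VE1 WB1 VE1' WB1' st st').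
- exact (step_continuous oO bO epsb mub sigmab epss mus
    eps0_gt0 mu0_gt0 epse mue sigmap dt0 VH WL Vlin Wlin VW).
move=> E B EB st en Ehalf diss.
have enE n : en n = 2^-1 * discrete_energy O eps mu (E n) (B n).
  exact: (energyE epss mus eps0_gt0 mu0_gt0 epse mue).
have dissE n : diss n = ip O (tapp sigma (Ehalf n)) (Ehalf n).
  exact: L2norm_tsqrt.
have bal n : (n < Nt)%N -> (en n.+1 - en n) / dt + diss n = ip O (favg n) (Ehalf n).
  move=> nN; have [VE0 WB0] := EB n (ltnW nN); have [VE1 WB1] := EB n.+1 nN.
  rewrite -(step_energy oO epsb mub epss mus mu0_gt0 mue VH WL Vlin Wlin VW
    VE0 WB0 VE1 WB1 (st _ nN)).
  congr (_ + _); last exact: dissE.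
  by rewrite !enE -mulrBr (invfM 2 dt) [LHS]mulrAC.
have src0 n : (n < Nt)%N -> zero_in_time O T f -> ip O (favg n) (Ehalf n) = 0.
  move=> nN z; have [t0 lt tle] := tT n nN.
  by rewrite (ip_ael _ (average_zero mO t0 lt tle (avg _ nN) z)) ip0l.
split; first exact: bal.
- move=> z n nN; have := bal n nN; rewrite src0// => /eqP.
  rewrite addr_eq0 => /eqP drop.
  have dti : 0 < dt^-1 by rewrite invr_gt0.
  by rewrite -subr_le0 -(pmulr_lle0 _ dti) drop oppr_le0 sqr_ge0.
- move=> z s0 n nN; have := bal n nN; rewrite src0// dissE.
  rewrite (@ip_ael _ _ _ 0); last first.
    by apply: filterS s0 => x s0 Ox; rewrite /tapp s0// mul0mx.
  rewrite ip0l addr0 => /eqP.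
  by rewrite mulf_eq0 invr_eq0 (gt_eqF dt0) orbF subr_eq0 => /eqP.
- move=> m /andP[_ mN]; rewrite !enE.
  rewrite (eq_bigr (fun n => ip O (tapp sigma (Ehalf n)) (Ehalf n))) => [|n _]; last exact: dissE.
  rewrite ger0_norm ?(ltW T0)//.
  apply: (trajectory_bound oO epsb mub epss mus
    eps0_gt0 mu0_gt0 epse mue sigmap dt0 VH WL Vlin Wlin VW).
  + by rewrite /dt mulrCA ler_piMr ?(ltW T0)// ler_pdivrMr ?ltr0n// mul1r ler_nat.
  + by move=> n nm; exact: (EB _ (leq_trans nm mN)).
  + by move=> n nm; exact: (gL _ (leq_trans nm mN)).
  + by move=> n nm; exact: (st _ (leq_trans nm mN)).
Qed.
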